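(* There is an algorithm which, for any $\lambda\in(0,1]$ (rational), any $\epsilon\in\mathbb Q_{>0}$ and any differentiable $\lambda$-quasar-convex function $f:\mathcal X\to\mathbb R$ whose gradient mapping $F:=\nabla f$ satisfies assumptions (i)–(ii) listed in the context with parameter $B$ (in particular, $\nabla f$ is not assumed to be Lipschitz continuous), runs in time $\mathrm{poly}(d,\log(B/\epsilon),\log(1/\lambda))$ and outputs a point $x\in\mathcal X$ such that $f(x)\le\min_{x'\in\mathcal X}f(x')+\epsilon$.
   Context: $\|\cdot\|$ is the Euclidean norm. $f:\mathcal X\to\mathbb R$ is differentiable (on an open superset of $\mathcal X$). For $\lambda\in(0,1]$ and a minimizer $x$ of $f$ over $\mathcal X$, $f$ is $\lambda$-quasar-convex (with respect to $x$) if $$f(x)\ge f(x')+\tfrac1\lambda\langle\nabla f(x'),x-x'\rangle\quad\text{for all }x'\in\mathcal X.$$ The minimizer $x$ is not known to the algorithm. $\mathcal X\subseteq\mathbb R^d$ is convex and compact and in isotropic position: a uniformly random $x\in\mathcal X$ has $\mathbb E[x]=0$, $\mathbb E[xx^\top]=I_d$; accordingly, $\mathcal B_1(0)\subseteq\mathcal X\subseteq\mathcal B_R(0)$ for some $R\le\mathrm{poly}(d)$, where $\mathcal B_r(0)$ is the closed Euclidean ball of radius $r$. It is accessed through a separation oracle: given $x\in\mathbb Q^d$, the oracle either asserts $x\in\mathcal X$ or returns $c\in\mathbb Q^d$ with $\|c\|_\infty=1$ and $\langle c,x'\rangle<\langle c,x\rangle$ for every $x'\in\mathcal X$. The algorithm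 also has oracle access to the values of $f$. Assumptions on $F=\nabla f$: (i) for every $x\in\mathcal X\cap\mathbb Q^d$, $F(x)$ is rational and can be evaluated exactly in $\mathrm{poly}(d)$ time, with bit length polynomial in that of $x$; (ii) $\|F(x)\|\le B$ for all $x\in\mathcal X$, $B\in\mathbb Q_{>0}$. The parameters $\lambda,\epsilon,B$ are given to the algorithm. *)

(* Defs.v *)
(* MathComp / MathComp-Analysis *)
From HB Require Import structures.
From mathcomp Require Import all_boot all_order all_algebra.
From mathcomp Require Import all_classical all_reals all_analysis.

Set Implicit Arguments.
Unset Strict Implicit.
Unset Printing Implicit Defensive.

Import Order.TTheory GRing.Theory Num.Theory.
Import numFieldNormedType.Exports.

Local Open Scope classical_set_scope.
Local Open Scope ring_scope.

(* ** Euclidean geometry of 'rV_d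

   The norm `|x| of the library on row vectors is the sup norm. *)

Definition dot (K : pzRingType) d (x y : 'rV[K]_d) : K :=
  \sum_(i < d) x 0 i * y 0 i.

Definition enorm (R : realType) d (x : 'rV[R]_d) : R := Num.sqrt (dot x x).

Definition eball (R : realType) d (r : R) : set 'rV[R]_d :=
  [set x | enorm x <= r].

Definition ratv (R : realType) d (q : 'rV[rat]_d) : 'rV[R]_d :=
  map_mx (@ratr R) q.

Definition grad (R : realType) d (f : 'rV[R]_d -> R) (x : 'rV[R]_d) : 'rV[R]_d :=
  \row_(i < d) 'D_(delta_mx 0 i) f x.

(* ** Isotropic position *)

(* The d-dimensional Lebesgue integral, written as an iterated integral. It is
   only applied to bounded Borel functions with compact support, where the two
   agree by Fubini's theorem. *)
Fixpoint lebint (R : realType) (d : nat) : ('rV[R]_d -> R) -> \bar R :=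
  match d with
  | 0 => fun g => (g 0)%:E
  | d'.+1 => fun g =>
      (\int[lebesgue_measure]_(t in [set: R])
          @lebint R d' (fun y : 'rV[R]_d' =>
            g (row_mx (t%:M : 'rV[R]_1) y : 'rV[R]_(1 + d'))))%E
  end.

(* expectation of g under the uniform distribution on X *)
Definition unif_mean (R : realType) d (X : set 'rV[R]_d) (g : 'rV[R]_d -> R) : R :=
  fine (lebint (fun x => \1_X x * g x)) / fine (lebint (\1_X : 'rV[R]_d -> R)).

Definition isotropic (R : realType) d (X : set 'rV[R]_d) : Prop :=
  (forall i, unif_mean X (fun x => x 0 i) = 0) /\
  (forall i j, unif_mean X (fun x => x 0 i * x 0 j) = (i == j)%:R).

(* ** Quasar-convexity *)

Definition minimizer (R : realType) d (X : set 'rV[R]_d) (f : 'rV[R]_d -> R)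
    (x : 'rV[R]_d) : Prop :=
  X x /\ forall x', X x' -> f x <= f x'.

Definition quasar_convex (R : realType) d (X : set 'rV[R]_d)
    (f : 'rV[R]_d -> R) (lam : R) (x : 'rV[R]_d) : Prop :=
  minimizer X f x /\
  forall x', X x' -> f x >= f x' + lam^-1 * dot (grad f x') (x - x').

(* ** Sizes *)

Definition nat_bits (n : nat) : nat := (trunc_log 2 n).+1.

(* sign, numerator and denominator in lowest terms *)
Definition rat_bits (q : rat) : nat :=
  (1 + nat_bits `|numq q| + nat_bits `|denq q|)%N.

Definition vec_bits d (q : 'rV[rat]_d) : nat := (\sum_(i < d) rat_bits (q 0%R i))%N.

(* max(0, ceil(log_2 q)), for q > 0 *)
Definition log2c (q : rat) : nat := up_log 2 `|Num.ceil q|.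

(* ** The machine

   A random access machine over rational numbers with oracles. Its state has
   registers (named in the program), a memory (addressed by the contents of
   registers), and value registers, which hold function values. A function value
   is an arbitrary real number and has no finite encoding: the machine can store
   and compare function values, and nothing else.

   Time is logarithmic cost. An arithmetic instruction is charged the bit length
   of the number it produces, an oracle call the bit length of the query, and
   for the gradient also the time its evaluation takes; tests and moves of a
   number are charged one unit. Each number present is therefore an input, a
   constant of the program, (an entry of) an oracle answer, or has already been
   charged its bit length, so that time on this machine and time on a Turing
   machine are equivalent up to a polynomial in the time, the length of the
   inputs and the length of the oracle answers. Inputs and oracle answers are
   not charged for their length, because a bound in terms of d, log(B/eps) and
   log(1/lam) does not control the number of digits of lam, eps and B. *)

Inductive arith_op := OpAdd | OpSub | OpMul | OpDiv | OpQuo.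

(* division by 0 yields 0 *)
Definition arith (o : arith_op) (x y : rat) : rat :=
  match o with
  | OpAdd => x + y
  | OpSub => x - y
  | OpMul => x * y
  | OpDiv => x / y
  | OpQuo => (Num.floor (x / y))%:~R
  end.

Inductive instr :=
  | Const (r : nat) (q : rat)                (* r := q *)
  | Arith (o : arith_op) (r s t : nat)       (* r := s o t *)
  | Move (r s : nat)                         (* r := s *)
  | ReadMem (r s : nat)                         (* r := mem[s] *)
  | WriteMem (r s : nat)                        (* mem[r] := s *)
  | AskSep (r s t : nat)
      (* query mem[r ..]; t := 0 if it is asserted to be in the set, otherwise
         t := 1 and mem[s ..] := separating vector *)
  | AskGrad (r s : nat)                      (* mem[s ..] := gradient at mem[r ..] *)
  | AskVal (v r : nat)                       (* value v := value at mem[r ..] *)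
  | MoveVal (v w : nat).                     (* value v := value w *)

Inductive test :=
  | Le (r s : nat)
  | LeVal (v w : nat).

Inductive cmd :=
  | Skip
  | Do (i : instr)
  | Seq (c1 c2 : cmd)
  | If (b : test) (c1 c2 : cmd)
  | While (b : test) (c : cmd).

(* The answer None of the separation oracle asserts membership. *)
Record oracles (R : realType) (d : nat) := Oracles {
  o_sep : 'rV[rat]_d -> option 'rV[rat]_d;
  o_grad : 'rV[rat]_d -> 'rV[rat]_d;
  o_grad_time : 'rV[rat]_d -> nat;
  o_val : 'rV[rat]_d -> R }.

Record state (R : realType) := State {
  reg : nat -> rat;
  mem : nat -> rat;
  vreg : nat -> R }.

Definition read_vec d (m : nat -> rat) (a : nat) : 'rV[rat]_d :=
  \row_(i < d) m (a + i)%N.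

Definition write_vec d (m : nat -> rat) (a : nat) (v : 'rV[rat]_d) : nat -> rat :=
  fun j => if (a <= j)%N then oapp (v 0) (m j) (insub (j - a)%N) else m j.

Section Semantics.
Context (R : realType) (d : nat) (O : oracles R d).
Implicit Types (s : state R) (i : instr) (b : test) (c : cmd).

Definition addr s (r : nat) : nat := Num.truncn (reg s r).

Definition arg s (r : nat) : 'rV[rat]_d := read_vec d (mem s) (addr s r).

Definition set_reg s r q := State [eta reg s with r |-> q] (mem s) (vreg s).

Definition set_vreg s v x := State (reg s) (mem s) [eta vreg s with v |-> x].

Definition step i s : state R :=
  match i with
  | Const r q => set_reg s r q
  | Arith o r t u => set_reg s r (arith o (reg s t) (reg s u))
  | Move r t => set_reg s r (reg s t)
  | ReadMem r t => set_reg s r (mem s (addr s t))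
  | WriteMem r t => State (reg s) [eta mem s with addr s r |-> reg s t] (vreg s)
  | AskSep r t u =>
      match o_sep O (arg s r) with
      | None => set_reg s u 0
      | Some x =>
          set_reg (State (reg s) (write_vec (mem s) (addr s t) x) (vreg s)) u 1
      end
  | AskGrad r t =>
      State (reg s) (write_vec (mem s) (addr s t) (o_grad O (arg s r))) (vreg s)
  | AskVal v r => set_vreg s v (o_val O (arg s r))
  | MoveVal v w => set_vreg s v (vreg s w)
  end.

Definition cost i s : nat :=
  match i with
  | Const _ q => rat_bits q
  | Arith o _ t u => rat_bits (arith o (reg s t) (reg s u))
  | Move _ _ | ReadMem _ _ | WriteMem _ _ | MoveVal _ _ => 1
  | AskSep r _ _ | AskVal _ r => 1 + vec_bits (arg s r)
  | AskGrad r _ => 1 + vec_bits (arg s r) + o_grad_time O (arg s r)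
  end%N.

Definition holds b s : bool :=
  match b with
  | Le r t => reg s r <= reg s t
  | LeVal v w => vreg s v <= vreg s w
  end.

(* exec c s n s': from s, the program c halts in state s' after time n. *)
Inductive exec : cmd -> state R -> nat -> state R -> Prop :=
  | ExecSkip s : exec Skip s 0 s
  | ExecDo i s : exec (Do i) s (cost i s) (step i s)
  | ExecSeq c1 c2 s1 n1 s2 n2 s3 :
      exec c1 s1 n1 s2 -> exec c2 s2 n2 s3 -> exec (Seq c1 c2) s1 (n1 + n2) s3
  | ExecIf b c1 c2 s n s' :
      exec (if holds b s then c1 else c2) s n s' -> exec (If b c1 c2) s n.+1 s'
  | ExecWhileF b c s : ~~ holds b s -> exec (While b c) s 1 s
  | ExecWhileT b c s1 n1 s2 n2 s3 :
      holds b s1 -> exec c s1 n1 s2 -> exec (While b c) s2 n2 s3 ->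
      exec (While b c) s1 (n1 + n2).+1 s3.

Lemma exec_deterministic c s n1 s1 n2 s2 :
  exec c s n1 s1 -> exec c s n2 s2 -> n1 = n2 /\ s1 = s2.
Proof.
move=> e; elim: e n2 s2 => {c s n1 s1}.
- by move=> s n2 s2 e; inversion e.
- by move=> i s n2 s2 e; inversion e.
- move=> c1 c2 s1 n1 s2 n2 s3 _ IH1 _ IH2 m s e.
  inversion_clear e as [| |? ? ? m1 t2 m2 ? e1 e2| | |].
  have [? ?] := IH1 _ _ e1; subst t2 m1.
  by have [-> ->] := IH2 _ _ e2.
- move=> b c1 c2 s n s' _ IH m t e.
  inversion_clear e as [| | |? ? ? ? m1 ? e1| |].
  by have [-> ->] := IH _ _ e1.
- move=> b c s bs m t e.
  by inversion e as [| | | | |? ? ? ? ? ? ? bs']; rewrite // bs' in bs.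
- move=> b c s1 n1 s2 n2 s3 bs _ IH1 _ IH2 m t e.
  move: bs; inversion e as [| | | |? ? ? nb|? ? ? m1 t2 m2 ? _ e1 e2]; subst.
    by rewrite (negbTE nb).
  have [? ?] := IH1 _ _ e1; subst t2 m1.
  by have [-> ->] := IH2 _ _ e2.
Qed.

(* Input: d, lam, eps, B in registers 0 to 3. Output: memory cells 0 to d - 1. *)
Definition init (lam eps B : rat) : state R :=
  State (nth 0 [:: d%:R; lam; eps; B]) (fun=> 0) (fun=> 0).

Definition output s : 'rV[rat]_d := read_vec d (mem s) 0.

End Semantics.

(* ** What the oracles compute *)

Definition separation_oracle (R : realType) d (X : set 'rV[R]_d)
    (sep : 'rV[rat]_d -> option 'rV[rat]_d) : Prop :=
  forall q, match sep q with
  | None => X (ratv R q)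
  | Some c => `|ratv R c| = 1 /\
      forall x', X x' -> dot (ratv R c) x' < dot (ratv R c) (ratv R q)
  end.

(* The evaluation time of the gradient is polynomial in d and the length of the
   query, the length of the answer is polynomial in the length of the query.
   Nothing is known about answers to queries outside X. *)
Definition gradient_oracle (R : realType) d (X : set 'rV[R]_d)
    (f : 'rV[R]_d -> R) (ptime pbits : {poly nat}) (O : oracles R d) : Prop :=
  forall q, X (ratv R q) ->
    [/\ ratv R (o_grad O q) = grad f (ratv R q),
        (o_grad_time O q <= ptime.[d + vec_bits q])%N
      & (vec_bits (o_grad O q) <= pbits.[vec_bits q])%N].

Definition value_oracle (R : realType) d (X : set 'rV[R]_d)
    (f : 'rV[R]_d -> R) (val : 'rV[rat]_d -> R) : Prop :=
  forall q, X (ratv R q) -> val q = f (ratv R q).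

(* Main.v *)
(* Cutting planes with simplices instead of ellipsoids (Yamnitsky and Levin), so that no square
   roots occur and no volumes have to be measured.

   Let x* be a minimizer. The convex set X contains the points y_0 = (1 - dl) x* and
   y_j = y_0 + (dl / 2) e_j. The program keeps a simplex; as long as no query was eps-good,
   each y_i is a convex combination of its vertices, with coefficients forming the i-th row
   of a stochastic matrix P, so that |det P| <= 1. A query at the centroid q returns a vector
   c such that <c, y_i> < <c, q> for all i: either X is separated from q with a margin
   dl / 2, or c is the gradient at q and quasar-convexity gives <c, x* - q> < - lam eps.
   Both inequalities are strict enough to survive the rounding of c to an integer vector.
   Keeping the vertex that minimizes <c, .> and moving the others along the edges from it
   gives a simplex that still contains the y_i and has smaller volume; that is, |det P| grows
   by the factor 1 + 1 / (16 (d + 1)^2). After 16 (d + 1)^3 L steps, with 2^L larger than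
   the inverse d-th root of the initial value of |det P|, it would exceed 1.

   The vertices are integer vectors with the common denominator Q^k after k steps, and each
   step multiplies them by factors of O(log d) bits, so their length stays polynomial without
   any rounding. Only the oracle answers are rounded, by integer quotients. *)
Require Import Defs.
From HB Require Import structures.
From mathcomp Require Import all_boot all_order all_fingroup all_algebra.
From mathcomp Require Import all_classical all_reals all_analysis.
From mathcomp Require Import ring lra zify.

Set Implicit Arguments.
Unset Strict Implicit.
Unset Printing Implicit Defensive.

Import Order.TTheory GRing.Theory Num.Theory.
Import numFieldNormedType.Exports.
(* [Defs.mem] is shadowed by the [mem] of ssrbool. *)
Import Defs.

Local Open Scope classical_set_scope.
Local Open Scope ring_scope.

(** * Simplices and barycentric coordinates *)

(** The numbers lam, eps, B and the separating vectors may have arbitrarily many digits, while the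
    time allows only the logarithms of B/eps and 1/lam. So they enter the arithmetic only through
    integer quotients: the program keeps integers K1 > B/eps and K2 > 1/lam. With X inside the ball
    of radius r, it takes dl = 1/(2 K1 K2 (d+1)(r+1)); replacing the minimizer by some y_i then
    costs a gradient cut at most half of its margin lam eps.

    A cut is scaled by P = 8^(L+N) before it is rounded (by P/eps for gradients), N being the number
    of rounds. The simplex is not confined to X: relative to the common denominator its coordinates
    are only known to grow by at most a factor 8 per round, which 8^N absorbs. The factor 8^L pays
    for dl, d and r.

    An eps-good query cannot be recognized, because the minimum is unknown. The loop always runs all
    N rounds, so the bounds on the lengths of numbers must not rely on the cuts being valid, whereas
    the determinant is tracked only as long as no query was good. *)

Lemma norm_det_stochastic (F : realFieldType) n (P : 'M[F]_n) :
  (forall i j, 0 <= P i j) -> (forall i, \sum_j P i j = 1) -> `|\det P| <= 1.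
Proof.
move=> P0 P1.
have <- : \prod_(i < n) \sum_j P i j = 1 by rewrite big1.
(* The product of the row sums expands over all maps into nonnegative terms. The injective maps
   contribute the permanent, which bounds the determinant in absolute value. *)
rewrite bigA_distr_bigA /= (bigID (fun f : {ffun 'I_n -> 'I_n} => injectiveb f)) /=.
rewrite (reindex (@pval _)) /=; last first.
  pose in_Sn := insubd (1%g : 'S_n).
  by exists in_Sn => /= f Uf; first apply: val_inj; apply: insubdK.
apply: (le_trans (ler_norm_sum _ _ _)).
rewrite -[X in X <= _]addr0; apply: lerD; last first.
  by apply: sumr_ge0 => f _; apply: prodr_ge0.
rewrite [X in _ <= X](eq_bigl xpredT) => [|s]; last by rewrite (valP s).
apply: ler_sum => s _; rewrite normrM normrX normrN1 expr1n mul1r.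
by rewrite ger0_norm ?prodr_ge0//; apply: ler_prod => i _; rewrite P0 pvalE /=.
Qed.

(* The barycentric coordinates of the vertices v_k + u_i (v_i - v_k). *)
Definition stretch_mx (F : nzRingType) d (k : 'I_d.+1) (u : 'I_d.+1 -> F) : 'M[F]_d.+1 :=
  \matrix_(i, j) if i == k then (j == k)%:R
                 else u i *+ (j == i) + (1 - u i) *+ (j == k).

(** Row [k] is the unit vector at [k], and without that row and column the matrix is diagonal. The
    value is the factor by which stretching the edges at vertex [k] multiplies the volume. *)
Lemma det_stretch (F : comNzRingType) d (k : 'I_d.+1) (u : 'I_d.+1 -> F) :
  \det (stretch_mx k u) = \prod_(i | i != k) u i.
Proof.
rewrite (expand_det_row _ k) (bigD1 k) //= big1 ?addr0 => [|j jk]; last first.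
  by rewrite !mxE eqxx (negbTE jk) mul0r.
rewrite !mxE !eqxx mul1r /cofactor -signr_odd oddD addbb mul1r.
have -> : row' k (col' k (stretch_mx k u)) = diag_mx (\row_i u (lift k i)).
  apply/matrixP=> i j; rewrite !mxE eq_sym (negbTE (neq_lift k i)).
  rewrite (eq_sym (lift k j) k) (negbTE (neq_lift k j)) mulr0n addr0.
  by rewrite (inj_eq lift_inj) eq_sym.
rewrite det_diag; under eq_bigr do rewrite mxE.
rewrite [RHS]big_mkcond /= (bigD1_ord k) //= eqxx mul1r.
by apply: eq_bigr => i _; rewrite eq_sym neq_lift.
Qed.

Lemma expr_mul_le1 (F : realFieldType) (z : F) d :
  0 <= z <= 1 -> (1 - z) ^+ d * (1 + d%:R * z) <= 1.
Proof.
case/andP => z0 z1; elim: d => [|d IH]; first by rewrite expr0 mul0r addr0 mulr1.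
apply: le_trans IH; rewrite exprSr -mulrA ler_wpM2l ?exprn_ge0 ?subr_ge0 //.
have : 0 <= (d%:R : F) by [].
by rewrite -natr1; nra.
Qed.

(** The arithmetic-geometric mean inequality reduces the product to the sum of the [u i]. With x =
    b/(8 n^2) >= -1/2 one has 1/(1+x) <= 1 - x + 2 x^2. In units of y = 1/(16 n^2), the linear terms
    lower the sum by 2y, the quadratic terms give back at most y/2, and so do the d rounding errors
    1/(32 n^3). Hence the sum is at most d - y, and the product at most (1 - y/d)^d <= 1/(1+y). *)
Lemma volume_factor (F : realFieldType) d (k : 'I_d.+1) (b u : 'I_d.+1 -> F) :
  (0 < d)%N ->
  (forall i, i != k -> -1 <= b i) -> \sum_(i | i != k) b i = 1 ->
  (forall i, i != k ->
     0 <= u i <= (1 + b i / (8 * d.+1%:R ^+ 2))^-1 + (32 * d.+1%:R ^+ 3)^-1) ->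
  (\prod_(i | i != k) u i) * (1 + (16 * d.+1%:R ^+ 2)^-1) <= 1.
Proof.
move=> d0 bge bsum hu; set n : F := d.+1%:R.
have nd : n = d%:R + 1 by rewrite /n -natr1.
have d1 : 1 <= (d%:R : F) by rewrite ler1n.
have n2 : 2 <= n by lra.
have cardk : #|[pred i : 'I_d.+1 | i != k]| = d by rewrite cardC1 card_ord.
(* The numbers b_i + 1 are nonnegative with sum n, so each is at most n and their squares sum to at
   most n^2. *)
have sb2 : \sum_(i | i != k) b i ^+ 2 <= n ^+ 2.
  have e1 : \sum_(i | i != k) (b i + 1) = n.
    by rewrite big_split /= bsum sumr_const cardk nd addrC.
  have le1 i : i != k -> b i + 1 <= n.
    move=> ik; rewrite -e1 (bigD1 i) //= lerDl sumr_ge0 // => j /andP[jk _].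
    by have := bge j jk; lra.
  have : \sum_(i | i != k) (b i ^+ 2 + (1 + 2 * b i)) <= \sum_(i | i != k) n * (b i + 1).
    apply: ler_sum => i ik; have := le1 i ik; have := bge i ik; nra.
  rewrite -mulr_sumr e1 big_split /= big_split /= -mulr_sumr bsum sumr_const cardk.
  by rewrite expr2; lra.
pose x i := b i / (8 * n ^+ 2).
have q0 : 0 < (8 * n ^+ 2)^-1 by rewrite invr_gt0; nra.
have ub i : i != k -> u i <= 1 - x i + 2 * x i ^+ 2 + (32 * n ^+ 3)^-1.
  move=> ik; case/andP: (hu i ik) => _ h; apply: le_trans h _; rewrite -/(x i) lerD2r.
  have x2 : - (1 / 2) <= x i.
    rewrite /x ler_pdivlMr; last nra.
    have := bge i ik; nra.
  rewrite -[_^-1]mul1r ler_pdivrMr; last lra.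
  nra.
have us : \sum_(i | i != k) u i <= d%:R - (16 * n ^+ 2)^-1.
  apply: le_trans (ler_sum _ ub) _.
  rewrite !big_split /= sumr_const cardk sumrN -mulr_suml bsum -mulr_sumr sumr_const cardk.
  have -> : \sum_(i | i != k) x i ^+ 2 = (\sum_(i | i != k) b i ^+ 2) / (8 * n ^+ 2) ^+ 2.
    by rewrite mulr_suml; apply: eq_bigr => i _; rewrite /x exprMn exprVn.
  have h1 : (\sum_(i | i != k) b i ^+ 2) / (8 * n ^+ 2) ^+ 2 <= n ^+ 2 / (8 * n ^+ 2) ^+ 2.
    by rewrite ler_wpM2r // invr_ge0 exprn_ge0 //; nra.
  have h2 : n ^+ 2 / (8 * n ^+ 2) ^+ 2 = (16 * n ^+ 2)^-1 / 4 by field; lra.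
  have h3 : (32 * n ^+ 3)^-1 *+ d <= (16 * n ^+ 2)^-1 / 2.
    have -> : (16 * n ^+ 2)^-1 / 2 = (32 * n ^+ 3)^-1 * n :> F by field; lra.
    rewrite -[X in X <= _]mulr_natr ler_wpM2l //; last by lra.
    by rewrite invr_ge0 mulr_ge0 // exprn_ge0 //; lra.
  have h4 : 1 / (8 * n ^+ 2) = (16 * n ^+ 2)^-1 * 2 :> F by field; lra.
  move: h1 h3; rewrite h4 h2; 
  set A := (\sum_(i | _) _) / _; set y := (16 * n ^+ 2)^-1.
  move: ((32 * n ^+ 3)^-1 *+ d) A y => C A y; lra.
have y1 : (16 * n ^+ 2)^-1 <= 1 by rewrite invf_le1; nra.
have := (leif_AGM (A := [pred i | i != k]) (E := u) _).1.
rewrite cardk => /(_ _)/le_trans agm.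
apply: le_trans (_ : (1 - (16 * n ^+ 2)^-1 / d%:R) ^+ d * (1 + (16 * n ^+ 2)^-1) <= _).
  rewrite ler_wpM2r //.
    by rewrite addr_ge0 // invr_ge0 mulr_ge0 // exprn_ge0 //; lra.
  apply: agm => [i|]; first by rewrite inE => /hu/andP[].
  rewrite lerXn2r ?nnegrE //.
  - by rewrite divr_ge0 ?sumr_ge0 // => i /hu/andP[].
  - by rewrite subr_ge0 ler_pdivrMr ?mul1r ?(le_trans y1) //; lra.
  rewrite ler_pdivrMr; last lra.
  by rewrite mulrBl divfK ?mul1r //; lra.
have z01 : 0 <= ((16 * n ^+ 2)^-1 / d%:R : F) <= 1.
  rewrite divr_ge0 ?invr_ge0 ?mulr_ge0 ?exprn_ge0 //=.
  by rewrite ler_pdivrMr ?mul1r ?(le_trans y1) //; lra.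
have := expr_mul_le1 d z01.
have -> // : d%:R * ((16 * n ^+ 2)^-1 / d%:R) = (16 * n ^+ 2)^-1 :> F.
by field; lra.
Qed.

(** The geometric vertices are the rows of [V / S]. The common denominator [S] is kept apart so that
    [V] can stay integral. *)
Definition barycentric (F : realFieldType) n d (V : 'M[F]_(n, d)) (S : F) (Y : 'M[F]_(n, d))
    (P : 'M[F]_n) : Prop :=
  [/\ forall i j, 0 <= P i j, forall i, \sum_j P i j = 1 & P *m V = S *: Y].

(** * The effect of one cut on the barycentric coordinates *)

Section CuttingStep.
Variables (F : realFieldType) (d : nat) (V Y : 'M[F]_(d.+1, d)) (S : F) (P : 'M[F]_d.+1).
Variables (c : 'I_d -> F) (k : 'I_d.+1) (U : 'I_d.+1 -> F).

Let n : F := d.+1%:R.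
Let Q : F := 32 * n ^+ 3.
Let e (i : 'I_d.+1) := \sum_j c j * V i j.
(** The cut takes the value [tau / n] at the centroid of [V]. Thus [al / n] is the height of the
    centroid above the lowest vertex and [a i / n] the height of vertex [i] above the centroid; the
    factor n avoids a division. *)
Let tau := \sum_i e i.
Let al := tau - n * e k.
Let a i := n * e i - tau.

Hypothesis d_gt0 : (0 < d)%N.
Hypothesis baryP : barycentric V S Y P.
Hypothesis min_k : forall i, e k <= e i.
Hypothesis cut : forall i, n * (S * \sum_j c j * Y i j) < tau.
Hypothesis U_bounds : forall i, i != k ->
  Q * (8 * n ^+ 2 * al / (8 * n ^+ 2 * al + a i)) <= U i
  <= Q * (8 * n ^+ 2 * al / (8 * n ^+ 2 * al + a i)) + 1.

Let n2 : 2 <= n.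
Proof. by rewrite /n ler_nat. Qed.

Let dotP i : \sum_l P i l * e l = S * \sum_j c j * Y i j.
Proof.
case: baryP => _ _ PV.
transitivity (\sum_j c j * (P *m V) i j).
  under eq_bigr do rewrite mulr_sumr.
  rewrite exchange_big /=; apply: eq_bigr => j _; rewrite mxE mulr_sumr.
  by apply: eq_bigr => l _; rewrite mulrCA.
by rewrite PV mulr_sumr; apply: eq_bigr => j _; rewrite mxE mulrCA.
Qed.

(** The tracked point 0 is a convex combination of the vertices and lies strictly below the
    centroid; the lowest vertex is at least as low. *)
Let al_gt0 : 0 < al.
Proof.
case: baryP => P0 P1 _.
have h : e k <= \sum_l P ord0 l * e l.
  rewrite -[e k]mul1r -(P1 ord0) mulr_suml; apply: ler_sum => l _.
  by rewrite ler_wpM2l.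
rewrite subr_gt0; apply: le_lt_trans (cut ord0); rewrite -dotP ler_wpM2l //; lra.
Qed.

Let age i : - al <= a i.
Proof. by rewrite /al /a; have := min_k i; have := n2; nra. Qed.

Let sum_a i : \sum_l P i l * a l < 0.
Proof.
case: baryP => _ P1 _; have := cut i; rewrite -dotP mulr_sumr => h.
under eq_bigr do rewrite mulrBr mulrCA.
by rewrite sumrB -mulr_suml P1 mul1r subr_lt0.
Qed.

(** The unrounded multiplier of edge [i] is [1 / w i]: edges to vertices below the centroid are
    lengthened, those to vertices above it are shortened. The damping by 8 n^2 keeps [w i] at least
    7/8. *)
Let w i := 1 + (a i / al) / (8 * n ^+ 2).

Let q1 : 8 <= 8 * n ^+ 2.
Proof. by have := n2; nra. Qed.

Let w_gt0 i : 0 < w i.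
Proof.
have h : -1 <= a i / al by rewrite ler_pdivlMr // mulN1r.
have h2 : - 8^-1 <= (a i / al) / (8 * n ^+ 2).
  by rewrite ler_pdivlMr; have := q1; lra.
by rewrite /w; move: (a i / al / _) h2 => z h2; lra.
Qed.

Let u i := U i / Q.

Let Q_gt0 : 0 < Q.
Proof. by rewrite /Q mulr_gt0 ?exprn_gt0 //; have := n2; lra. Qed.

Let ub i : i != k -> (w i)^-1 <= u i <= (w i)^-1 + Q^-1.
Proof.
move=> /U_bounds.
have -> : 8 * n ^+ 2 * al / (8 * n ^+ 2 * al + a i) = (w i)^-1.
  have h0 : 8 * n ^+ 2 * al + a i = (8 * n ^+ 2 * al) * w i.
    by rewrite /w; field; rewrite !gt_eqF //; have := n2; lra.
  rewrite h0 invfM mulrA divff ?mul1r // gt_eqF // mulr_gt0 //; have := q1; lra.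
case/andP=> h1 h2; apply/andP; split.
  by rewrite /u ler_pdivlMr // mulrC.
by rewrite /u ler_pdivrMr // mulrDl mulVf ?gt_eqF // [_ * Q]mulrC.
Qed.

Let u_gt0 i : i != k -> 0 < u i.
Proof. by move=> /ub/andP[h _]; apply: lt_le_trans h; rewrite invr_gt0. Qed.

Let t i l := P i l / u l.

Let P' : 'M[F]_d.+1 :=
  \matrix_(i, l) if l == k then 1 - \sum_(m | m != k) t i m else t i l.

(* The new coordinates are t_i / u_i for i <> k. They sum to at most 1 because u_i >= 1 / w_i,
   where sum_i t_i w_i <= 1 is a convex combination of sum_(i <> k) t_i <= 1 and the cut. *)
Lemma barycentric_step :
  exists P2, barycentric (\matrix_(i, j) (Q * V k j + U i * (V i j - V k j))) (Q * S) Y P2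
    /\ `|\det P| * (1 + (16 * n ^+ 2)^-1) <= `|\det P2|.
Proof.
case: (baryP) => P0 P1 PV; exists P'.
have sumk i (f : 'I_d.+1 -> F) : \sum_l P' i l * f l = 
    f k + \sum_(m | m != k) t i m * (f m - f k).
  rewrite (bigD1 k) //= mxE eqxx mulrBl mul1r -addrA; congr (_ + _).
  rewrite mulr_suml -sumrN -big_split /=; apply: eq_bigr => l lk.
  by rewrite mxE (negbTE lk) mulrBr addrC.
have t0 i l : l != k -> 0 <= t i l.
  by move=> lk; rewrite divr_ge0 // ltW // u_gt0.
have tu i l : l != k -> t i l * u l = P i l.
  by move=> lk; rewrite divfK // gt_eqF // u_gt0.
have P1k i : \sum_(m | m != k) P i m = 1 - P i k.
  by rewrite -(P1 i) [X in X - _](bigD1 k) //= addrAC subrr add0r.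
split; [split|].
- move=> i l; rewrite mxE; case: eqP => [_|/eqP/t0//].
  rewrite subr_ge0; apply: le_trans (_ : \sum_(m | m != k) P i m * w m <= _).
    apply: ler_sum => m mk; rewrite ler_wpM2l // -[X in _ <= X]invrK.
    by rewrite lef_pV2 ?posrE ?invr_gt0 ?u_gt0 //; case/andP: (ub mk).
  under eq_bigr do rewrite mulrDr mulr1 2!mulrA.
  rewrite big_split /= -!mulr_suml P1k.
  have := sum_a i; rewrite (bigD1 k) //=.
  set A := \sum_(_ | _) _ => h.
  have ak : a k = - al by rewrite /a /al opprB.
  have {}h : A <= P i k * al by rewrite ak in h; lra.
  have h2 : A / al <= P i k by rewrite ler_pdivrMr.
  have h3 : A / al / (8 * n ^+ 2) <= P i k.
    rewrite ler_pdivrMr; last by have := q1; lra.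
    by apply: le_trans h2 _; rewrite ler_peMr //; have := q1; lra.
  by move: (A / al / _) h3 => z h3; lra.
- move=> i; have := sumk i (fun=> 1).
  under eq_bigr do rewrite mulr1.
  by move=> ->; under eq_bigr do rewrite subrr mulr0; rewrite sumr_const mul0rn addr0.
- apply/matrixP => i j; rewrite mxE.
  transitivity (\sum_l P' i l * (Q * V k j + U l * (V l j - V k j))).
    by apply: eq_bigr => l _; rewrite [X in _ * X]mxE.
  rewrite sumk subrr mulr0 addr0.
  transitivity (Q * \sum_l P i l * V l j); last first.
    by rewrite mxE -mulrA; congr (_ * _); move/matrixP/(_ i j): PV; rewrite !mxE.
  rewrite [in RHS](bigD1 k) //= -[P i k](subKr 1) -P1k.
  rewrite [(1 - _) * _]mulrBl mul1r mulrDr mulrBr -addrA; congr (_ + _).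
  rewrite addrC -mulrBr mulr_suml -sumrB mulr_sumr; apply: eq_bigr => l lk.
  have -> : U l = Q * u l by rewrite /u mulrC divfK // gt_eqF.
  by rewrite -(tu i l lk); ring.
(* Passing to the new vertices and back recovers the old coordinates, so the determinant of [P'] is
   that of [P] divided by the product of the [u i], to which [volume_factor] applies with b =
   a/al. *)
have detE : P = P' *m stretch_mx k u.
  apply/matrixP => i j; rewrite mxE.
  transitivity (\sum_l P' i l * stretch_mx k u l j); last by [].
  rewrite sumk; have [->|jk] := eqVneq j k.
    rewrite !mxE !eqxx; under eq_bigr => m mk.
      rewrite !mxE eqxx (negbTE mk) eq_sym (negbTE mk) mulr0n add0r mulr1n addrAC subrr add0r.
      rewrite mulrN tu //; over.
    by rewrite sumrN P1k opprB addrC subrK.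
  rewrite !mxE eqxx (negbTE jk) add0r (bigD1 j) //= big1 => [|m /andP[mk mj]].
    by rewrite !mxE !eqxx (negbTE jk) mulr1n mulr0n !addr0 subr0 tu.
  by rewrite !mxE (negbTE mk) eq_sym (negbTE mj) (negbTE jk) !mulr0n addr0 subr0 mulr0.
rewrite [X in \det X]detE det_mulmx det_stretch normrM -mulrA.
rewrite -[X in _ <= X]mulr1 ler_wpM2l // ger0_norm; last first.
  by apply: prodr_ge0 => l /u_gt0/ltW.
apply: (volume_factor (b := fun i => a i / al)) => // [i _||i ik].
- by rewrite ler_pdivlMr // mulN1r.
- rewrite -mulr_suml; apply: (canLR (mulfK _)); rewrite ?gt_eqF // mul1r.
  have : \sum_l a l = 0.
    by rewrite sumrB -mulr_sumr sumr_const card_ord mulr_natl subrr.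
  rewrite (bigD1 k) //= => /eqP; rewrite addrC addr_eq0 => /eqP ->.
  by rewrite /al opprB.
- by rewrite ltW ?u_gt0 //=; case/andP: (ub ik).
Qed.
End CuttingStep.

(** * The initial simplex and the number of rounds *)

Definition init_vertices (F : nzRingType) d (r : F) : 'M[F]_(d.+1, d) :=
  \matrix_(i, j) (- r + (2 * d%:R * r) *+ (i == lift ord0 j)).

(** The initial simplex sits at the corner (-r, ..., -r) of the cube [-r, r]^d; edges of length 2 d
    r are what the opposite corner of the cube requires. The rows of [Y] span a simplex of the same
    shape with edges h, and the determinant is the ratio of the two volumes. *)
Lemma init_barycentric (F : realFieldType) d (r h : F) (z : 'I_d -> F) (Y : 'M[F]_(d.+1, d)) :
  (0 < d)%N -> 0 < r -> (forall i j, `|Y i j| <= r) ->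
  (forall i j, Y i j = z j + h *+ (i == lift ord0 j)) ->
  exists P, barycentric (init_vertices d r) 1 Y P /\ \det P = (h / (2 * d%:R * r)) ^+ d.
Proof.
move=> d0 r0 Yr Yz; set D : F := 2 * d%:R * r.
have d1 : 1 <= (d%:R : F) by rewrite ler1n.
have D0 : 0 < D by rewrite /D mulr_gt0 //; lra.
pose co i j := (Y i j + r) / D.
pose P : 'M[F]_d.+1 :=
  \matrix_(i, l) if unlift ord0 l is Some m then co i m else 1 - \sum_m co i m.
have P0 i : P i ord0 = 1 - \sum_m co i m by rewrite mxE unlift_none.
have PS i m : P i (lift ord0 m) = co i m by rewrite mxE liftK.
have P1 i : \sum_j P i j = 1.
  by rewrite big_ord_recl P0 [X in _ + X](eq_bigr _ (fun m _ => PS i m)) subrK.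
exists P; split; first split => //.
- move=> i l; case: (unliftP ord0 l) => [m ->|->].
    rewrite PS; apply: divr_ge0; last exact: ltW.
    have := Yr i m.
    by rewrite ler_norml -(lerD2r r) addNr => /andP[].
  rewrite P0 subr_ge0 -mulr_suml ler_pdivrMr // mul1r.
  apply: le_trans (_ : \sum_(m < d) (r + r) <= _).
    apply: ler_sum => m _; rewrite lerD2r; have := Yr i m.
    by rewrite ler_norml => /andP[].
  by rewrite sumr_const card_ord -mulr_natl /D; lra.
- apply/matrixP => i j; rewrite mxE scale1r.
  under eq_bigr do rewrite [X in _ * X]mxE mulrDr.
  rewrite big_split /= -mulr_suml P1 mul1r (bigD1 (lift ord0 j)) //= eqxx PS.
  rewrite big1 => [|l /negbTE->]; last by rewrite mulr0n mulr0.
  by rewrite addr0 /co -/D divfK ?gt_eqF // addrC addrK.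
(* With C and B triangular, P C = C B, so that det P = det B. *)
pose C : 'M[F]_d.+1 := \matrix_(i, l) if l == ord0 then 1 else (i == l)%:R.
pose B : 'M[F]_d.+1 := \matrix_(i, l)
  if unlift ord0 l is Some m then if i == ord0 then co ord0 m else (h / D) *+ (i == l)
  else (i == ord0)%:R.
have detC : \det C = 1.
  rewrite det_trig; last first.
    apply/is_trig_mxP => i j ij; rewrite mxE.
    have -> : (j == ord0) = false by rewrite -val_eqE /= gtn_eqF // (leq_trans _ ij).
    by rewrite -val_eqE /= ltn_eqF.
  by rewrite big1 // => i _; rewrite mxE eqxx; case: eqP.
have detB : \det B = (h / D) ^+ d.
  rewrite -det_tr det_trig; last first.
    apply/is_trig_mxP => i j ij; rewrite !mxE.
    have -> : (j == ord0) = false by rewrite -val_eqE /= gtn_eqF // (leq_trans _ ij).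
    by case: unliftP => // m _; rewrite -val_eqE /= gtn_eqF.
  rewrite big_ord_recl !mxE unlift_none eqxx mul1r.
  under eq_bigr do rewrite !mxE liftK eq_sym (negbTE (neq_lift _ _)) eqxx mulr1n.
  by rewrite prodr_const card_ord.
have PC : P *m C = C *m B.
  apply/matrixP => i l; rewrite !mxE.
  case: (unliftP ord0 l) => [m ->|->]; last first.
    under eq_bigr do rewrite [X in _ * X]mxE eqxx mulr1.
    rewrite P1 (bigD1 ord0) //= !mxE unlift_none !eqxx mulr1 big1 ?addr0 //.
    by move=> k /negbTE k0; rewrite !mxE unlift_none k0 mulr0.
  rewrite (bigD1 (lift ord0 m)) //= PS !mxE eqxx eq_sym (negbTE (neq_lift _ _)) mulr1.
  rewrite big1 ?addr0 => [|k /negbTE km]; last first.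
    by rewrite !mxE eq_sym (negbTE (neq_lift _ _)) km mulr0.
  rewrite big_ord_recl !mxE eqxx mul1r liftK.
  have -> : \sum_(k < d) C i (lift ord0 k) * B (lift ord0 k) (lift ord0 m)
      = (h / D) *+ (i == lift ord0 m).
    rewrite (bigD1 m) //= !mxE liftK eq_sym (negbTE (neq_lift _ _)) eqxx mulr1n.
    rewrite big1 ?addr0 => [|k /negbTE km]; last first.
      rewrite !mxE liftK [lift _ _ == ord0]eq_sym (negbTE (neq_lift _ _)).
      by rewrite (inj_eq lift_inj) km mulr0n mulr0.
    by rewrite mulrC mulr_natr.
  rewrite /co !Yz eq_sym (negbTE (neq_lift _ _)) mulr0n addr0 -mulrnAl -mulrDl addrAC.
  by [].
by have := congr1 determinant PC; rewrite !det_mulmx detC detB mulr1 mul1r.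
Qed.

(** By Bernoulli's inequality, m = 16 n^2 factors 1 + 1/m multiply to at least 2. The exponent is m
    times L (d+1), which gives 2^(L d) to beat rho^d and a further factor 2^L. *)
Lemma stretch_growth (F : realFieldType) d L (rho : F) :
  (0 < d)%N -> 0 < rho -> 1 < rho * 2 ^+ L ->
  1 < rho ^+ d * (1 + (16 * d.+1%:R ^+ 2)^-1) ^+ (16 * d.+1 ^ 3 * L).
Proof.
move=> d0 rho0 rhoL; set n : F := d.+1%:R.
have n1 : 1 <= n by rewrite /n ler1n.
have two : 2 <= (1 + (16 * n ^+ 2)^-1) ^+ (16 * d.+1 ^ 2).
  set m := (16 * d.+1 ^ 2)%N.
  have -> : 16 * n ^+ 2 = m%:R by rewrite /m natrM natrX.
  have m0 : 0 < m%:R :> F by rewrite ltr0n muln_gt0 expn_gt0.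
  have bern k : 1 + k%:R * m%:R^-1 <= (1 + m%:R^-1 : F) ^+ k.
    elim: k => [|k IH]; first by rewrite mul0r addr0 expr0.
    rewrite exprS; apply: le_trans (ler_wpM2l _ IH); last by rewrite addr_ge0 // invr_ge0 ltW.
    rewrite -natr1; have : 0 <= m%:R^-1 :> F by rewrite invr_ge0 ltW.
    move: (m%:R^-1) => y y0; have : 0 <= k%:R * y * y :> F by rewrite !mulr_ge0.
    by nra.
  by apply: le_trans (bern m); rewrite divff ?gt_eqF.
have -> : (16 * d.+1 ^ 3 * L = 16 * d.+1 ^ 2 * (L * d.+1))%N.
  by rewrite (expnSr _ 2) -!mulnA [(L * _)%N]mulnC.
rewrite exprM.
apply: lt_le_trans (_ : rho ^+ d * 2 ^+ (L * d.+1) <= _); last first.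
  apply: ler_wpM2l; first by rewrite exprn_ge0 // ltW.
  by rewrite lerXn2r ?nnegrE //; apply: le_trans two.
rewrite exprM exprSr mulrA -exprMn.
have h1 : 1 < (rho * 2 ^+ L) ^+ d by rewrite exprn_egt1 // -lt0n.
have h2 : 1 <= 2 ^+ L :> F by rewrite exprn_ege1 // ler1n.
rewrite -[X in X < _]mulr1.
by apply: lt_le_trans (ler_wpM2l _ h2); rewrite ?mulr1 ?ltW // (lt_trans ltr01).
Qed.

(** * The cuts *)

Lemma enorm_coord (R : realType) d (x : 'rV[R]_d) (r : R) i : enorm x <= r -> `|x 0 i| <= r.
Proof.
apply: le_trans; rewrite -sqrtr_sqr; apply: ler_wsqrtr.
rewrite /dot (bigD1 i) //= -expr2 lerDl; apply: sumr_ge0 => j _.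
by rewrite -expr2 sqr_ge0.
Qed.

Lemma convexP (R : realType) d (X : set 'rV[R]_d) (t : R) x y :
  convex_set X -> 0 <= t <= 1 -> X x -> X y -> X ((1 - t) *: x + t *: y).
Proof.
move=> cX /andP[t0 t1] Xx Xy.
have := cX y x (Itv01 t0 t1); rewrite !inE => /(_ Xy Xx).
by rewrite /conv /= addrC.
Qed.

Section TrackedPoints.
Variables (R : realType) (d : nat) (X : set 'rV[R]_d) (x : 'rV[R]_d) (dl : R).
Hypotheses (cX : convex_set X) (bX : eball 1 `<=` X) (Xx : X x) (dl01 : 0 <= dl <= 1).

Definition tracked : 'M[R]_(d.+1, d) :=
  \matrix_(i, j) ((1 - dl) * x 0 j + dl / 2 *+ (i == lift ord0 j)).

Let half (i : 'I_d.+1) : 'rV[R]_d := \row_j (2^-1 *+ (i == lift ord0 j)).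

(** A tracked point uses at most half of the radius of the unit ball. The other half is room for a
    move along one axis, which gives the separation cut its margin. *)
Let half_bound i (s : R) l : `|s| <= 1 ->
  X ((1 - dl) *: x + dl *: (half i + (s / 2) *: delta_mx 0 l)).
Proof.
move=> s1; apply: convexP => //; apply: bX; rewrite /eball /= /enorm.
rewrite -[leRHS]sqrtr1; apply: ler_wsqrtr.
rewrite /dot; under eq_bigr do rewrite -expr2 !mxE eqxx /=.
rewrite (bigD1 l) //= eqxx /=; case: (unliftP ord0 i) => [m ->|->]; last first.
  rewrite eq_liftF mulr0n add0r mulr1 big1 => [|j /negbTE jl]; last first.
    by rewrite jl mulr0 ?(@eq_liftF d.+1 ord0 j) ?mulr0n addr0 expr0n.
  by move: s1; rewrite ler_norml => /andP[? ?]; nra.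
rewrite (inj_eq lift_inj); have [->|ml] := eqVneq m l.
  rewrite mulr1n mulr1 big1 => [|j /negbTE jl]; last first.
    by rewrite jl (inj_eq lift_inj) eq_sym jl mulr0n mulr0 addr0 expr0n.
  by move: s1; rewrite ler_norml => /andP[? ?]; nra.
rewrite (bigD1 m) //= (inj_eq lift_inj) eqxx (negbTE ml) /= mulr0n mulr1n mulr0.
rewrite !(addr0, add0r) mulr1 big1 => [|j /andP[/negbTE jl /negbTE jm]]; last first.
  by rewrite jl (inj_eq lift_inj) eq_sym jm mulr0n mulr0 addr0 expr0n.
by move: s1; rewrite ler_norml => /andP[? ?]; nra.
Qed.

Lemma tracked_margin i (s : R) l : `|s| <= 1 ->
  X (row i tracked + (dl / 2 * s) *: delta_mx 0 l).
Proof.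
move=> /(half_bound i l); congr X; apply/rowP => j; rewrite !mxE mulrDr addrA.
by congr (_ + _ + _); [rewrite mulrnAr | rewrite mulrA [dl / 2 * s]mulrAC mulrA].
Qed.

Lemma tracked_in i : X (row i tracked).
Proof.
case: (posnP d) => d0.
  by rewrite (_ : row i tracked = x) //; apply/rowP => j; have := ltn_ord j; rewrite {2}d0.
have /(tracked_margin i (Ordinal d0)) : `|0 : R| <= 1 by rewrite normr0.
by rewrite mulr0 scale0r addr0.
Qed.
End TrackedPoints.

(** Rounding the scaled vector [s c] by at most 1 in each coordinate changes its value on [y - q] by
    at most d D. The scale [s] is large enough for the scaled margin [s g] to cover this. *)
Lemma rounded_cut (F : realFieldType) d (c c' y q : 'I_d -> F) (s g D : F) :
  (forall l, `|c' l - s * c l| <= 1) -> (forall l, `|y l - q l| <= D) ->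
  0 < s -> d%:R * D <= s * g -> \sum_l c l * (y l - q l) < - g ->
  \sum_l c' l * y l < \sum_l c' l * q l.
Proof.
move=> cc yq s0 hD hg; rewrite -subr_lt0 -sumrB.
have -> : \sum_l (c' l * y l - c' l * q l) =
    s * (\sum_l c l * (y l - q l)) + \sum_l (c' l - s * c l) * (y l - q l).
  by rewrite mulr_sumr -big_split /=; apply: eq_bigr => l _; ring.
have : \sum_l (c' l - s * c l) * (y l - q l) <= d%:R * D.
  rewrite mulr_natl -[X in _ <= _ *+ X]card_ord -sumr_const; apply: ler_sum => l _.
  apply: le_trans (ler_norm _) _; rewrite normrM -[D]mul1r.
  by rewrite ler_pM.
move: (\sum_l (c' l - s * c l) * _) (\sum_l _) hg => A B hg AD; nra.
Qed.

(** Some coordinate l of [c] is 1 or -1, because the sup norm is 1. Moving the tracked point by dl/2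
    along that axis, in the direction of the sign, stays in X and raises the value of [c] by dl/2;
    the moved point is still separated from [q]. *)
Lemma separation_cut (R : realType) d (X : set 'rV[R]_d) (x : 'rV[R]_d) (dl : R)
    (c q : 'rV[R]_d) i :
  convex_set X -> eball 1 `<=` X -> X x -> 0 <= dl <= 1 -> `|c| = 1 ->
  (forall x', X x' -> dot c x' < dot c q) ->
  \sum_l c 0 l * (tracked x dl i l - q 0 l) < - (dl / 2).
Proof.
move=> cX bX Xx dl01 c1 sep.
have [|[a l]] := mx_norm_neq0 (x := c); first by rewrite -[mx_norm c]/(`|c|) c1 oner_neq0.
rewrite -[mx_norm c]/(`|c|) c1 (ord1 a) /= => cl.
have := sep _ (@tracked_margin _ _ _ _ _ cX bX Xx dl01 i (c 0 l) l _).
rewrite -cl lexx => /(_ isT).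
rewrite /dot -subr_lt0 -sumrB => h.
rewrite -subr_lt0 opprK; apply: le_lt_trans h.
under [leRHS]eq_bigr do rewrite !mxE mulrDr [_ + _ - _]addrAC -mulrBr.
rewrite big_split /= lerD //; last first.
rewrite (bigD1 l) //= eqxx mulr1 big1 => [|j /negbTE ->]; last by rewrite ?andbF !mulr0.
rewrite addr0 mulrCA -expr2.
have -> : c 0 l ^+ 2 = 1 by rewrite -real_normK ?num_real // -cl expr1n.
by rewrite mulr1.
by apply: ler_sum => j _; rewrite !mxE.
Qed.

(** At a query that is not eps-good, quasar-convexity makes the gradient less than -lam eps on
    [x - q]. Replacing [x] by a tracked point adds dl times a sum of d terms, each at most B (r+1);
    this is at most half of the margin. *)
Lemma quasar_cut (R : realType) d (X : set 'rV[R]_d) (f : 'rV[R]_d -> R) (lam B eps r dl : R)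
    (x q : 'rV[R]_d) i :
  (0 < d)%N -> 0 < lam -> X `<=` eball r -> eball 1 `<=` X ->
  quasar_convex X f lam x -> X q -> (forall x, X x -> enorm (grad f x) <= B) ->
  0 < dl -> dl * (d%:R * (B * (r + 1))) <= lam * eps / 2 ->
  f x + eps < f q ->
  \sum_l grad f q 0 l * (tracked x dl i l - q 0 l) < - (lam * eps / 2).
Proof.
move=> d0 lam0 Xr bX [[Xx _] qc] Xq gB dl0 hdl fq.
have r0 (y : 'rV[R]_d) l : X y -> `|y 0 l| <= r by move=> /Xr; apply: enorm_coord.
have gq l : `|grad f q 0 l| <= B by apply: enorm_coord; apply: gB.
have h1 : dot (grad f q) (x - q) < - (lam * eps).
  have := qc _ Xq; rewrite -lerBrDl mulrC ler_pdivrMr // => h; nra.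
have -> : \sum_l grad f q 0 l * (tracked x dl i l - q 0 l) =
    dot (grad f q) (x - q) +
    dl * \sum_l grad f q 0 l * (2^-1 *+ (i == lift ord0 l) - x 0 l).
  rewrite /dot mulr_sumr -big_split /=; apply: eq_bigr => l _; rewrite !mxE.
  by rewrite -mulr_natr -[2^-1 *+ _]mulr_natr; ring.
have h2 : \sum_l grad f q 0 l * (2^-1 *+ (i == lift ord0 l) - x 0 l) <= d%:R * (B * (r + 1)).
  rewrite mulr_natl -[X in _ <= _ *+ X]card_ord -sumr_const; apply: ler_sum => l _.
  apply: le_trans (ler_norm _) _; rewrite normrM ler_pM //.
  apply: le_trans (ler_normB _ _) _; rewrite addrC lerD ?r0 //.
  by case: (_ == _); rewrite ?mulr1n ?mulr0n ?normr0 // ger0_norm ?invr_ge0 // invf_le1 // ler1n.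
have := ler_wpM2l (ltW dl0) h2; move: h1 hdl.
move: (dot _ _) (dl * \sum_l _) (dl * _) => a b c'; lra.
Qed.

(** * Bit lengths *)

Lemma nat_bits_le n b : (n <= 2 ^ b)%N -> (nat_bits n <= b.+1)%N.
Proof. by move=> h; rewrite /nat_bits ltnS -[b in (_ <= b)%N](@trunc_expnK 2) // leq_trunc_log. Qed.

Lemma nat_bitsM m n : (nat_bits (m * n) <= nat_bits m + nat_bits n)%N.
Proof.
rewrite {1}/nat_bits; have [->|mn0] := posnP (m * n); first by rewrite trunc_log0 addSn.
rewrite -(ltn_exp2l (m := 2)) //; apply: leq_ltn_trans (trunc_logP _ mn0) _ => //.
by rewrite expnD ltn_mul // trunc_log_ltn.
Qed.

Lemma leq_nat_bits m n : (m <= n)%N -> (nat_bits m <= nat_bits n)%N.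
Proof. by move=> h; rewrite ltnS leq_trunc_log. Qed.

(** By coprimality the reduced numerator divides [a] and the reduced denominator divides [b];
    cancellation can only shorten a fraction. *)
Lemma frac_num_den_le (a b : int) (q : rat) : b != 0 -> q = a%:~R / b%:~R ->
  (`|numq q| <= `|a|)%N /\ (`|denq q| <= `|b|)%N.
Proof.
move=> b0 qE; have eq : numq q * b = a * denq q.
  apply: (@intr_inj rat); rewrite !intrM -[q in denq q]divq_num_den -[q in numq q]divq_num_den.
  rewrite !divq_num_den; have := divq_num_den q; rewrite {3}qE.
  have d0 : (denq q)%:~R != 0 :> rat by rewrite intr_eq0 denq_neq0.
  have b0' : b%:~R != 0 :> rat by rewrite intr_eq0.
  by move=> /(canRL (divfK d0)) ->; rewrite mulrAC divfK.
have /eqP eqN : (`|numq q| * `|b| == `|a| * `|denq q|)%N by rewrite -!abszM eq.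
have co := coprime_num_den q.
split; last first.
  apply: dvdn_leq; first by rewrite absz_gt0.
  by rewrite -(@Gauss_dvdr _ `|numq q|) 1?coprime_sym // eqN dvdn_mull.
have [a0|a0] := eqVneq a 0; first by rewrite qE a0 mul0r.
apply: dvdn_leq; first by rewrite absz_gt0.
by rewrite -(@Gauss_dvdl _ _ `|denq q|) // -eqN dvdn_mulr.
Qed.

Lemma rat_bitsM x y : (rat_bits (x * y) <= rat_bits x + rat_bits y)%N.
Proof.
have e : x * y = (numq x * numq y)%:~R / (denq x * denq y)%:~R.
  by rewrite -[x in LHS]divq_num_den -[y in LHS]divq_num_den !intrM invfM mulrACA.
have [|h1 h2] := frac_num_den_le _ e; first by rewrite mulf_neq0 ?denq_neq0.
rewrite /rat_bits; have := leq_nat_bits h1; have := leq_nat_bits h2; rewrite !abszM.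
have := nat_bitsM `|numq x| `|numq y|; have := nat_bitsM `|denq x| `|denq y|.
lia.
Qed.

(** Bit lengths of fractions behave badly under addition. Sizes are therefore controlled through the
    magnitude of integers and turned into bit lengths, by [fits_bits], only when an instruction is
    charged. *)
Definition fits (b : nat) (q : rat) : Prop := q \is a Num.int /\ `|q| <= 2 ^+ b.

Lemma fitsP b q : fits b q -> exists2 z : int, q = z%:~R & (`|z| <= 2 ^ b)%N.
Proof.
case=> /intrP[z ->] h; exists z => //.
by rewrite -(ler_nat rat) natrX pmulrn abszE intr_norm.
Qed.

Lemma fits_bits b q : fits b q -> (rat_bits q <= b + 3)%N.
Proof.
case/fitsP => z -> h; rewrite /rat_bits numq_int denq_int.
have := nat_bits_le h; have : nat_bits `|1%R : int| = 1%N by [].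
lia.
Qed.

Lemma fits_leq b c q : (b <= c)%N -> fits b q -> fits c q.
Proof. by move=> bc [h1 h2]; split => //; apply: le_trans h2 _; rewrite ler_weXn2l // ler1n. Qed.

Lemma fits_nat n : fits n n%:R.
Proof. by split; rewrite ?natr_int // ger0_norm // -natrX ler_nat ltnW // ltn_expl. Qed.

Lemma fitsN b q : fits b q -> fits b (- q).
Proof. by case=> h1 h2; split; rewrite ?rpredN // normrN. Qed.

(** Cruder than a maximum, but linear in the exponents, so that the side conditions on costs stay
    within linear arithmetic. *)
Lemma fitsD b c x y : fits b x -> fits c y -> fits (b + c).+1 (x + y).
Proof.
case=> x1 x2 [y1 y2]; split; first by rewrite rpredD.
apply: le_trans (ler_normD _ _) _.
have hb : 1 <= 2 ^+ b :> rat by rewrite exprn_ege1 // ler1n.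
have hc : 1 <= 2 ^+ c :> rat by rewrite exprn_ege1 // ler1n.
rewrite exprS exprD; nra.
Qed.

Lemma fitsB b c x y : fits b x -> fits c y -> fits (b + c).+1 (x - y).
Proof. by move=> hx /fitsN; apply: fitsD. Qed.

Lemma fitsM b c x y : fits b x -> fits c y -> fits (b + c) (x * y).
Proof.
case=> x1 x2 [y1 y2]; split; first by rewrite rpredM.
by rewrite normrM exprD ler_pM.
Qed.

Lemma fits_floor b (x : rat) : `|x| <= 2 ^+ b -> fits b (Num.floor x)%:~R.
Proof.
move=> h; split; first exact: intr_int.
have e : 2 ^+ b = ((2 ^ b)%N%:Z)%:~R :> rat by rewrite -pmulrn natrX.
move: h; rewrite -intr_norm e ler_int !ler_norml => /andP[h1 h2]; apply/andP; split.
  by rewrite floor_ge_int rmorphN.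
by rewrite -(ler_int rat); apply: le_trans h2; exact: floor_le.
Qed.

Lemma fits_quo b (x y : rat) : y \is a Num.int -> fits b x -> fits b (Num.floor (x / y))%:~R.
Proof.
move=> yi [xi h]; apply: fits_floor; have [->|y0] := eqVneq y 0.
  by rewrite invr0 mulr0 normr0 exprn_ge0.
apply: le_trans h; rewrite normrM normfV ler_pdivrMr ?normr_gt0 //.
by rewrite ler_peMr // norm_intr_ge1.
Qed.

Lemma fits_sum b k (F : nat -> rat) : (forall i, (i < k)%N -> fits b (F i)) ->
  fits (b + k) (\sum_(i < k) F i).
Proof.
move=> h; split; first by apply: rpred_sum => i _; case: (h i).
apply: le_trans (ler_norm_sum _ _ _) _.
apply: le_trans (_ : \sum_(i < k) 2 ^+ b <= _); first by apply: ler_sum => i _; case: (h i).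
rewrite sumr_const card_ord exprD -[_ *+ k]mulr_natr ler_wpM2l ?exprn_ge0 //.
by rewrite -natrX ler_nat ltnW // ltn_expl.
Qed.

(** * Functions bounded by polynomials *)

Definition polybounded (f : nat -> nat) : Prop := exists T : {poly nat}, forall x, (f x <= T.[x])%N.

Lemma polybounded_cst a : polybounded (fun=> a).
Proof. by exists a%:P => x; rewrite hornerC. Qed.

Lemma polybounded_id : polybounded id.
Proof. by exists 'X => x; rewrite hornerX. Qed.

Lemma polyboundedD f g : polybounded f -> polybounded g -> polybounded (fun x => f x + g x)%N.
Proof. by move=> [S hS] [T hT]; exists (S + T) => x; rewrite hornerD leq_add. Qed.

Lemma polyboundedM f g : polybounded f -> polybounded g -> polybounded (fun x => f x * g x)%N.
Proof. by move=> [S hS] [T hT]; exists (S * T) => x; rewrite hornerM leq_mul. Qed.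

Lemma horner_leq (p : {poly nat}) x y : (x <= y)%N -> (p.[x] <= p.[y])%N.
Proof.
move=> xy; rewrite !horner_coef; apply: leq_sum => i _.
apply: leq_mul => //; case: (nat_of_ord i) => // k.
by rewrite natrXE natrXE leq_exp2r.
Qed.

Lemma polybounded_horner (p : {poly nat}) f : polybounded f -> polybounded (fun x => p.[f x]).
Proof.
by move=> [T hT]; exists (p \Po T) => x; rewrite horner_comp horner_leq.
Qed.

Lemma polyboundedX f k : polybounded f -> polybounded (fun x => f x ^ k)%N.
Proof.
move=> hf; elim: k => [|k IH]; first exact: polybounded_cst.
have [T hT] := polyboundedM hf IH; exists T => x; rewrite expnS; exact: hT.
Qed.

(** * Program logic *)

(** Describes the memory after [k] rounds of a loop that fills consecutive cells from [a] on. *)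
Definition upd_range (m : nat -> rat) (a k : nat) (g : nat -> rat) : nat -> rat :=
  fun x => if (a <= x < a + k)%N then g (x - a)%N else m x.

Lemma upd_range_in m a k g i : (i < k)%N -> upd_range m a k g (a + i)%N = g i.
Proof. by move=> ik; rewrite /upd_range leq_addr ltn_add2l ik addKn. Qed.

Lemma upd_range_out m a k g x : (x < a)%N || (a + k <= x)%N -> upd_range m a k g x = m x.
Proof.
by rewrite /upd_range [(x < a + k)%N]ltnNge; case: ltnP => //= h; case: (_ <= x)%N.
Qed.

Lemma upd_range0 m a g : upd_range m a 0 g = m.
Proof. by apply: funext => x; rewrite upd_range_out // addn0 ltnNge orNb. Qed.

Lemma upd_rangeS m a k g :
  [eta upd_range m a k g with (a + k)%N |-> g k] = upd_range m a k.+1 g :> (nat -> rat).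
Proof.
apply: funext => x /=; rewrite /upd_range addnS ltnS.
have [->|xk] := eqVneq x (a + k)%N; first by rewrite leqnn leq_addr addKn.
by rewrite [(x <= _)%N]leq_eqVlt (negbTE xk).
Qed.

Lemma write_vecE d m a (v : 'rV[rat]_d) :
  write_vec m a v = upd_range m a d (fun j => oapp (v 0) 0 (insub j)).
Proof.
apply: funext => x; rewrite /write_vec /upd_range; case: (leqP a x) => //= ax.
rewrite -ltn_subLR //; case: ltnP => h; first by rewrite !insubT.
by rewrite insubF // ltnNge h.
Qed.

Definition blk (il : seq instr) : cmd := foldr (fun i c => Seq (Do i) c) Skip il.
Arguments blk : simpl never.

Section Logic.
Context (R : realType) (d : nat) (O : oracles R d).
Implicit Types (s : state R) (c : cmd) (E : seq rat) (m : nat -> rat) (v : nat -> R).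

Definition run (il : seq instr) s : state R := foldl (fun s i => step O i s) s il.

Fixpoint cost_each (t : nat) (il : seq instr) s : Prop :=
  if il is i :: il' then (cost O i s <= t)%N /\ cost_each t il' (step O i s) else True.

(** Total correctness: halting within time [t] is part of the assertion. Since [t] is only an upper
    bound, bounds can be weakened freely. *)
Definition runs c s (t : nat) (Q : state R -> Prop) : Prop :=
  exists n s', [/\ exec O c s n s', (n <= t)%N & Q s'].

Lemma runs_weaken c s t t' (Q Q' : state R -> Prop) :
  runs c s t Q -> (t <= t')%N -> (forall s', Q s' -> Q' s') -> runs c s t' Q'.
Proof.
move=> [n [s' [e h q]]] tt' QQ'; exists n, s'; split=> //; last exact: QQ'.
exact: leq_trans tt'.
Qed.

Lemma runs_skip s (Q : state R -> Prop) : Q s -> runs Skip s 0 Q.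
Proof. by exists 0%N, s; split=> //; exact: ExecSkip. Qed.

Lemma runs_blk t il s (Q : state R -> Prop) :
  cost_each t il s -> Q (run il s) -> runs (blk il) s (size il * t) Q.
Proof.
elim: il s => [|i il IH] s /=; first by move=> _; exact: runs_skip.
move=> [ci /IH h] /h [n [s' [e nt q]]].
exists (cost O i s + n)%N, s'; split=> //; first exact: ExecSeq (ExecDo _ _ _) e.
by rewrite mulSn leq_add.
Qed.

Lemma runs_seq c1 c2 s t1 t2 (Q1 Q2 : state R -> Prop) :
  runs c1 s t1 Q1 -> (forall s', Q1 s' -> runs c2 s' t2 Q2) -> runs (Seq c1 c2) s (t1 + t2) Q2.
Proof.
move=> [n1 [s1 [e1 l1 q1]]] /(_ _ q1) [n2 [s2 [e2 l2 q2]]].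
exists (n1 + n2)%N, s2; split=> //; [exact: ExecSeq e1 e2|exact: leq_add].
Qed.

Lemma runs_if b c1 c2 s t (Q : state R -> Prop) :
  runs (if holds b s then c1 else c2) s t Q -> runs (If b c1 c2) s t.+1 Q.
Proof. by move=> [n [s' [e l q]]]; exists n.+1, s'; split=> //; exact: ExecIf. Qed.

Definition regs (p : nat) s : seq rat := [seq reg s r | r <- iota 0 p].

Lemma nth_regs p s r : (r < p)%N -> nth 0 (regs p s) r = reg s r.
Proof. by move=> rp; rewrite (nth_map 0%N) ?size_iota // nth_iota // add0n. Qed.

Lemma regsS p s : regs p.+1 s = rcons (regs p s) (reg s p).
Proof. by rewrite /regs -addn1 iotaD map_cat cats1. Qed.

Lemma eq_regs p s s' : (forall r, (r < p)%N -> reg s r = reg s' r) -> regs p s = regs p s'.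
Proof. by move=> e; apply/eq_in_map => r; rewrite mem_iota => /e. Qed.

(* The registers below [size E] hold [E]; the others are scratch. *)
Definition at_state E m v s : Prop := [/\ regs (size E) s = E, mem s = m & vreg s = v].

Lemma at_reg E m v s r : at_state E m v s -> (r < size E)%N -> reg s r = nth 0 E r.
Proof. by move=> [e _ _] h; rewrite -(nth_regs s h) e. Qed.

Lemma at_rcons E x m v s :
  at_state (rcons E x) m v s <-> at_state E m v s /\ reg s (size E) = x.
Proof.
rewrite /at_state size_rcons regsS; split=> [[/rcons_inj[h ->] ? ?]|[[-> ? ?] ->]] //.
Qed.

Lemma at_set_reg E m v s r q : (size E <= r)%N ->
  at_state E m v s -> at_state E m v (set_reg s r q).
Proof.
move=> er [h1 h2 h3]; split=> //; rewrite -[RHS]h1; apply: eq_regs => k kE /=.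
by rewrite ltn_eqF // (leq_trans kE).
Qed.

Lemma at_set_mem E m v s m' : at_state E m v s -> at_state E m' v (State (reg s) m' (vreg s)).
Proof. by move=> [h1 h2 h3]; split. Qed.

(* the register holding the constant 1 *)
Notation one := 4%N.

(** The only numeric test is [Le], so the limit register holds the last index rather than the number
    of rounds. This is why [env] stores d - 1, N - 1 and the like. *)
Definition For (i lim : nat) c : cmd :=
  Seq (blk [:: Const i 0])
      (While (Le i lim) (Seq c (blk [:: Arith OpAdd i i one]))).

(** Clearing the counter costs 3 and the final failing test 1. A round costs the body, at most len +
    3 for the increment, and 1 for the test. *)
Definition for_time (len t : nat) : nat := (4 + len * (t + len + 4))%N.

(* [I k] may only depend on the counter through [reg s i = k]. *)
Lemma runs_for (I : nat -> state R -> Prop) i lim c len t s :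
  (0 < len)%N -> (i != lim) -> i != one ->
  (forall k s, I k s -> reg s lim = len%:R - 1 /\ reg s one = 1) ->
  (forall k s q, I k s -> I k (set_reg s i q)) ->
  (forall k s, (k < len)%N -> I k s -> reg s i = k%:R ->
     runs c s t (fun s' => I k.+1 s' /\ reg s' i = k%:R)) ->
  I 0%N s -> runs (For i lim c) s (for_time len t) (I len).
Proof.
move=> len0 ilim ione Ic Ii body I0.
have bits k : (k <= len)%N -> (rat_bits k%:R <= len + 3)%N.
  by move=> kl; apply: leq_trans (fits_bits (fits_nat k)) _; rewrite leq_add2r.
have loop j k s0 : (k + j = len)%N -> I k s0 -> reg s0 i = k%:R ->
    runs (While (Le i lim) (Seq c (blk [:: Arith OpAdd i i one]))) s0
      (j * (t + len + 4) + 1) (I len).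
  elim: j k s0 => [|j IH] k s0 kj Ik ki.
    exists 1%N, s0; split=> //; last by rewrite -kj addn0.
    apply: ExecWhileF; rewrite /= ki (Ic _ _ Ik).1 -ltNge -kj addn0.
    by rewrite ltrBlDr ltrDl.
  have kl : (k < len)%N by rewrite -kj -addSnnS leq_addr.
  have hb : holds (Le i lim) s0.
    by rewrite /= ki (Ic _ _ Ik).1 lerBrDr natr1 ler_nat.
  have [n1 [s1 [e1 l1 [q1 i1]]]] := body k s0 kl Ik ki.
  have e2 := ExecSeq (ExecDo O (Arith OpAdd i i one) s1) (ExecSkip _ _).
  have si : reg s1 i + reg s1 one = k.+1%:R.
    by rewrite i1 (Ic _ _ q1).2 natr1.
  have [|||n3 [s3 [e3 l3 q3]]] := IH k.+1 (step O (Arith OpAdd i i one) s1).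
  - by rewrite -kj addnS.
  - exact: Ii.
  - by rewrite /= eqxx i1 (Ic _ _ q1).2 natr1.
  exists ((n1 + (cost O (Arith OpAdd i i one) s1 + 0)) + n3).+1, s3; split=> //.
    by apply: ExecWhileT e3 => //; exact: ExecSeq e1 e2.
  have : (cost O (Arith OpAdd i i one) s1 <= len + 3)%N by rewrite /= si bits.
  by rewrite mulSn; lia.
have [|||n [s' [e l q]]] := loop len 0%N (step O (Const i 0) s).
- by [].
- exact: Ii.
- by rewrite /= eqxx.
exists ((cost O (Const i 0) s + 0) + n)%N, s'; split=> //.
  by apply: ExecSeq e; exact: ExecSeq (ExecDo _ _ _) (ExecSkip _ _).
have : cost O (Const i 0) s = 3%N by [].
by rewrite /for_time; lia.
Qed.

Definition Fill (i lim base : nat) c (res : nat) : cmd :=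
  For i lim (Seq c (blk [:: Arith OpAdd res.+1 base i; WriteMem res.+1 res])).

Definition fill_time (len a t : nat) : nat := for_time len (t + 2 * (a + len + 4)).

(** In round [k] the body sees a memory whose first [k] target cells already hold new values.
    Updates in place, as for the multipliers and the vertices, are possible because each round reads
    only cells that are not yet overwritten. *)
Lemma runs_fill E m v lim base c res len a t (g : nat -> rat) s :
  (0 < len)%N -> (lim < size E)%N -> (one < size E)%N -> (base < size E)%N ->
  (size E < res)%N ->
  nth 0 E lim = len%:R - 1 -> nth 0 E one = 1 -> nth 0 E base = a%:R ->
  (forall k s, (k < len)%N -> at_state (rcons E k%:R) (upd_range m a k g) v s ->
     runs c s t (fun s' => at_state (rcons E k%:R) (upd_range m a k g) v s'
                           /\ reg s' res = g k)) ->
  at_state E m v s ->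
  runs (Fill (size E) lim base c res) s (fill_time len a t)
    (at_state E (upd_range m a len g) v).
Proof.
move=> len0 hl ho hb er el eo eb body s0.
apply: (runs_for (I := fun k s => at_state E (upd_range m a k g) v s)) => //.
- by rewrite gtn_eqF.
- by rewrite gtn_eqF.
- by move=> k s1 h; rewrite !(at_reg h).
- by move=> k s1 q h; apply: at_set_reg.
- move=> k s1 kl h hk.
  apply: runs_seq; first by apply: (body k s1 kl); apply/at_rcons.
  move=> s2 [/at_rcons[h2 hk2] hr].
  have ad : reg s2 base + reg s2 (size E) = (a + k)%:R.
    by rewrite (at_reg h2) // eb hk2 natrD.
  have := @runs_blk (a + len + 4) [:: Arith OpAdd res.+1 base (size E); WriteMem res.+1 res] s2.
  apply.
    rewrite /= ad; split; last by split=> //; lia.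
    by apply: leq_trans (fits_bits (fits_nat _)) _; lia.
  rewrite /run /= /addr /= eqxx ad natrK (ltn_eqF (ltnSn res)) hr; split; last first.
    by rewrite ltn_eqF // ltnW.
  have [r2 m2 v2] := at_set_reg (r := res.+1) (a + k)%:R (leqW (ltnW er)) h2.
  by split=> //=; rewrite -upd_rangeS -m2.
- by rewrite upd_range0.
Qed.

Definition Sum (acc lim : nat) c (res : nat) : cmd :=
  Seq (blk [:: Const acc 0])
      (For acc.+1 lim (Seq c (blk [:: Arith OpAdd acc acc res]))).

Definition sum_time (len b t : nat) : nat := (3 + for_time len (t + b))%N.

(** Every partial sum is written to a register and charged, which is why the bound on bit lengths is
    required for all prefixes. *)
Lemma runs_sum E m v lim c res len b t (h : nat -> rat) s :
  (0 < len)%N -> (lim < size E)%N -> (one < size E)%N -> ((size E).+1 < res)%N ->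
  nth 0 E lim = len%:R - 1 -> nth 0 E one = 1 ->
  (forall k, (k <= len)%N -> (rat_bits (\sum_(x < k) h x) <= b)%N) ->
  (forall k a s, (k < len)%N -> at_state (rcons (rcons E a) k%:R) m v s ->
     runs c s t (fun s' => at_state (rcons (rcons E a) k%:R) m v s' /\ reg s' res = h k)) ->
  at_state E m v s ->
  runs (Sum (size E) lim c res) s (sum_time len b t)
    (at_state (rcons E (\sum_(x < len) h x)) m v).
Proof.
move=> len0 hl ho er el eo hb body s0.
have := @runs_blk 3 [:: Const (size E) 0] s (at_state (rcons E 0) m v).
move=> /(_ (conj (leqnn _) I)) h0.
apply: (runs_seq (h0 _)).
  by apply/at_rcons; split; [apply: at_set_reg|rewrite /= eqxx].
move=> s1 h1.
apply: (runs_for (I := fun k s => at_state (rcons E (\sum_(x < k) h x)) m v s)) => //.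
- by rewrite gtn_eqF // leqW.
- by rewrite gtn_eqF // leqW.
- by move=> k s2 hs; rewrite !(at_reg hs) ?size_rcons ?leqW // !nth_rcons hl ho.
- by move=> k s2 q hs; apply: at_set_reg; rewrite ?size_rcons.
- move=> k s2 kl h2 hk; apply: runs_seq.
    by apply: (body k _ s2 kl); apply/at_rcons; split; [exact: h2|rewrite size_rcons].
  move=> s3 [/at_rcons[]]; rewrite size_rcons => /at_rcons[h3 ha] hk3 hr.
  have e : \sum_(x < k) h x + h k = \sum_(x < k.+1) h x by rewrite big_ord_recr.
  have := @runs_blk b [:: Arith OpAdd (size E) (size E) res] s3.
  rewrite [(size _ * b)%N]mul1n; apply.
    by split=> //=; rewrite ha hr e; apply: hb.
  rewrite /run /= gtn_eqF //; split=> //; apply/at_rcons; split; first exact: at_set_reg.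
  by rewrite /= eqxx ha hr e.
- by rewrite big_ord0.
Qed.

End Logic.

(** * The program *)

(* Registers 0 to 16 hold constants, listed by env; 17 counts the iterations, 18 is the common
   denominator of the vertices and the others are scratch. Memory: the best point found is at
   0, the oracle answer at d, the query point at 2 d, the kept vertex at 3 d, the values of the
   cut at the vertices (later the multipliers of the edges) at 4 d, the vertices at 6 d. *)
Definition env (d N Q M P : nat) (lam eps B : rat) : seq rat :=
  [:: d%:R; lam; eps; B; 1; d%:R - 1; d.+1%:R; (d.+1 * d)%:R - 1;
      (2 * d)%:R; (3 * d)%:R; (4 * d)%:R; (6 * d)%:R;
      Q%:R; M%:R; P%:R; P%:R^-1; N%:R - 1].

Definition vertex (d : nat) (m : nat -> rat) (i j : nat) : rat := m (6 * d + (i * d + j))%N.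

Definition read_vertex (t i j : nat) : seq instr :=
  [:: Arith OpMul t i 0; Arith OpAdd t t j; Arith OpAdd t 11 t; ReadMem t t].

Definition values_cmd : cmd :=
  Fill 19 0 10 (Sum 20 5 (blk (read_vertex 22 19 21 ++
    [:: Arith OpAdd 23 0 21; ReadMem 24 23; Arith OpMul 25 24 22])) 25) 20.

Definition total_cmd : cmd := Sum 19 0 (blk [:: Arith OpAdd 21 10 20; ReadMem 22 21]) 22.

Definition argmin_cmd : cmd :=
  Seq (blk [:: Const 20 0; ReadMem 21 10])
      (For 22 0 (Seq (blk [:: Arith OpAdd 23 10 22; ReadMem 24 23])
                     (If (Le 24 21) (blk [:: Move 21 24; Move 20 22]) Skip))).

(** Register 21 holds the smallest value of the cut at first and [al] afterwards. The multipliers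
    replace the values of the cut in the same cells; the final addition of 1 rounds up. *)
Definition multipliers_cmd : cmd :=
  Seq (blk [:: Arith OpMul 21 6 21; Arith OpSub 21 19 21; Arith OpMul 22 13 21;
               Arith OpMul 23 12 22])
      (Fill 24 0 10 (blk [:: Arith OpAdd 25 10 24; ReadMem 26 25; Arith OpMul 26 6 26;
          Arith OpSub 26 26 19; Arith OpAdd 26 22 26; Arith OpQuo 26 23 26;
          Arith OpAdd 26 26 4]) 26).

(** The vertices are updated in place, and the row of the kept vertex is itself multiplied by Q. Its
    old coordinates are still needed by the later rows, hence the copy. *)
Definition pivot_cmd : cmd := Fill 24 5 9 (blk (read_vertex 25 20 24)) 25.

Definition vertices_cmd : cmd :=
  Fill 24 7 11 (blk [:: Arith OpQuo 25 24 0; Arith OpMul 26 25 0; Arith OpSub 26 24 26;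
      Arith OpAdd 26 9 26; ReadMem 27 26; Arith OpAdd 26 10 25; ReadMem 28 26;
      Arith OpAdd 26 11 24; ReadMem 29 26; Arith OpSub 29 29 27; Arith OpMul 29 28 29;
      Arith OpMul 27 12 27; Arith OpAdd 29 27 29]) 29.

(** * Correctness and cost of the stages of a cut, with every instruction costing at most [c] *)

Section Stages.
Context (R : realType) (d : nat) (O : oracles R d).
Variables (N Q M P : nat) (lam eps B : rat).
Notation E0 := (env d N Q M P lam eps B).
Implicit Types (m : nat -> rat) (v : nat -> R).
Variable (c : nat).

Lemma nat_cost k : (k + 3 <= c)%N -> (rat_bits k%:R <= c)%N.
Proof. by move=> h; apply: leq_trans h; apply: fits_bits; apply: fits_nat. Qed.

Lemma fits_cost b q : fits b q -> (b + 3 <= c)%N -> (rat_bits q <= c)%N.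
Proof. by move=> /fits_bits h; apply: leq_trans. Qed.

Lemma values_runs it S m v s bC bV :
  (0 < d)%N -> (d.+1 * d + 10 * d + 3 <= c)%N -> (bC + bV + d + 3 <= c)%N ->
  (forall j, (j < d)%N -> fits bC (m (d + j)%N)) ->
  (forall i j, (i < d.+1)%N -> (j < d)%N -> fits bV (vertex d m i j)) ->
  at_state (E0 ++ [:: it; S]) m v s ->
  runs O values_cmd s (fill_time d.+1 (4 * d) (sum_time d c (7 * c)))
    (at_state (E0 ++ [:: it; S])
       (upd_range m (4 * d) d.+1 (fun i => \sum_(j < d) m (d + j)%N * vertex d m i j)) v).
Proof.
move=> d0 cd cb hC hV h0.
set g := (fun i => \sum_(j < d) m (d + j)%N * vertex d m i j).
apply: (@runs_fill _ _ _ (E0 ++ [:: it; S])) => //=.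
  by rewrite -natr1 addrK.
move=> i s1 il h1.
set m1 := upd_range m (4 * d) i g in h1 *.
have rC j : (j < d)%N -> m1 (d + j)%N = m (d + j)%N.
  by move=> jd; rewrite /m1 upd_range_out //; apply/orP; left; lia.
have rV j : (j < d)%N -> vertex d m1 i j = vertex d m i j.
  by move=> jd; rewrite /vertex /m1 upd_range_out //; apply/orP; right; lia.
apply: (runs_weaken (Q := at_state (rcons (rcons (E0 ++ [:: it; S]) i%:R) (g i)) m1 v)).
- apply: (@runs_sum _ _ _ (rcons (E0 ++ [:: it; S]) i%:R) m1 v 5 _ 25 d c (7 * c)
     (fun j => m (d + j)%N * vertex d m i j)) => //=.
  + move=> k kd; apply: fits_cost cb.
    apply: (@fits_leq (bC + bV + k)); first by rewrite leq_add2l.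
    apply: (@fits_sum _ _ (fun j => m (d + j)%N * vertex d m i j)) => j jk.
    by have jd := leq_trans jk kd; exact: fitsM (hC _ jd) (hV _ _ il jd).
  move=> j a s2 jd h2.
  have [_ hm hv] := h2.
  have e1 : i%:R * d%:R + j%:R = (i * d + j)%:R :> rat by rewrite natrD natrM.
  have e2 : (6 * d)%:R + (i * d + j)%:R = (6 * d + (i * d + j))%:R :> rat by rewrite [RHS]natrD.
  have e3 : d%:R + j%:R = (d + j)%:R :> rat by rewrite [RHS]natrD.
  have hidx : (i * d + j <= d.+1 * d)%N by nia.
  apply: runs_blk.
  + rewrite /= /addr /= !(at_reg h2) //= e1 e2 e3 hm !natrK.
    rewrite -[m1 (6 * d + _)%N]/(vertex d m1 i j) rV // rC // -natrM.
    do !split=> //; first [by lia | by apply: nat_cost; nia | idtac].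
    by apply: (fits_cost (fitsM (hC _ jd) (hV _ _ il jd))); lia.
  + split=> //=.
    rewrite /addr /= !(at_reg h2) //= e1 e2 e3 hm !natrK.
    by rewrite -[m1 (6 * d + _)%N]/(vertex d m1 i j) rV // rC.
- by [].
- by move=> s2 /at_rcons[h2 h3].
Qed.

Lemma total_runs it S m v s bE :
  (0 < d)%N -> (10 * d + 3 <= c)%N -> (bE + d + 4 <= c)%N ->
  (forall i, (i < d.+1)%N -> fits bE (m (4 * d + i)%N)) ->
  at_state (E0 ++ [:: it; S]) m v s ->
  runs O total_cmd s (sum_time d.+1 c (2 * c))
    (at_state (E0 ++ [:: it; S; \sum_(i < d.+1) m (4 * d + i)%N]) m v).
Proof.
move=> d0 cd cb hE h0.
apply: (@runs_sum _ _ _ (E0 ++ [:: it; S]) m v 0 _ 22 d.+1 c (2 * c)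
  (fun i => m (4 * d + i)%N)) => //=.
- by rewrite -natr1 addrK.
- move=> k kd; apply: (@fits_cost (bE + d.+1)); last lia.
  apply: (@fits_leq (bE + k)); first by rewrite leq_add2l.
  by apply: (@fits_sum _ _ (fun i => m (4 * d + i)%N)) => j jk; apply: hE; lia.
- move=> i a s2 il h2; have [_ hm hv] := h2.
  have e1 : (4 * d)%:R + i%:R = (4 * d + i)%:R :> rat by rewrite [RHS]natrD.
  apply: runs_blk.
    rewrite /= /addr /= !(at_reg h2) //= e1.
    by do !split=> //; first [lia | apply: nat_cost; lia].
  by split=> //=; rewrite /addr /= !(at_reg h2) //= e1 hm natrK.
Qed.

(** The triple [l] bundles the contents of registers 17 to 19, which this stage preserves. *)
Lemma argmin_runs l m v s :
  let E := E0 ++ [:: l.1.1; l.1.2; l.2] in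
  let e i := m (4 * d + i)%N in
  (0 < d)%N -> (10 * d + 4 <= c)%N -> 
  at_state E m v s ->
  runs O argmin_cmd s (2 * c + for_time d.+1 (2 * c + (2 * c).+1))
    (fun s' => exists2 k, (k < d.+1)%N /\ (forall i, (i < d.+1)%N -> e k <= e i)
       & at_state (E ++ [:: k%:R; e k]) m v s').
Proof.
move=> E e d0 cd h0; have [_ hm0 hv0] := h0.
apply: (runs_seq (Q1 := at_state (E ++ [:: 0%:R; e 0%N]) m v)).
  have e0 : rat_bits 0 = 3%N by [].
  apply: runs_blk; first by do !split=> //=; rewrite ?e0; lia.
  rewrite /run [foldl _ _ _]/=; apply/(@at_rcons _ (E ++ [:: 0%:R])); split.
    by apply/(@at_rcons _ E).
  by rewrite /= /addr /= (at_reg h0) //= natrK hm0 /e addn0.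
move=> s1 h1.
pose I k s' := exists2 k0, (k0 < d.+1)%N /\ (forall i, (i < k)%N -> e k0 <= e i)
       & at_state (E ++ [:: k0%:R; e k0]) m v s'.
apply: (runs_for (I := I)) => //.
- by move=> k s2 [k0 _ hs]; rewrite !(at_reg hs) //= -natr1 addrK.
- move=> k s2 kl [k0 [k0l kmin] hs] hk.
  have [_ hm hv] := hs.
  have e1 : (4 * d)%:R + k%:R = (4 * d + k)%:R :> rat by rewrite [RHS]natrD.
  apply: (runs_seq (Q1 := fun s' => [/\ at_state (E ++ [:: k0%:R; e k0]) m v s',
      reg s' 22 = k%:R & reg s' 24 = e k])).
    apply: runs_blk.
      rewrite /= /addr /= hk !(at_reg hs) //= e1.
      by do !split=> //; first [lia | apply: nat_cost; lia].
    by split=> //=; rewrite /addr /= hk !(at_reg hs) //= e1 hm natrK.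
  move=> s3 [h3 k3 r3]; apply: runs_if.
  rewrite /= r3 (at_reg h3) //=; case: ifP => [le|/negbT].
    apply: runs_blk; first by do !split=> //=; lia.
    split; last by [].
    exists k; first split=> // i.
      by rewrite ltnS leq_eqVlt => /predU1P[-> //|/kmin]; apply: le_trans.
    apply/(@at_rcons _ (E ++ [:: k%:R])); split; last by rewrite /= r3.
    apply/(@at_rcons _ E); split; last by rewrite /= k3.
    by have [r m3 v3] := h3; split=> //; rewrite /= -[RHS]/(take 20 (E ++ [:: k0%:R; e k0])) -r.
  rewrite -ltNge => lt; apply: (runs_weaken (t := 0)
    (Q := fun s' => I k.+1 s' /\ reg s' 22 = k%:R)) => //.
    apply: runs_skip; split; last exact: k3; exists k0 => //; split=> // i.
    by rewrite ltnS leq_eqVlt => /predU1P[->|/kmin //]; exact: ltW.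
- by exists 0%N.
Qed.

(** Q times the unrounded multiplier, rounded up. Rounding up keeps the tracked points inside the
    simplex and lengthens an edge by at most the fraction 1/Q. *)
Definition multiplier (tau al : rat) (x : rat) : rat :=
  (Num.floor (Q%:R * (M%:R * al) / (M%:R * al + (d.+1%:R * x - tau))))%:~R + 1.

Lemma multipliers_runs it S tau k x m v s b :
  let al := tau - d.+1%:R * x in
  (0 < d)%N -> (10 * d + 4 <= c)%N -> (Q + 2 * M + 3 * d + 6 * b + 20 <= c)%N ->
  fits b tau -> fits b x -> (forall i, (i < d.+1)%N -> fits b (m (4 * d + i)%N)) ->
  at_state (E0 ++ [:: it; S; tau; k; x]) m v s ->
  runs O multipliers_cmd s (4 * c + fill_time d.+1 (4 * d) (7 * c))
    (at_state (E0 ++ [:: it; S; tau; k; al; M%:R * al; Q%:R * (M%:R * al)])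
       (upd_range m (4 * d) d.+1 (fun i => multiplier tau al (m (4 * d + i)%N))) v).
Proof.
move=> al d0 cd cb ft fx hm0 h0.
have fal : fits (b + (d.+1 + b)).+1 al by apply: fitsB => //; apply: fitsM => //; exact: fits_nat.
have fMal := fitsM (fits_nat M) fal; have fQal := fitsM (fits_nat Q) fMal.
apply: (runs_seq (Q1 := at_state
  (E0 ++ [:: it; S; tau; k; al; M%:R * al; Q%:R * (M%:R * al)]) m v)).
  have [r0 _ _] := h0.
  apply: runs_blk.
    rewrite /= !(at_reg h0) //= -/al.
    do !split=> //; [apply: (fits_cost (fitsM (fits_nat _) fx)) | apply: (fits_cost fal)
      | apply: (fits_cost fMal) | apply: (fits_cost fQal)]; lia.
  rewrite /run [foldl _ _ _]/=.
  apply/(@at_rcons _ (E0 ++ [:: it; S; tau; k; al; M%:R * al])); split; last first.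
    by rewrite /= !(at_reg h0).
  apply/(@at_rcons _ (E0 ++ [:: it; S; tau; k; al])); split; last first.
    by rewrite /= !(at_reg h0).
  apply/(@at_rcons _ (E0 ++ [:: it; S; tau; k])); split; last first.
    by rewrite /= !(at_reg h0).
  by do 4!apply: at_set_reg => //; case/(@at_rcons _ (E0 ++ [:: it; S; tau; k])): h0.
move=> s1 h1.
set g := (fun i => multiplier tau al (m (4 * d + i)%N)).
apply: (@runs_fill _ _ _ (E0 ++ [:: it; S; tau; k; al; M%:R * al; Q%:R * (M%:R * al)])) => //=.
  by rewrite -natr1 addrK.
move=> i s2 il h2; have [_ hm hv] := h2.
have e1 : (4 * d)%:R + i%:R = (4 * d + i)%:R :> rat by rewrite [RHS]natrD.
have e2 : upd_range m (4 * d) i g (4 * d + i)%N = m (4 * d + i)%N.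
  by rewrite upd_range_out // leqnn orbT.
have f1 := fitsM (fits_nat d.+1) (hm0 _ il); have f2 := fitsB f1 ft; have f3 := fitsD fMal f2.
have f4 := fits_quo f3.1 fQal; have f5 := fitsD f4 (fits_nat 1).
apply: runs_blk.
  rewrite /= /addr /= !(at_reg h2) //= e1 hm natrK e2.
  do !split=> //; first [by apply: nat_cost; lia | idtac];
    [lia | apply: (fits_cost f1) | apply: (fits_cost f2) | apply: (fits_cost f3)
      | apply: (fits_cost f4) | apply: (fits_cost f5) ]; lia.
split=> //=.
by rewrite /addr /= !(at_reg h2) //= e1 hm natrK e2.
Qed.

Lemma pivot_runs it S tau k y1 y2 y3 m v s :
  (0 < d)%N -> (d.+1 * d + 10 * d + 4 <= c)%N -> (k < d.+1)%N ->
  let E := E0 ++ [:: it; S; tau; k%:R; y1; y2; y3] in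
  at_state E m v s ->
  runs O pivot_cmd s (fill_time d (3 * d) (4 * c))
    (at_state E (upd_range m (3 * d) d (vertex d m k)) v).
Proof.
move=> d0 cd kd E h0.
apply: (@runs_fill _ _ _ (E0 ++ [:: it; S; tau; k%:R; y1; y2; y3])) => //=.
move=> j s1 jd h1; have [_ hm hv] := h1.
have e1 : k%:R * d%:R + j%:R = (k * d + j)%:R :> rat by rewrite natrD natrM.
have e2 : (6 * d)%:R + (k * d + j)%:R = (6 * d + (k * d + j))%:R :> rat by rewrite [RHS]natrD.
have hidx : (k * d + j <= d.+1 * d)%N by nia.
apply: runs_blk.
  rewrite /= /addr /= !(at_reg h1) //= e1 e2 -natrM.
  by do !split=> //; first [lia | apply: nat_cost; lia | apply: nat_cost; nia].
split=> //=.
rewrite /addr /= !(at_reg h1) //= e1 e2 hm natrK upd_range_out //.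
by apply/orP; right; lia.
Qed.

Lemma floor_divn (x y : nat) : (Num.floor (x%:R / y%:R : rat))%:~R = (x %/ y)%:R :> rat.
Proof.
have [->|y0] := posnP y; first by rewrite invr0 mulr0 floor0 divn0.
rewrite (@floor_def _ _ (x %/ y)%N%:Z) // -pmulrn; apply/andP; split.
  by rewrite ler_pdivlMr ?ltr0n // -natrM ler_nat leq_trunc_div.
by rewrite intrD -pmulrn natr1 ltr_pdivrMr ?ltr0n // -natrM ltr_nat ltn_ceil.
Qed.

Lemma vertices_runs it S tau k y1 y2 y3 m v s b b' :
  let E := E0 ++ [:: it; S; tau; k; y1; y2; y3] in
  (0 < d)%N -> (d.+1 * d + 10 * d + 4 <= c)%N -> (Q + 3 * b + b' + 10 <= c)%N ->
  (forall j, (j < d)%N -> fits b (m (3 * d + j)%N)) ->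
  (forall i, (i < d.+1)%N -> fits b' (m (4 * d + i)%N)) ->
  (forall i j, (i < d.+1)%N -> (j < d)%N -> fits b (vertex d m i j)) ->
  at_state E m v s ->
  runs O vertices_cmd s (fill_time (d.+1 * d) (6 * d) (13 * c))
    (at_state E (upd_range m (6 * d) (d.+1 * d) (fun x => Q%:R * m (3 * d + x %% d)%N +
        m (4 * d + x %/ d)%N * (m (6 * d + x)%N - m (3 * d + x %% d)%N))) v).
Proof.
move=> E d0 cd cb hK hU hV h0.
set g := (fun x => _).
apply: (@runs_fill _ _ _ (E0 ++ [:: it; S; tau; k; y1; y2; y3])) => //=.
  by rewrite muln_gt0.
move=> x s1 xl h1; have [_ hm hv] := h1.
have dx := divn_eq x d; have xm := ltn_pmod x d0.
have xd : (x %/ d < d.+1)%N by rewrite ltn_divLR.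
have e1 : x%:R - (x %/ d)%:R * d%:R = (x %% d)%:R :> rat.
  by rewrite -natrM {1}dx natrD addrAC subrr add0r.
have e2 : (3 * d)%:R + (x %% d)%:R = (3 * d + x %% d)%:R :> rat by rewrite [RHS]natrD.
have e3 : (4 * d)%:R + (x %/ d)%:R = (4 * d + x %/ d)%:R :> rat by rewrite [RHS]natrD.
have e4 : (6 * d)%:R + x%:R = (6 * d + x)%:R :> rat by rewrite [RHS]natrD.
set m1 := upd_range _ _ _ _ in h1 hm *.
have r2 : m1 (3 * d + x %% d)%N = m (3 * d + x %% d)%N.
  by rewrite /m1 upd_range_out //; apply/orP; left; lia.
have r3 : m1 (4 * d + x %/ d)%N = m (4 * d + x %/ d)%N.
  by rewrite /m1 upd_range_out //; apply/orP; left; lia.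
have r4 : m1 (6 * d + x)%N = m (6 * d + x)%N.
  by rewrite /m1 upd_range_out // leqnn orbT.
have fK := hK _ xm; have fU := hU _ xd.
have fV : fits b (m (6 * d + x)%N) by rewrite dx; exact: hV.
have f1 := fitsB fV fK; have f2 := fitsM fU f1; have f3 := fitsM (fits_nat Q) fK.
have f4 := fitsD f3 f2.
apply: runs_blk.
  rewrite /= /addr /= !(at_reg h1) //= floor_divn e1 e2 e3 e4 hm !natrK r2 r3 r4 -natrM.
  do !split=> //; first [lia | apply: nat_cost; nia | apply: (fits_cost f1); lia
    | apply: (fits_cost f2); lia | apply: (fits_cost f3); lia | apply: (fits_cost f4); lia ].
split=> //=.
by rewrite /addr /= !(at_reg h1) //= floor_divn e1 e2 e3 e4 hm !natrK r2 r3 r4.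
Qed.
End Stages.

(** * Queries and the rounding of oracle answers *)

Lemma rat_bits_div a b x y : fits a x -> fits b y -> (rat_bits (x / y) <= a + b + 3)%N.
Proof.
move=> /fitsP[z -> hz] /fitsP[w -> hw]; have [->|w0] := eqVneq w 0.
  by rewrite rmorph0 invr0 mulr0 (_ : rat_bits 0 = 3%N) //; lia.
have [h1 h2] := frac_num_den_le w0 (erefl (z%:~R / w%:~R : rat)).
have := nat_bits_le (leq_trans h1 hz); have := nat_bits_le (leq_trans h2 hw).
rewrite /rat_bits; move: (nat_bits _) (nat_bits _) => n1 n2; lia.
Qed.

(** The coordinates of the query are left unrounded. Each is a quotient of two integers of bounded
    magnitude, so its reduced form is short as well. *)
Definition query_cmd : cmd :=
  Seq (blk [:: Arith OpMul 19 6 18])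
      (Fill 20 5 8 (Seq (Sum 21 0 (blk (read_vertex 23 22 20)) 23)
                        (blk [:: Arith OpDiv 23 21 19])) 23).

(** A separating vector may have any number of digits, so even its product with P could be too long
    to write down. The integer quotient by 1/P, held in register 15, gives the floor of that product
    and is charged for the rounded result only. *)
Definition scale_sep_cmd : cmd :=
  Fill 19 5 0 (blk [:: Arith OpAdd 20 0 19; ReadMem 21 20; Arith OpQuo 22 21 15]) 22.

(** The length of a gradient is bounded in terms of the query, so multiplying it by P is affordable.
    The digits of eps are not bounded, so eps enters only through the integer quotient, and P/eps is
    never formed. *)
Definition scale_grad_cmd : cmd :=
  Fill 19 5 0 (blk [:: Arith OpAdd 20 0 19; ReadMem 21 20; Arith OpMul 21 21 14;
                       Arith OpQuo 22 21 2]) 22.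

Definition copy_cmd : cmd :=
  Seq (blk [:: Const 19 0]) (Fill 20 5 19 (blk [:: Arith OpAdd 21 8 20; ReadMem 22 21]) 22).

Section Stages2.
Context (R : realType) (d : nat) (O : oracles R d).
Variables (N Q M P : nat) (lam eps B : rat).
Notation E0 := (env d N Q M P lam eps B).
Implicit Types (m : nat -> rat) (v : nat -> R).
Variables (c p : nat).

Definition centroid (m : nat -> rat) (S : rat) (j : nat) : rat :=
  (\sum_(i < d.+1) vertex d m i j) / (d.+1%:R * S).

Lemma query_runs it S m v s b a :
  (0 < d)%N -> (d.+1 * d + 10 * d + 4 <= c)%N -> (b + a + 2 * d + 10 <= c)%N ->
  fits a S -> (forall i j, (i < d.+1)%N -> (j < d)%N -> fits b (vertex d m i j)) ->
  at_state (E0 ++ [:: it; S]) m v s ->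
  runs O query_cmd s (c + fill_time d (2 * d) (sum_time d.+1 c (4 * c) + c))
    (at_state (E0 ++ [:: it; S; d.+1%:R * S]) (upd_range m (2 * d) d (centroid m S)) v).
Proof.
move=> d0 cd cb fS hV h0; have fnS := fitsM (fits_nat d.+1) fS.
apply: (runs_seq (Q1 := at_state (E0 ++ [:: it; S; d.+1%:R * S]) m v)).
  rewrite -[c]mul1n; apply: runs_blk.
    by rewrite /= !(at_reg h0) //=; split=> //; apply: (fits_cost fnS); lia.
  rewrite /run [foldl _ _ _]/=; apply/(@at_rcons _ (E0 ++ [:: it; S])); split.
    exact: at_set_reg.
  by rewrite /= !(at_reg h0).
move=> s1 h1.
apply: (@runs_fill _ _ _ (E0 ++ [:: it; S; d.+1%:R * S])) => //=.
move=> j s2 jd h2.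
set m1 := upd_range _ _ _ _ in h2 *.
have rV i : vertex d m1 i j = vertex d m i j.
  by rewrite /vertex /m1 upd_range_out //; apply/orP; right; lia.
have fs k : (k <= d.+1)%N -> fits (b + d.+1) (\sum_(i < k) vertex d m i j).
  move=> kd; apply: (@fits_leq (b + k)); first by rewrite leq_add2l.
  by apply: (@fits_sum _ _ (fun i => vertex d m i j)) => i ik; apply: hV => //; lia.
apply: runs_seq.
  apply: (@runs_sum _ _ _ (E0 ++ [:: it; S; d.+1%:R * S; j%:R]) m1 v 0 _ 23 d.+1 c (4 * c)
    (fun i => vertex d m i j)) => //=.
  - by rewrite -natr1 addrK.
  - by move=> k kd; apply: (fits_cost (fs _ kd)); lia.
  move=> i y s3 il h3; have [_ hm hv] := h3.
  have e1 : i%:R * d%:R + j%:R = (i * d + j)%:R :> rat by rewrite natrD natrM.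
  have e2 : (6 * d)%:R + (i * d + j)%:R = (6 * d + (i * d + j))%:R :> rat by rewrite [RHS]natrD.
  have hidx : (i * d + j <= d.+1 * d)%N by nia.
  apply: runs_blk.
    rewrite /= /addr /= !(at_reg h3) //= e1 e2 -natrM.
    by do !split=> //; first [lia | apply: nat_cost; lia | apply: nat_cost; nia].
  split=> //=.
  by rewrite /addr /= !(at_reg h3) //= e1 e2 hm natrK -rV.
move=> s3 h3.
rewrite -[c in runs _ _ _ c]mul1n; apply: runs_blk.
  rewrite /= !(at_reg h3) //=; split=> //.
  by apply: leq_trans (rat_bits_div (fs _ (leqnn _)) fnS) _; lia.
split; last by rewrite /= !(at_reg h3).
rewrite /run [foldl _ _ _]/=; apply: at_set_reg => //.
by case/(@at_rcons _ (E0 ++ [:: it; S; d.+1%:R * S; j%:R])): h3.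
Qed.

Lemma scale_sep_runs it S m v s :
  (0 < d)%N -> (10 * d + 4 <= c)%N -> (p + 3 <= c)%N ->
  (forall j, (j < d)%N -> `|m (d + j)%N / P%:R^-1| <= 2 ^+ p) ->
  at_state (E0 ++ [:: it; S]) m v s ->
  runs O scale_sep_cmd s (fill_time d d (3 * c))
    (at_state (E0 ++ [:: it; S])
      (upd_range m d d (fun j => (Num.floor (m (d + j)%N / P%:R^-1))%:~R)) v).
Proof.
move=> d0 cd cP hm0 h0.
apply: (@runs_fill _ _ _ (E0 ++ [:: it; S])) => //=.
move=> j s1 jd h1; have [_ hm hv] := h1.
have e1 : d%:R + j%:R = (d + j)%:R :> rat by rewrite [RHS]natrD.
have e2 g : upd_range m d j g (d + j)%N = m (d + j)%N.
  by rewrite upd_range_out // leqnn orbT.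
apply: runs_blk.
  rewrite /= /addr /= !(at_reg h1) //= e1 hm natrK e2.
  by do !split=> //; first [lia | apply: nat_cost; lia
    | apply: (fits_cost (fits_floor (hm0 _ jd))); lia].
by split=> //=; rewrite /addr /= !(at_reg h1) //= e1 hm natrK e2.
Qed.

Lemma scale_grad_runs it S m v s b g :
  (0 < d)%N -> (10 * d + 4 <= c)%N -> (b + 3 <= c)%N -> (g + (p + 3) <= c)%N ->
  fits p P%:R ->
  (forall j, (j < d)%N -> `|m (d + j)%N * P%:R / eps| <= 2 ^+ b) ->
  (forall j, (j < d)%N -> (rat_bits (m (d + j)%N) <= g)%N) ->
  at_state (E0 ++ [:: it; S]) m v s ->
  runs O scale_grad_cmd s (fill_time d d (4 * c))
    (at_state (E0 ++ [:: it; S])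
      (upd_range m d d (fun j => (Num.floor (m (d + j)%N * P%:R / eps))%:~R)) v).
Proof.
move=> d0 cd cb cg fP hm0 hg h0.
apply: (@runs_fill _ _ _ (E0 ++ [:: it; S])) => //=.
move=> j s1 jd h1; have [_ hm hv] := h1.
have e1 : d%:R + j%:R = (d + j)%:R :> rat by rewrite [RHS]natrD.
have e2 h : upd_range m d j h (d + j)%N = m (d + j)%N.
  by rewrite upd_range_out // leqnn orbT.
have hb : (rat_bits (m (d + j)%N * P%:R) <= c)%N.
  apply: leq_trans (rat_bitsM _ _) _; apply: leq_trans cg.
  by rewrite leq_add ?hg ?fits_bits.
apply: runs_blk.
  rewrite /= /addr /= !(at_reg h1) //= e1 hm natrK e2.
  by do !split=> //; first [lia | apply: nat_cost; lia
    | apply: (fits_cost (fits_floor (hm0 _ jd))); lia].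
by split=> //=; rewrite /addr /= !(at_reg h1) //= e1 hm natrK e2.
Qed.

Lemma copy_runs it S m v s :
  (0 < d)%N -> (10 * d + 4 <= c)%N -> at_state (E0 ++ [:: it; S]) m v s ->
  runs O copy_cmd s (c + fill_time d 0 (2 * c))
    (at_state (E0 ++ [:: it; S]) (upd_range m 0 d (fun j => m (2 * d + j)%N)) v).
Proof.
move=> d0 cd h0.
apply: (runs_seq (Q1 := at_state (E0 ++ [:: it; S; 0]) m v)).
  rewrite -[c]mul1n; apply: runs_blk.
    by split=> //=; have : rat_bits 0 = 3%N by []; lia.
  rewrite /run [foldl _ _ _]/=; apply/(@at_rcons _ (E0 ++ [:: it; S])); split=> //.
move=> s1 h1; apply: (runs_weaken (t := fill_time d 0 (2 * c)) (Q := at_state (E0 ++ [:: it; S; 0])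
    (upd_range m 0 d (fun j => m (2 * d + j)%N)) v)) => //; last first.
  by move=> s2 /(@at_rcons _ (E0 ++ [:: it; S]))[].
apply: (@runs_fill _ _ _ (E0 ++ [:: it; S; 0%:R]) _ _ _ _ _ _ _ 0%N) => //=.
move=> j s2 jd h2; have [_ hm hv] := h2.
have e1 : (2 * d)%:R + j%:R = (2 * d + j)%:R :> rat by rewrite [RHS]natrD.
have e2 h : upd_range m 0 j h (2 * d + j)%N = m (2 * d + j)%N.
  by rewrite upd_range_out // add0n leq_addl orbT.
apply: runs_blk.
  rewrite /= /addr /= !(at_reg h2) //= e1.
  by do !split=> //; first [lia | apply: nat_cost; lia].
by split=> //=; rewrite /addr /= !(at_reg h2) //= e1 hm natrK e2.
Qed.
End Stages2.

(** * The composed stages: one oracle query and one update of the simplex *)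

Definition ask_cmd : cmd :=
  Seq (blk [:: AskSep 8 0 19])
      (If (Le 4 19) scale_sep_cmd
          (Seq (blk [:: AskVal 1 8])
          (Seq (If (LeVal 1 0) (Seq (blk [:: MoveVal 0 1]) copy_cmd) Skip)
          (Seq (blk [:: AskGrad 8 0]) scale_grad_cmd)))).

Definition update_cmd : cmd :=
  Seq values_cmd (Seq total_cmd (Seq argmin_cmd (Seq multipliers_cmd
    (Seq pivot_cmd (Seq vertices_cmd (blk [:: Arith OpMul 18 12 18])))))).

Definition ask_time (d c : nat) : nat := (10 * c + fill_time d d (4 * c) + fill_time d 0 (2 * c) + 10)%N.

Definition update_time (d c : nat) : nat :=
  (fill_time d.+1 (4 * d) (sum_time d c (7 * c)) + (sum_time d.+1 c (2 * c) +
   ((2 * c + for_time d.+1 (2 * c + (2 * c).+1)) +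
   ((4 * c + fill_time d.+1 (4 * d) (7 * c)) + (fill_time d (3 * d) (4 * c) +
   (fill_time (d.+1 * d) (6 * d) (13 * c) + c))))))%N.

Section Stages3.
Context (R : realType) (d : nat) (O : oracles R d).
Variables (N Q M P : nat) (lam eps B : rat).
Notation E0 := (env d N Q M P lam eps B).
Implicit Types (m : nat -> rat) (v : nat -> R).
Variables (c p : nat).

Lemma fits_multiplier b tau al x : fits b tau -> fits b al -> fits b x ->
  fits (Q + M + b + 2) (multiplier d Q M tau al x).
Proof.
move=> ft fa fx; have f1 := fitsM (fits_nat M) fa; have f2 := fitsM (fits_nat Q) f1.
have f3 := fitsB (fitsM (fits_nat d.+1) fx) ft; have f4 := fitsD f1 f3.
by apply: fits_leq (fitsD (fits_quo f4.1 f2) (fits_nat 1)); lia.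
Qed.

Lemma read_vec_upd m a (g : nat -> rat) : read_vec d (upd_range m a d g) a = \row_j g j.
Proof. by apply/rowP => j; rewrite !mxE upd_range_in. Qed.

Lemma read_vec_out m a k g a' : (a' + d <= a)%N || (a + k <= a')%N ->
  read_vec d (upd_range m a k g) a' = read_vec d m a'.
Proof.
move=> h; apply/rowP => j; rewrite !mxE upd_range_out //.
by have := ltn_ord j; move: h => /orP[h|h] jd; apply/orP; [left|right]; lia.
Qed.

Lemma oapp_insub (x : 'rV[rat]_d) (j : 'I_d) : oapp (x 0) 0 (insub (j : nat)) = x 0 j.
Proof. by rewrite valK. Qed.

(** The interface to the correctness proof: the effect of a query on the cut and on the best point,
    free of scratch registers and of time. Values and gradients are asked only when membership has
    been asserted. *)
Definition asked m v m' v' : Prop :=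
  let q := read_vec d m (2 * d) in
  (exists c', [/\ o_sep O q = Some c',
       forall j : 'I_d, m' (d + j)%N = (Num.floor (c' 0 j / P%:R^-1))%:~R, v' 0%N = v 0%N
     & read_vec d m' 0 = read_vec d m 0]) \/
  [/\ o_sep O q = None,
      forall j : 'I_d, m' (d + j)%N = (Num.floor (o_grad O q 0 j * P%:R / eps))%:~R &
      (v' 0%N, read_vec d m' 0) = if o_val O q <= v 0%N then (o_val O q, q)
                                  else (v 0%N, read_vec d m 0)].

Lemma ask_runs it S m v s b g vb tg :
  let q := read_vec d m (2 * d) in
  (0 < d)%N -> (10 * d + 4 <= c)%N -> (p + 3 <= c)%N -> (b + 3 <= c)%N -> (g + (p + 3) <= c)%N ->
  (1 + vb + tg <= c)%N -> fits p P%:R -> (vec_bits q <= vb)%N ->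
  (forall c', o_sep O q = Some c' -> forall j, `|c' 0 j| <= 1) ->
  (o_sep O q = None -> (o_grad_time O q <= tg)%N /\
     forall j, `|o_grad O q 0 j * P%:R / eps| <= 2 ^+ b /\ (rat_bits (o_grad O q 0%R j) <= g)%N) ->
  at_state (E0 ++ [:: it; S]) m v s ->
  runs O ask_cmd s (ask_time d c)
    (fun s' => exists m' v', [/\ at_state (E0 ++ [:: it; S]) m' v' s',
       (forall x, (3 * d <= x)%N -> m' x = m x) & asked m v m' v']).
Proof.
move=> q d0 cd cp cb cg ct fP hvb hsep hgrad h0.
have [_ hm0 hv0] := h0.
have aq s' m' v' : at_state (E0 ++ [:: it; S]) m' v' s' -> arg d s' 8 = read_vec d m' (2 * d).
  by move=> h; have [_ hm _] := h; rewrite /arg /addr (at_reg h) //= natrK hm.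
have ac s' m' v' : at_state (E0 ++ [:: it; S]) m' v' s' -> addr s' 0 = d.
  by move=> h; rewrite /addr (at_reg h) //= natrK.
set E := E0 ++ [:: it; S] in aq ac h0 *.
pose m1 c' := upd_range m d d (fun j => oapp ((c' : 'rV[rat]_d) 0) 0 (insub j)).
apply: (@runs_weaken _ _ _ _ _ (1 * c + (9 * c + fill_time d d (4 * c) + fill_time d 0 (2 * c) + 10))).
2: by rewrite /ask_time; lia.
2: by move=> s'; exact.
apply: (runs_seq (Q1 := fun s' => match o_sep O q with
    | None => at_state E m v s' /\ reg s' 19 = 0
    | Some c' => at_state E (m1 c') v s' /\ reg s' 19 = 1 end)).
  apply: runs_blk.
    by rewrite /= (aq _ _ _ h0) -/q; split=> //; lia.
  rewrite /run [foldl _ _ _]/= (aq _ _ _ h0) -/q.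
  case: (o_sep O q) => [c'|]; split; rewrite /= ?eqxx //.
  apply: at_set_reg => //; rewrite /m1 -write_vecE -hm0 -{2}(ac _ _ _ h0).
  exact: at_set_mem h0.
move=> s1; case eq: (o_sep O q) => [c'|] [h1 r1];
  apply: (@runs_weaken _ _ _ _ _ (fill_time d d (4 * c) + fill_time d 0 (2 * c) + 9 * c).+1 _
    (fun s' => exists m' v', [/\ at_state (E0 ++ [:: it; S]) m' v' s',
       (forall x, (3 * d <= x)%N -> m' x = m x) & asked m v m' v'])) => //; try lia;
  apply: runs_if; rewrite /= r1 (at_reg h1) //=.
  have mc (j : nat) (jd : (j < d)%N) : m1 c' (d + j)%N = c' 0 (Ordinal jd).
    by rewrite /m1 upd_range_in // -[j]/(val (Ordinal jd)) oapp_insub.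
  apply: (runs_weaken (@scale_sep_runs _ _ _ _ _ _ _ _ _ _ c p _ _ _ _ _ d0 cd cp _ h1)).
  - move=> j jd; rewrite mc invrK normrM; case: fP => _ hP.
    by rewrite -[2 ^+ p]mul1r ler_pM // (hsep _ eq).
  - by rewrite /fill_time /for_time; nia.
  move=> s2 h2; eexists; exists v; split; first exact: h2.
    move=> x x3; rewrite upd_range_out; last by apply/orP; right; lia.
    by rewrite /m1 upd_range_out //; apply/orP; right; lia.
  left; exists c'; split=> //.
    by move=> j; rewrite upd_range_in // mc (_ : Ordinal _ = j) //; exact: val_inj.
  by rewrite !read_vec_out //; apply/orP; left; lia.
rewrite ?ler10 /=.
have [htg hg] := hgrad eq.
pose vq := o_val O q.
have t1 : (1 * c + (1 + (1 * c + (c + fill_time d 0 (2 * c))) + (1 * c + fill_time d d (4 * c))) <=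
   fill_time d d (4 * c) + fill_time d 0 (2 * c) + 9 * c)%N by lia.
apply: runs_weaken t1 _; last by move=> s'; exact.
pose v1 := [eta v with 1%N |-> vq] : nat -> R.
apply: (runs_seq (Q1 := at_state E m v1)).
  apply: runs_blk.
    by rewrite /= (aq _ _ _ h1) -/q; split=> //; lia.
  rewrite /run [foldl _ _ _]/= (aq _ _ _ h1) -/q; have [r2 m2 v2] := h1.
  by split=> //; rewrite /= v2.
move=> s2 h2; have [r2 m2 v2] := h2.
pose m3 := if vq <= v 0%N then upd_range m 0 d (fun j => m (2 * d + j)%N) else m.
pose v3 := if vq <= v 0%N then [eta v1 with 0%N |-> vq] : nat -> R else v1.
apply: (runs_seq (Q1 := at_state E m3 v3)).
  apply: (@runs_weaken _ _ _ _ _ (1 * c + (c + fill_time d 0 (2 * c))).+1 _ (at_state E m3 v3)) => //.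
  apply: runs_if; rewrite /= v2 /= /m3 /v3; case: ifP => _.
    apply: (runs_seq (Q1 := at_state E m ([eta v1 with 0%N |-> vq] : nat -> R))).
      apply: runs_blk; first by split=> //=; lia.
      by split=> //=; rewrite v2.
    by move=> s3 h3; apply: copy_runs.
  by apply: (runs_weaken (t := 0) (Q := at_state E m v1)) => //; exact: runs_skip.
move=> s3 h3.
have eq3 : read_vec d m3 (2 * d) = q.
  by rewrite /m3; case: ifP => // _; rewrite read_vec_out //; apply/orP; right; lia.
pose m4 := upd_range m3 d d (fun j => oapp (o_grad O q 0) 0 (insub j)).
have mc (j : nat) (jd : (j < d)%N) : m4 (d + j)%N = o_grad O q 0 (Ordinal jd).
  by rewrite /m4 upd_range_in // -[j]/(val (Ordinal jd)) oapp_insub.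
apply: (runs_seq (Q1 := at_state E m4 v3)).
  apply: runs_blk.
    by rewrite /= (aq _ _ _ h3) eq3; split=> //; lia.
  rewrite /run [foldl _ _ _]/= (aq _ _ _ h3) eq3 (ac _ _ _ h3); have [r4 m4' v4] := h3.
  by split=> //; rewrite /= m4' write_vecE.
move=> s4 h4.
apply: (runs_weaken (@scale_grad_runs _ _ _ _ _ _ _ _ _ _ c p _ _ _ _ _ b g
  d0 cd cb cg fP _ _ h4)) => //.
- by move=> j jd; rewrite mc; case: (hg (Ordinal jd)).
- by move=> j jd; rewrite mc; case: (hg (Ordinal jd)).
move=> s5 h5; eexists; exists v3; split; first exact: h5.
  move=> x x3; rewrite upd_range_out; last by apply/orP; right; lia.
  rewrite /m4 upd_range_out; last by apply/orP; right; lia.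
  by rewrite /m3; case: ifP => // _; rewrite upd_range_out //; apply/orP; right; lia.
right; split=> //.
  move=> j; rewrite upd_range_in // mc -/q (_ : Ordinal _ = j) //.
  exact: val_inj.
rewrite read_vec_out; last by apply/orP; left; lia.
rewrite /m4 read_vec_out; last by apply/orP; left; lia.
rewrite -/q -/vq /v3 /m3; case: ifP => _ //; congr (_, _).
by rewrite read_vec_upd; apply/rowP => j; rewrite !mxE.
Qed.
End Stages3.

Section Stages4.
Context (R : realType) (d : nat) (O : oracles R d).
Variables (N Q M P : nat) (lam eps B : rat).
Notation E0 := (env d N Q M P lam eps B).
Implicit Types (m : nat -> rat) (v : nat -> R).
Variables (c : nat).

(** The counterpart of [asked] for the simplex. The vertex [k] stays existential, since any vertex
    that minimizes the cut will do. *)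
Definition updated m m' : Prop := exists2 k, (k < d.+1)%N &
  let e i := \sum_(j < d) m (d + j)%N * vertex d m i j in
  let tau := \sum_(i < d.+1) e i in
  (forall i, (i < d.+1)%N -> e k <= e i) /\
  forall i j, (i < d.+1)%N -> (j < d)%N -> vertex d m' i j =
    Q%:R * vertex d m k j +
    multiplier d Q M tau (tau - d.+1%:R * e k) (e i) * (vertex d m i j - vertex d m k j).

Lemma update_runs it S m v s bC bV a :
  (0 < d)%N ->
  (d.+1 * d + 40 * d + 2 * Q + 3 * M + 20 * (bC + bV) + a + 60 <= c)%N ->
  fits a S -> (forall j, (j < d)%N -> fits bC (m (d + j)%N)) ->
  (forall i j, (i < d.+1)%N -> (j < d)%N -> fits bV (vertex d m i j)) ->
  at_state (E0 ++ [:: it; S]) m v s ->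
  runs O update_cmd s (update_time d c)
    (fun s' => exists m', [/\ at_state (E0 ++ [:: it; Q%:R * S]) m' v s',
       forall x, (x < d)%N -> m' x = m x & updated m m']).
Proof.
move=> d0 cd fS hC hV h0.
pose e i := \sum_(j < d) m (d + j)%N * vertex d m i j.
pose tau := \sum_(i < d.+1) e i.
have fe i : (i < d.+1)%N -> fits (bC + bV + d) (e i).
  move=> il; apply: (@fits_sum _ _ (fun j => m (d + j)%N * vertex d m i j)) => j jd.
  exact: fitsM (hC _ jd) (hV _ _ il jd).
have ft : fits (bC + bV + d + d.+1) tau by apply: (@fits_sum _ _ e).
have fe' i : (i < d.+1)%N -> fits (bC + bV + d + d.+1) (e i).
  by move=> il; apply: fits_leq (fe _ il); rewrite leq_addr.
rewrite /update_time.
apply: runs_seq.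
  by apply: (@values_runs _ _ _ N Q M P lam eps B c it S m v s bC bV); rewrite //; lia.
set m1 := upd_range _ _ _ _ => s1 h1.
have m1e i : (i < d.+1)%N -> m1 (4 * d + i)%N = e i by move=> il; rewrite /m1 upd_range_in.
have v1 i j : vertex d m1 i j = vertex d m i j.
  by rewrite /vertex /m1 upd_range_out //; apply/orP; right; lia.
apply: runs_seq.
  apply: (@total_runs _ _ _ N Q M P lam eps B c it S m1 v s1 (bC + bV + d)); rewrite //; try lia.
  by move=> i il; rewrite m1e //; exact: fe.
have -> : \sum_(i < d.+1) m1 (4 * d + i)%N = tau by apply: eq_bigr => i _; rewrite m1e.
move=> s2 h2.
apply: runs_seq.
  by apply: (@argmin_runs _ _ _ N Q M P lam eps B c (it, S, tau) m1 v s2); rewrite //; lia.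
move=> s3 [k [kl kmin] h3].
rewrite /= m1e // in h3.
pose al := tau - d.+1%:R * e k.
have fal : fits (2 * (bC + bV + d + d.+1) + d + 2) al.
  by apply: fits_leq (fitsB ft (fitsM (fits_nat _) (fe' _ kl))); lia.
apply: runs_seq.
  apply: (@multipliers_runs _ _ _ N Q M P lam eps B c it S tau k%:R (e k) m1 v s3 (bC + bV + d + d.+1));
    rewrite //; try lia.
  - exact: fe'.
  - by move=> i il; rewrite m1e //; exact: fe'.
rewrite -/al; set m2 := upd_range _ _ _ _ => s4 h4.
have m2e i : (i < d.+1)%N -> m2 (4 * d + i)%N = multiplier d Q M tau al (e i).
  by move=> il; rewrite /m2 upd_range_in // m1e.
have v2 i j : vertex d m2 i j = vertex d m i j.
  by rewrite -v1 {1}/vertex /m2 upd_range_out //; apply/orP; right; lia.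
apply: runs_seq.
  by apply: (@pivot_runs _ _ _ N Q M P lam eps B c it S tau k al (M%:R * al)
    (Q%:R * (M%:R * al)) m2 v s4); rewrite //; lia.
set m3 := upd_range _ _ _ _ => s5 h5.
have m3e i : (i < d.+1)%N -> m3 (4 * d + i)%N = multiplier d Q M tau al (e i).
  move=> il; rewrite -m2e // /m3 upd_range_out //; apply/orP; right; lia.
have v3 i j : vertex d m3 i j = vertex d m i j.
  by rewrite -v2 {1}/vertex /m3 upd_range_out //; apply/orP; right; lia.
have m3k j : (j < d)%N -> m3 (3 * d + j)%N = vertex d m k j.
  by move=> jd; rewrite /m3 upd_range_in.
apply: runs_seq.
  apply: (@vertices_runs _ _ _ N Q M P lam eps B c it S tau k%:R al (M%:R * al)
     (Q%:R * (M%:R * al)) m3 v s5 bV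
     (Q + M + (2 * (bC + bV + d + d.+1) + d + 2) + 2)); rewrite //; try lia.
  - by move=> j jd; rewrite m3k //; exact: hV.
  - move=> i il; rewrite m3e //; apply: fits_multiplier => //.
      by apply: fits_leq ft; lia.
    by apply: fits_leq (fe' _ il); lia.
  - by move=> i j il jd; rewrite v3; exact: hV.
set m4 := upd_range _ _ _ _ => s6 h6; have [r6 hm6 hv6] := h6.
rewrite -[c in runs _ _ _ c]mul1n; apply: runs_blk.
  rewrite /= !(at_reg h6) //=; split=> //; apply: (fits_cost (fitsM (fits_nat _) fS)); lia.
exists m4; split.
- rewrite /run [foldl _ _ _]/=; apply/(@at_rcons _ (E0 ++ [:: it])); split; last first.
    by rewrite /= !(at_reg h6).
  apply: at_set_reg => //; split=> //.
  by rewrite -[RHS]/(take 18 (E0 ++ [:: it; S; tau; k%:R; al; M%:R * al; Q%:R * (M%:R * al)])) -r6.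
- move=> x xd; rewrite /m4 upd_range_out; last by apply/orP; left; lia.
  rewrite /m3 upd_range_out; last by apply/orP; left; lia.
  rewrite /m2 upd_range_out; last by apply/orP; left; lia.
  by rewrite /m1 upd_range_out //; apply/orP; left; lia.
exists k => //; split.
  by move=> i il; have := kmin i il; rewrite !m1e.
move=> i j il jd.
have ij : (i * d + j < d.+1 * d)%N by nia.
rewrite {1}/vertex /m4 upd_range_in // modnMDl modn_small // divnMDl // divn_small // addn0.
by rewrite m3k // m3e // -[m3 (6 * d + _)%N]/(vertex d m3 i j) v3.
Qed.
End Stages4.

(** * Initialization *)

Definition constants_cmd : cmd := blk
  [:: Const 4 1; Arith OpSub 5 0 4; Arith OpAdd 6 0 4; Arith OpMul 7 6 0; Arith OpSub 7 7 4;
      Arith OpAdd 8 0 0; Arith OpAdd 9 8 0; Arith OpAdd 10 9 0; Arith OpAdd 11 9 9; Const 19 0].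

Fixpoint horner_cmd (a : seq nat) : cmd :=
  if a is x :: a' then
    Seq (horner_cmd a') (blk [:: Arith OpMul 19 19 0; Const 20 x%:R; Arith OpAdd 19 19 20])
  else Skip.

(** Register 19 becomes a positive radius r, registers 20 and 21 the integers K1 > B/eps and K2 >
    1/lam, register 22 the inverse of dl. Register 23 gets 4 (d+1) r / dl, an upper bound for the
    inverse d-th root 4 d r / dl of the initial determinant. Registers 24 and 25 are prepared for
    the computation of the logarithm. *)
Definition threshold_cmd : cmd := blk
  [:: Arith OpAdd 19 19 4; Arith OpQuo 20 3 2; Arith OpAdd 20 20 4;
      Arith OpQuo 21 4 1; Arith OpAdd 21 21 4; Const 22 2; Arith OpMul 22 22 20;
      Arith OpMul 22 22 21; Arith OpMul 22 22 6; Arith OpAdd 23 19 4; Arith OpMul 22 22 23;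
      Const 23 4; Arith OpMul 23 23 6; Arith OpMul 23 23 19; Arith OpMul 23 23 22;
      Const 24 1; Const 25 0].

Definition log_cmd : cmd :=
  While (Le 24 23) (blk [:: Arith OpAdd 24 24 24; Arith OpAdd 25 25 4]).

(** Register 25 changes from L to L + N - 1, the last index of the loop that computes 8^(L+N).
    Register 26 carries one literal after the other and ends with the 8 of that loop. *)
Definition parameters_cmd : cmd := blk
  [:: Arith OpMul 13 6 6; Arith OpMul 12 13 6; Const 26 16; Arith OpMul 16 26 12;
      Arith OpMul 16 16 25; Arith OpAdd 25 25 16; Arith OpSub 25 25 4; Arith OpSub 16 16 4;
      Const 26 32; Arith OpMul 12 26 12; Const 26 8; Arith OpMul 13 26 13; Const 14 1].

Definition precision_cmd : cmd :=
  Seq (For 27 25 (blk [:: Arith OpMul 14 14 26])) (blk [:: Arith OpDiv 15 4 14]).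

Section Initialization.
Context (R : realType) (d : nat) (O : oracles R d).
Variables (lam eps B : rat) (c : nat).
Implicit Types (m : nat -> rat) (v : nat -> R) (s : state R).

Definition env12 : seq rat :=
  [:: d%:R; lam; eps; B; 1; d%:R - 1; d.+1%:R; (d.+1 * d)%:R - 1;
      (2 * d)%:R; (3 * d)%:R; (4 * d)%:R; (6 * d)%:R].

Lemma constants_runs : (0 < d)%N -> (d.+1 * d + 10 * d + 10 <= c)%N ->
  runs O constants_cmd (init R d lam eps B) (10 * c)
    (fun s => at_state env12 (fun=> 0) (fun=> 0) s /\ reg s 19 = 0).
Proof.
move=> d0 cd.
have e1 : d%:R - 1 = d.-1%:R :> rat by rewrite -[in LHS](prednK d0) -natr1 addrK.
have e2 : d%:R + 1 = d.+1%:R :> rat by rewrite natr1.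
have e3 : d.+1%:R * d%:R = (d.+1 * d)%:R :> rat by rewrite natrM.
have nd0 : (0 < d.+1 * d)%N by rewrite muln_gt0.
have e4 : (d.+1 * d)%:R - 1 = (d.+1 * d).-1%:R :> rat by rewrite -[in LHS](prednK nd0) -natr1 addrK.
have e5 : d%:R + d%:R = (2 * d)%:R :> rat by rewrite -natrD addnn mul2n.
have e6 : (2 * d)%:R + d%:R = (3 * d)%:R :> rat by rewrite -natrD; congr (_%:R); lia.
have e7 : (3 * d)%:R + d%:R = (4 * d)%:R :> rat by rewrite -natrD; congr (_%:R); lia.
have e8 : (3 * d)%:R + (3 * d)%:R = (6 * d)%:R :> rat by rewrite -natrD; congr (_%:R); lia.
apply: runs_blk.
  rewrite /= e1 e2 e3 e4 e5 e6 e7 e8.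
  by do !split=> //; first [apply: nat_cost; lia | apply: (@nat_cost _ 1); lia
    | apply: (@nat_cost _ 0); lia].
split=> //; split=> //.
by rewrite /regs /= e2 e3 e5 e6 e7 e8.
Qed.

Lemma horner_runs m v s a : (0 < d)%N ->
  (horner_rec a d + 3 <= c)%N -> at_state env12 m v s -> reg s 19 = 0 ->
  runs O (horner_cmd a) s (size a * (3 * c))
    (fun s' => at_state env12 m v s' /\ reg s' 19 = (horner_rec a d)%:R).
Proof.
move=> d0 ca h0 r0; elim: a ca => [|x a IH] ca; first exact: runs_skip.
rewrite -[horner_rec (x :: a) d]/(horner_rec a d * d + x)%N in ca *.
rewrite [size _]/= mulSn [(3 * c + _)%N]addnC.
apply: (runs_seq (Q1 := fun s' => at_state env12 m v s' /\ reg s' 19 = (horner_rec a d)%:R)).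
  by apply: IH; nia.
move=> s1 [h1 r1].
have e1 : (horner_rec a d)%:R * d%:R = (horner_rec a d * d)%:R :> rat by rewrite natrM.
have e2 : (horner_rec a d * d)%:R + x%:R = (horner_rec a d * d + x)%:R :> rat.
  by rewrite natrD.
apply: runs_blk.
  rewrite /= r1 (at_reg h1) //= e1 e2.
  by do !split=> //; apply: nat_cost; lia.
split; first by do 3!apply: at_set_reg => //.
by rewrite /= r1 (at_reg h1) //= e1 e2.
Qed.

Lemma threshold_runs m v s (r K1 K2 : nat) b :
  let Dl := (2 * K1 * K2 * d.+1 * (r.+1 + 1))%N in
  let X := (4 * d.+1 * r.+1 * Dl)%N in
  (X <= 2 ^ b)%N -> (b + 5 <= c)%N -> (0 < K1)%N -> (0 < K2)%N ->
  (Num.floor (B / eps))%:~R + 1 = K1%:R :> rat ->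
  (Num.floor lam^-1)%:~R + 1 = K2%:R :> rat ->
  at_state env12 m v s -> reg s 19 = r%:R ->
  runs O threshold_cmd s (17 * c)
    (fun s' => [/\ at_state env12 m v s', reg s' 19 = r.+1%:R, reg s' 23 = X%:R,
                   reg s' 24 = 1 & reg s' 25 = 0]).
Proof.
move=> Dl X hX cb K10 K20 hK1 hK2 h0 r0.
have cn k : (k <= X)%N -> (rat_bits k%:R <= c)%N.
  move=> kX; have : fits b k%:R.
    by split; rewrite ?natr_int // ger0_norm // -natrX ler_nat (leq_trans kX).
  by move/fits_cost; apply; lia.
have k1 : (Num.floor (B / eps))%:~R = K1.-1%:R :> rat.
  by rewrite -subn1 natrB // -hK1 addrK.
have k2 : (Num.floor (1 / lam))%:~R = K2.-1%:R :> rat.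
  by rewrite -subn1 natrB // -hK2 addrK div1r.
have k1' : K1.-1%:R + 1 = K1%:R :> rat by rewrite natr1 prednK.
have k2' : K2.-1%:R + 1 = K2%:R :> rat by rewrite natr1 prednK.
have e0 : r%:R + 1 = r.+1%:R :> rat by rewrite natr1.
have e0' : r.+1%:R + 1 = (r.+1 + 1)%:R :> rat by rewrite [RHS]natrD.
have e1 : 2 * K1%:R = (2 * K1)%:R :> rat by rewrite natrM.
have e2 : (2 * K1)%:R * K2%:R = (2 * K1 * K2)%:R :> rat by rewrite [RHS]natrM.
have e3 : (2 * K1 * K2)%:R * d.+1%:R = (2 * K1 * K2 * d.+1)%:R :> rat by rewrite [RHS]natrM.
have e4 : (2 * K1 * K2 * d.+1)%:R * (r.+1 + 1)%:R = Dl%:R :> rat by rewrite [RHS]natrM.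
have e5 : 4 * d.+1%:R = (4 * d.+1)%:R :> rat by rewrite natrM.
have e6 : (4 * d.+1)%:R * r.+1%:R = (4 * d.+1 * r.+1)%:R :> rat by rewrite [RHS]natrM.
have e7 : (4 * d.+1 * r.+1)%:R * Dl%:R = X%:R :> rat by rewrite [RHS]natrM.
have D1 : (2 * K1 * K2 * d.+1 <= Dl)%N by rewrite leq_pmulr // addn1.
have D2 : (2 * K1 * K2 <= Dl)%N by apply: leq_trans D1; rewrite leq_pmulr.
have D3 : (2 * K1 <= Dl)%N by apply: leq_trans D2; rewrite leq_pmulr.
have D4 : (2 * K2 <= Dl)%N by apply: leq_trans D2; rewrite mulnAC leq_pmulr.
have D5 : (0 < Dl)%N by lia.
have X1 : (Dl <= X)%N by rewrite leq_pmull.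
have X2 : (4 * d.+1 * r.+1 <= X)%N by rewrite leq_pmulr.
have X3 : (4 * d.+1 <= X)%N by apply: leq_trans X2; rewrite leq_pmulr.
have X4 : (4 * r.+1 <= X)%N by apply: leq_trans X2; rewrite mulnAC leq_pmulr.
apply: runs_blk.
  rewrite /= r0 !(at_reg h0) //= e0 k1 k1' k2 k2' e1 e2 e3 e0' e4 e5 e6 e7.
  by do !split=> //; first [apply: cn; lia | apply: (@cn 1%N); lia | apply: (@cn 0%N); lia
    | apply: (@cn 2%N); lia | apply: (@cn 4%N); lia].
split=> //.
- by rewrite /= r0 (at_reg h0).
- by rewrite /= r0 !(at_reg h0) //= e0 k1 k1' k2 k2' e1 e2 e3 e0' e4 e5 e6 e7.
Qed.

Lemma log_runs m v s (r X b : nat) :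
  (0 < X)%N -> (X <= 2 ^ b)%N -> (b + 6 <= c)%N ->
  at_state env12 m v s -> reg s 19 = r%:R -> reg s 23 = X%:R -> reg s 24 = 1 -> reg s 25 = 0 ->
  runs O log_cmd s (b.+2 * (2 * c + 1))
    (fun s' => exists L : nat, [/\ at_state env12 m v s', reg s' 19 = r%:R, reg s' 25 = L%:R,
       (X < 2 ^ L)%N & (L <= b.+1)%N]).
Proof.
move=> X0 hX cb.
(* Here [j] counts the doublings that are still possible: at l = b + 1 the power 2^l certainly
   exceeds X. *)
suff loop j l s0 : (l + j = b.+1)%N -> at_state env12 m v s0 -> reg s0 19 = r%:R ->
    reg s0 23 = X%:R -> reg s0 24 = (2 ^ l)%:R -> reg s0 25 = l%:R ->
    runs O log_cmd s0 (j.+1 * (2 * c + 1))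
    (fun s' => exists L : nat, [/\ at_state env12 m v s', reg s' 19 = r%:R, reg s' 25 = L%:R,
       (X < 2 ^ L)%N & (L <= b.+1)%N]).
  by move=> h0 r0 r1 r2 r3; apply: (loop b.+1 0%N s).
elim: j l s0 => [|j IH] l s0 lj h0 r0 rX rt rl.
  exists 1%N, s0; split=> //; first last.
    exists l; split=> //; last by rewrite -lj addn0.
    by rewrite -[l]addn0 lj (leq_ltn_trans hX) // ltn_exp2l.
    by lia.
  apply: ExecWhileF; rewrite /= rX rt ler_nat -ltnNge -[l]addn0 lj.
  by rewrite (leq_ltn_trans hX) // ltn_exp2l.
case: (leqP (2 ^ l) X) => lX; last first.
  exists 1%N, s0; split=> //; first last.
    by exists l; split=> //; lia.
    by lia.
  by apply: ExecWhileF; rewrite /= rX rt ler_nat -ltnNge.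
have lb : (l <= b)%N by lia.
have e1 : (2 ^ l)%:R + (2 ^ l)%:R = (2 ^ l.+1)%:R :> rat by rewrite -natrD addnn -mul2n -expnS.
have e2 : l%:R + 1 = l.+1%:R :> rat by rewrite natr1.
have := @runs_blk _ _ O c [:: Arith OpAdd 24 24 24; Arith OpAdd 25 25 4] s0
  (fun s' => [/\ at_state env12 m v s', reg s' 19 = r%:R,
    reg s' 23 = X%:R, reg s' 24 = (2 ^ l.+1)%:R & reg s' 25 = l.+1%:R]).
case.
- rewrite /= rt rl (at_reg h0) //= e1 e2; do !split=> //.
    apply: (@fits_cost _ l.+1); last lia.
    by split; rewrite ?natr_int // ger0_norm // natrX.
  apply: (@fits_cost _ l.+1); last lia.
  exact: fits_nat.
- by split=> //; rewrite /= ?rt ?rl ?(at_reg h0) //= ?e1 ?e2.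
move=> n1 [s1 [ex1 n1c [h1 r1 X1 t1 l1]]].
have [|n2 [s2 [ex2 n2c q2]]] := IH l.+1 s1 _ h1 r1 X1 t1 l1; first by rewrite addSnnS.
exists (n1 + n2).+1, s2; split=> //.
  by apply: ExecWhileT ex1 ex2; rewrite /= rX rt ler_nat.
move: n1c n2c => /=; nia.
Qed.
End Initialization.

(** The memory is still zero, so the query made through register 17 is the origin, which lies in X
    and becomes the first best point. Registers 17 and 18 then serve temporarily for the two
    possible coordinates -r and 2 d r - r of the initial vertices. Equality of indices is tested by
    two comparisons. *)
Definition init_vertices_cmd : cmd :=
  Seq (blk [:: Const 17 0; AskVal 0 17; Arith OpSub 17 17 19; Arith OpMul 18 0 19;
               Arith OpAdd 18 18 18; Arith OpAdd 18 18 17])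
      (Fill 19 7 11
        (Seq (blk [:: Arith OpQuo 20 19 0; Arith OpMul 21 20 0; Arith OpSub 21 19 21;
                      Arith OpAdd 21 21 4; Move 22 17])
             (If (Le 20 21) (If (Le 21 20) (blk [:: Move 22 18]) Skip) Skip)) 22).

Ltac conjuncts := repeat match goal with
  | |- _ /\ _ => split
  | |- True => exact I
  end.

Section Initialization2.
Context (R : realType) (d : nat) (O : oracles R d).
Variables (lam eps B : rat) (c : nat).
Implicit Types (m : nat -> rat) (v : nat -> R) (s : state R).
Notation env12 := (env12 d lam eps B).

Definition steps (L : nat) : nat := (16 * d.+1 ^ 3 * L)%N.

Definition params (L : nat) : seq rat :=
  env d (steps L) (32 * d.+1 ^ 3) (8 * d.+1 ^ 2) (8 ^ (L + steps L)) lam eps B.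

Lemma parameters_runs m v s (r L : nat) :
  (0 < L)%N -> (32 * d.+1 ^ 3 + steps L + L + 20 <= c)%N ->
  at_state env12 m v s -> reg s 19 = r%:R -> reg s 25 = L%:R ->
  runs O parameters_cmd s (13 * c)
    (fun s' => at_state env12 m v s' /\
       [/\ reg s' 19 = r%:R, reg s' 25 = (L + steps L)%:R - 1 & reg s' 26 = 8] /\
       [/\ reg s' 12 = (32 * d.+1 ^ 3)%:R, reg s' 13 = (8 * d.+1 ^ 2)%:R,
           reg s' 14 = 1 & reg s' 16 = (steps L)%:R - 1]).
Proof.
move=> L0 cL h0 r0 rL.
have N0 : (0 < steps L)%N by rewrite /steps muln_gt0 L0 muln_gt0 expn_gt0.
have e1 : d.+1%:R * d.+1%:R = (d.+1 ^ 2)%:R :> rat by rewrite -natrM.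
have e2 : (d.+1 ^ 2)%:R * d.+1%:R = (d.+1 ^ 3)%:R :> rat by rewrite -natrM -expnSr.
have e3 : 16 * (d.+1 ^ 3)%:R = (16 * d.+1 ^ 3)%:R :> rat by rewrite natrM.
have e4 : (16 * d.+1 ^ 3)%:R * L%:R = (steps L)%:R :> rat by rewrite -natrM.
have e5 : L%:R + (steps L)%:R = (L + steps L)%:R :> rat by rewrite [RHS]natrD.
have e6 : 32 * (d.+1 ^ 3)%:R = (32 * d.+1 ^ 3)%:R :> rat by rewrite natrM.
have e7 : 8 * (d.+1 ^ 2)%:R = (8 * d.+1 ^ 2)%:R :> rat by rewrite natrM.
have p1 : (steps L)%:R - 1 = (steps L).-1%:R :> rat.
  by rewrite -[in LHS](prednK N0) -natr1 addrK.
have p2 : (L + steps L)%:R - 1 = (L + steps L).-1%:R :> rat.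
  have h : (0 < L + steps L)%N by rewrite addn_gt0 L0.
  by rewrite -[in LHS](prednK h) -natr1 addrK.
have q1 : (d.+1 ^ 2 <= d.+1 ^ 3)%N by rewrite leq_pexp2l.
apply: runs_blk.
  rewrite /= rL !(at_reg h0); [rewrite /= e1 e2 e3 e4 e5 p1 p2 e6 e7|by []..].
  by conjuncts; first [apply: nat_cost; lia | apply: (@nat_cost _ 16); lia
    | apply: (@nat_cost _ 32); lia | apply: (@nat_cost _ 8); lia | apply: (@nat_cost _ 1); lia].
split; first by rewrite /run [foldl _ _ _]/=; do 13!apply: at_set_reg => //.
split; split.
- exact: r0.
- by rewrite /= rL !(at_reg h0); [rewrite /= e1 e2 e3 e4 e5|by []..].
- by [].
- by rewrite /= !(at_reg h0); [rewrite /= e1 e2 e6|by []..].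
- by rewrite /= !(at_reg h0); [rewrite /= e1 e7|by []..].
- by [].
- by rewrite /= rL !(at_reg h0); [rewrite /= e1 e2 e3 e4|by []..].
Qed.

Lemma precision_runs m v s (r L : nat) :
  let k := (L + steps L)%N in
  (0 < L)%N -> (3 * k + 10 <= c)%N -> at_state env12 m v s ->
  [/\ reg s 19 = r%:R, reg s 25 = k%:R - 1 & reg s 26 = 8] ->
  [/\ reg s 12 = (32 * d.+1 ^ 3)%:R, reg s 13 = (8 * d.+1 ^ 2)%:R,
      reg s 14 = 1 & reg s 16 = (steps L)%:R - 1] ->
  runs O precision_cmd s (for_time k c + c)
    (fun s' => at_state (params L) m v s' /\ reg s' 19 = r%:R).
Proof.
move=> k L0 ck h0 hr hq.
have fP j : fits (3 * j) (8 ^ j)%:R.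
  split; first exact: natr_int.
  by rewrite ger0_norm // exprM -!natrX.
pose I j s' := at_state env12 m v s' /\
  [/\ reg s' 19 = r%:R, reg s' 25 = k%:R - 1 & reg s' 26 = 8] /\
  [/\ reg s' 12 = (32 * d.+1 ^ 3)%:R, reg s' 13 = (8 * d.+1 ^ 2)%:R,
      reg s' 14 = (8 ^ j)%:R & reg s' 16 = (steps L)%:R - 1].
apply: (runs_seq (Q1 := I k)).
  apply: (runs_for (I := I)) => //.
  - by rewrite addn_gt0 L0.
  - by move=> j s1 [h [[_ -> _] _]]; rewrite (at_reg h).
  - move=> j s1 jk [h [[a1 a2 a3] [b1 b2 b3 b4]]] hj.
    have e : (8 ^ j)%:R * 8 = (8 ^ j.+1)%:R :> rat by rewrite -natrM -expnSr.
    rewrite -[c]mul1n; apply: runs_blk.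
      by rewrite /= b3 a3 e; split=> //; apply: (fits_cost (fP _)); lia.
    split; last by rewrite /= hj.
    split; first by rewrite /run [foldl _ _ _]/=; apply: at_set_reg.
    by split; split=> //=; rewrite b3 a3 e.
move=> s1 [h [[a1 a2 a3] [b1 b2 b3 b4]]].
rewrite -[c in runs _ _ _ c]mul1n; apply: runs_blk.
  rewrite /= b3 (at_reg h) //; split=> //.
  by apply: leq_trans (rat_bits_div (fits_nat 1) (fP k)) _; lia.
split; last by rewrite /= a1.
rewrite /run [foldl _ _ _]/=.
apply/(@at_rcons _ (env12 ++ [:: _; _; _; _])); split; last by rewrite /= b4.
apply/(@at_rcons _ (env12 ++ [:: _; _; _])); split; last by rewrite /= b3 (at_reg h) //= div1r.
apply/(@at_rcons _ (env12 ++ [:: _; _])); split; last by rewrite /= b3.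
apply/(@at_rcons _ (env12 ++ [:: _])); split; last by rewrite /= b2.
apply/(@at_rcons _ env12); split; last by rewrite /= b1.
exact: at_set_reg.
Qed.

Lemma init_vertices_runs v s L (r : nat) :
  (0 < d)%N -> (d.+1 * d + 10 * d + 3 * d * r + r + 20 <= c)%N ->
  at_state (params L) (fun=> 0) v s -> reg s 19 = r%:R ->
  runs O init_vertices_cmd s (6 * c + fill_time (d.+1 * d) (6 * d) (5 * c + (1 * c).+2))
    (at_state (params L ++ [:: - r%:R; 2 * d%:R * r%:R - r%:R])
      (upd_range (fun=> 0) (6 * d) (d.+1 * d)
        (fun x => - r%:R + (2 * d%:R * r%:R) *+ (x %/ d == x %% d + 1)%N))
      [eta v with 0%N |-> o_val O 0]).
Proof.
move=> d0 cd h0 r0.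
have e1 : d%:R * r%:R = (d * r)%:R :> rat by rewrite natrM.
have e2 : (d * r)%:R + (d * r)%:R = (2 * d * r)%:R :> rat.
  by rewrite -natrD; congr (_%:R); lia.
have e2' : 2 * d%:R * r%:R = (2 * d * r)%:R :> rat by rewrite !natrM.
set v1 : nat -> R := [eta v with 0%N |-> o_val O 0].
have a0 s' : mem s' = (fun=> 0) -> reg s' 17 = 0 -> arg d s' 17 = 0.
  by move=> hm h; apply/rowP => j; rewrite !mxE hm.
set E := params L ++ _.
pose g x : rat := - r%:R + (2 * d%:R * r%:R) *+ (x %/ d == x %% d + 1)%N.
rewrite -/g.
apply: (runs_seq (Q1 := at_state E (fun=> 0) v1)).
  have [rr hm hv] := h0.
  apply: runs_blk.
    rewrite /= r0 !(at_reg h0) //= sub0r e1 e2 a0 //.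
    do !split=> //; first [lia | apply: nat_cost; lia | idtac].
    - by rewrite (_ : rat_bits 0 = 3%N) //; lia.
    - rewrite /vec_bits; under eq_bigr do rewrite mxE (_ : rat_bits 0 = 3%N) //.
      by rewrite sum_nat_const card_ord; lia.
    - by apply: (fits_cost (fitsN (fits_nat r))); lia.
    - by apply: (fits_cost (fitsD (fits_nat _) (fitsN (fits_nat r)))); lia.
  rewrite /run [foldl _ _ _]/= a0 //.
  apply/(@at_rcons _ (params L ++ [:: - r%:R])); split; last first.
    by rewrite /= r0 !(at_reg h0) //= sub0r e1 e2 e2'.
  apply/(@at_rcons _ (params L)); split; last by rewrite /= r0 sub0r.
  do 4!apply: at_set_reg => //.
  by split=> //=; rewrite /v1 hv.
move=> s1 h1.
apply: (@runs_fill _ _ _ E) => //=.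
  by rewrite muln_gt0.
move=> x s2 xl h2; have [_ hm hv] := h2.
have dx := divn_eq x d; have xm := ltn_pmod x d0.
have xd : (x %/ d < d.+1)%N by rewrite ltn_divLR.
have e3 : x%:R - (x %/ d)%:R * d%:R = (x %% d)%:R :> rat.
  by rewrite -natrM {1}dx natrD addrAC subrr add0r.
have e4 : (x %% d)%:R + 1 = (x %% d + 1)%:R :> rat by rewrite [RHS]natrD.
apply: (runs_seq (Q1 := fun s' => [/\ at_state (rcons E x%:R) (upd_range (fun=> 0) (6 * d) x g) v1 s',
   reg s' 20 = (x %/ d)%:R, reg s' 21 = (x %% d + 1)%:R & reg s' 22 = - r%:R])).
  apply: runs_blk.
    rewrite /= !(at_reg h2) //= floor_divn e3 e4 -natrM.
    by do !split=> //; first [lia | apply: nat_cost; lia].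
  split.
  - by rewrite /run [foldl _ _ _]/=; do 5!apply: at_set_reg => //.
  - by rewrite /= !(at_reg h2) //= floor_divn.
  - by rewrite /= !(at_reg h2) //= floor_divn e3 e4.
  - by rewrite /= !(at_reg h2).
move=> s3 [h3 r20 r21 r22].
apply: runs_if; rewrite /= r20 r21 ler_nat /g.
case: leqP => h; last first.
  apply: (runs_weaken (t := 0) (Q := fun s' => at_state (rcons E x%:R)
      (upd_range (fun=> 0) (6 * d) x g) v1 s' /\ reg s' 22 = - r%:R)) => //.
    exact: runs_skip.
  by move=> s4 [h4 r4]; rewrite gtn_eqF // mulr0n addr0.
apply: runs_if; rewrite /= r20 r21 ler_nat.
case: leqP => h'; last first.
  apply: (runs_weaken (t := 0) (Q := fun s' => at_state (rcons E x%:R)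
      (upd_range (fun=> 0) (6 * d) x g) v1 s' /\ reg s' 22 = - r%:R)) => //.
    exact: runs_skip.
  by move=> s4 [h4 r4]; rewrite ltn_eqF // mulr0n addr0.
have -> : (x %/ d == x %% d + 1)%N by rewrite eqn_leq h h'.
apply: runs_blk; first by split=> //=; lia.
by split; [apply: at_set_reg | rewrite /= (at_reg h3) //= mulr1n addrC].
Qed.
End Initialization2.

(** * Correctness *)

Lemma floor_dist (x : rat) : `|(Num.floor x)%:~R - x| <= 1.
Proof.
have /andP[h1 h2] := floor_itv x.
rewrite ler_norml; move: h2; rewrite intrD => h2; apply/andP; split; lra.
Qed.

Lemma multiplier_itv d Q M (tau al x : rat) :
  Q%:R * (M%:R * al / (M%:R * al + (d.+1%:R * x - tau))) <= multiplier d Q M tau al x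
  <= Q%:R * (M%:R * al / (M%:R * al + (d.+1%:R * x - tau))) + 1.
Proof.
rewrite /multiplier -[X in Num.floor X]mulrA; set y := Q%:R * _; have /andP[h1 h2] := floor_itv y.
by move: h2; rewrite intrD lerD2r h1 andbT => /ltW.
Qed.

(** The quotient M al / (M al + a) is at most 2, because a >= -al and M >= 2; rounding adds at most
    1 <= Q. The case al = 0 is included: after an eps-good query the cut may fail to separate
    anything, yet the numbers must stay bounded. *)
Lemma multiplier_bound d Q M (tau al x : rat) : (0 < Q)%N -> (2 <= M)%N -> 0 <= al ->
  - al <= d.+1%:R * x - tau -> `|multiplier d Q M tau al x| <= 3 * Q%:R.
Proof.
move=> Q0 M2 al0 hx; have := multiplier_itv d Q M tau al x.
rewrite /multiplier /=; set a := d.+1%:R * x - tau in hx *; set F : rat := (Num.floor _)%:~R.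
set z := M%:R * al / _ => /andP[_ hi].
have M2' : 2 <= M%:R :> rat by rewrite ler_nat.
have Q1 : 1 <= Q%:R :> rat by rewrite ler1n.
have z0 : 0 <= z <= 2.
  rewrite /z; have [->|aln0] := eqVneq al 0; first by rewrite mulr0 mul0r lexx /=.
  have alp : 0 < al by rewrite lt_def aln0.
  have den : 0 < M%:R * al + a by nra.
  apply/andP; split; last by rewrite ler_pdivrMr //; nra.
  by apply: divr_ge0; [rewrite mulr_ge0 | exact: ltW].
have F0 : 0 <= F.
  rewrite /F ler0z floor_ge0 divr_ge0 ?mulr_ge0 //.
  by nra.
case/andP: z0 => z0 z2; rewrite ger0_norm ?addr_ge0 //; nra.
Qed.

Lemma leq_vertex_addr d x : (3 * d <= 6 * d + x)%N.
Proof. lia. Qed.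

Lemma vertex_upd d m g i j : vertex d (upd_range m (2 * d) d g) i j = vertex d m i j.
Proof. by rewrite /vertex upd_range_out //; apply/orP; right; lia. Qed.

Lemma read_vec_upd_query d m g : read_vec d (upd_range m (2 * d) d g) 0 = read_vec d m 0.
Proof. by rewrite read_vec_out //; apply/orP; left; lia. Qed.

(** * The invariant of the main loop *)

Section Progress.
Context (R : realType) (d : nat) (X : set 'rV[R]_d) (f : 'rV[R]_d -> R) (O : oracles R d).
Variables (lam eps B : rat) (xmin : 'rV[R]_d) (r K1 K2 L : nat).

Let n : R := d.+1%:R.
Let rr : R := r%:R.
Let N := steps d L.
Let Q := (32 * d.+1 ^ 3)%N.
Let M := (8 * d.+1 ^ 2)%N.
Let P := (8 ^ (L + N))%N.
(** Chosen for [quasar_cut], which needs dl d B (r+1) <= lam eps / 2: the factors K1 and K2 stand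
    for B/eps and 1/lam. *)
Let Dl := (2 * K1 * K2 * d.+1 * r.+1)%N.
Let dl : R := Dl%:R^-1.

Hypotheses (d0 : (0 < d)%N) (r0 : (0 < r)%N) (K10 : (0 < K1)%N) (K20 : (0 < K2)%N).
Hypotheses (hK1 : B / eps <= K1%:R) (hK2 : lam^-1 <= K2%:R).
Hypotheses (cX : convex_set X) (bX : eball 1 `<=` X) (Xr : X `<=` eball rr).
Hypotheses (lam01 : 0 < lam <= 1) (eps0 : 0 < eps) (B0 : 0 < B).
Hypothesis hL : (4 * d.+1 * r * Dl < 2 ^ L)%N.
Hypothesis sepO : separation_oracle X (o_sep O).
Hypothesis qcf : quasar_convex X f (ratr lam) xmin.
Hypothesis gradO : forall q, X (ratv R q) -> ratv R (o_grad O q) = grad f (ratv R q).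
Hypothesis gradB : forall x, X x -> enorm (grad f x) <= ratr B.
Hypothesis valO : value_oracle X f (o_val O).

Definition vertices (m : nat -> rat) : 'M[R]_(d.+1, d) := \matrix_(i, j) ratr (vertex d m i j).

Let Y : 'M[R]_(d.+1, d) := tracked xmin dl.
Let rho : R := dl / 2 / (2 * d%:R * rr).

(** A new coordinate is at most Q times an old one plus 3 Q times a difference of two old ones, so 7
    Q times the previous bound; 8 is the next power of two. After division by the common denominator
    Q^k, the bound is 2 d r 8^k. *)
Definition radius (k : nat) : rat := (2 * d * r)%:R * (8 * Q)%:R ^+ k.

(** The bounds on the vertices and the membership of the best point hold unconditionally. The
    coordinates of the tracked points are only claimed while the best value is not yet eps-good;
    [rho ^+ d] is their initial determinant. *)
Definition invariant (k : nat) (m : nat -> rat) (v : nat -> R) : Prop :=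
  [/\ forall i j, (i < d.+1)%N -> (j < d)%N ->
        vertex d m i j \is a Num.int /\ `|vertex d m i j| <= radius k,
      X (ratv R (read_vec d m 0)), v 0%N = f (ratv R (read_vec d m 0))
    & v 0%N <= f xmin + ratr eps \/
      exists2 Pm, barycentric (vertices m) (Q ^ k)%:R Y Pm &
        rho ^+ d * (1 + (16 * n ^+ 2)^-1) ^+ k <= `|\det Pm| ].

Let Dl0 : (0 < Dl)%N. Proof. by rewrite /Dl !muln_gt0 K10 K20. Qed.
Let Xx : X xmin. Proof. by case: qcf => -[]. Qed.

Let dl01 : 0 <= dl <= 1.
Proof. by rewrite /dl invr_ge0 ler0n invf_le1 ?ltr0n // ler1n. Qed.

Let dl_gt0 : 0 < dl. Proof. by rewrite invr_gt0 ltr0n. Qed.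

Let Q0 : (0 < Q)%N. Proof. by rewrite /Q muln_gt0 expn_gt0. Qed.

Let Y_bound i j : `|Y i j| <= rr.
Proof.
have := enorm_coord j (Xr (tracked_in cX bX Xx dl01 i)).
by rewrite mxE.
Qed.

Let rho_gt0 : 0 < rho.
Proof. by rewrite /rho !divr_gt0 // !mulr_gt0 ?ltr0n. Qed.

Let rhoL : 1 < rho * 2 ^+ L.
Proof.
rewrite /rho /dl -!invfM mulrC ltr_pdivlMr ?mul1r; last by rewrite !mulr_gt0 ?ltr0n.
rewrite -natrX; apply: le_lt_trans (_ : (4 * d.+1 * r * Dl)%:R < _); last by rewrite ltr_nat.
have -> : (4 * d.+1 * r * Dl)%:R = 4 * (d%:R + 1) * rr * Dl%:R :> R.
  by rewrite (natrM _ (4 * d.+1 * r)) (natrM _ (4 * d.+1)) (natrM _ 4) -[d.+1%:R]natr1.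
have : 0 <= rr * Dl%:R by rewrite mulr_ge0.
move: (d%:R : R) (Dl%:R : R) => x y; lra.
Qed.

(* 8 ^ N bounds the growth of the simplex, whose vertices may leave X. *)
Let P_large : (6 * d ^ 2 * r * Dl * 8 ^ N <= P)%N.
Proof.
rewrite /P expnD leq_mul2r; apply/orP; right.
apply: leq_trans (_ : (2 ^ L) ^ 2 <= _)%N; last first.
  by rewrite -expnM -[8%N]/(2 ^ 3)%N -expnM leq_exp2l // mulnC leq_mul2r orbT.
apply: leq_trans (_ : (4 * d.+1 * r * Dl) ^ 2 <= _)%N; last by rewrite leq_exp2r // ltnW.
have h1 : (r * Dl <= (r * Dl) ^ 2)%N.
  by rewrite -{1}[(r * Dl)%N]expn1 leq_pexp2l // muln_gt0 r0.
have h2 : (d ^ 2 <= d.+1 ^ 2)%N by rewrite leq_exp2r.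
have -> : (6 * d ^ 2 * r * Dl = 6 * (d ^ 2 * (r * Dl)))%N by rewrite -!mulnA.
have -> : ((4 * d.+1 * r * Dl) ^ 2 = 16 * (d.+1 ^ 2 * (r * Dl) ^ 2))%N.
  have -> : (4 * d.+1 * r * Dl = 4 * (d.+1 * (r * Dl)))%N by rewrite !mulnA.
  by rewrite [LHS]expnMn [((d.+1 * _) ^ _)%N]expnMn.
by rewrite leq_mul // leq_mul.
Qed.

(** The contradiction after N rounds: the determinant would exceed 1, which the coordinates of
    convex combinations do not allow. *)
Lemma progress_end v : rho ^+ d * (1 + (16 * n ^+ 2)^-1) ^+ N <= `|\det v| ->
  forall V S, ~ barycentric V S Y v.
Proof.
move=> hv V S [v0 v1 _]; have := norm_det_stochastic v0 v1.
have := stretch_growth d0 rho_gt0 rhoL; rewrite -/n -/N.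
by move=> h1 h2; have := lt_le_trans h1 (le_trans hv h2); rewrite ltxx.
Qed.

Lemma invariant_init m v :
  (forall i j, (i < d.+1)%N -> (j < d)%N ->
     vertex d m i j = - r%:R + (2 * d%:R * r%:R) *+ (i == j.+1)) ->
  read_vec d m 0 = 0 -> v 0%N = f 0 -> invariant 0 m v.
Proof.
move=> hm h0 hv.
have X0 : X 0 by apply: bX; rewrite /eball /= /enorm /dot big1 ?sqrtr0 // => i _; rewrite mxE mulr0.
have z0 : ratv R (0 : 'rV[rat]_d) = 0 by apply/rowP => j; rewrite !mxE rmorph0.
have d1 : 1 <= d%:R :> rat by rewrite ler1n.
have r1 : 1 <= r%:R :> rat by rewrite ler1n.
split; rewrite ?h0 ?z0 //.
  move=> i j il jd; rewrite hm //; split.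
    by rewrite rpredD ?rpredN ?rpredMn ?rpredM ?natr_int.
  rewrite /radius expr0 mulr1 !natrM; case: (i == _); rewrite ?mulr1n ?mulr0n ?addr0.
    by rewrite ger0_norm; nra.
  by rewrite normrN normr_nat; nra.
right.
have [||Pm [bP dP]] := @init_barycentric R d rr (dl / 2) (fun j => (1 - dl) * xmin 0 j) Y d0 _ Y_bound.
- by rewrite ltr0n.
- by move=> i j; rewrite mxE.
exists Pm; last by rewrite dP expr0 mulr1 ger0_norm // exprn_ge0 // ltW.
rewrite expn0; congr (barycentric _ _ _ _): bP; apply/matrixP => i j; rewrite !mxE hm //.
rewrite rmorphD rmorphN /= ratr_nat; congr (_ + _).
by rewrite rmorphMn /= !rmorphM /= !ratr_nat.
Qed.
Let SQ k : 0 < (Q ^ k)%:R :> R.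
Proof. by rewrite ltr0n expn_gt0 Q0. Qed.

Lemma radius_ge0 k : 0 <= radius k.
Proof. by rewrite /radius mulr_ge0 // exprn_ge0. Qed.

(** Carries [barycentric_step] over from the real field to the rational data of the program; all
    identities pass through the embedding of the rationals. *)
Lemma updated_bary k m m2 m3 Pm :
  (forall i j, (i < d.+1)%N -> (j < d)%N -> vertex d m2 i j = vertex d m i j) ->
  updated d Q M m2 m3 ->
  barycentric (vertices m) (Q ^ k)%:R Y Pm ->
  (forall i, \sum_(l < d) ratr (m2 (d + l)%N) * Y i l <
             \sum_(l < d) ratr (m2 (d + l)%N) * ratr (centroid d m (Q ^ k)%:R l)) ->
  exists2 Pm', barycentric (vertices m3) (Q ^ k.+1)%:R Y Pm' &
    `|\det Pm| * (1 + (16 * n ^+ 2)^-1) <= `|\det Pm'|.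
Proof.
move=> v2 [k0 k0n [kmin upd]] bP cut.
pose ko := Ordinal k0n.
pose c (l : 'I_d) : R := ratr (m2 (d + l)%N).
pose e i := \sum_(j < d) m2 (d + j)%N * vertex d m2 i j.
pose tau := \sum_(i < d.+1) e i.
have eE (i : 'I_d.+1) : \sum_j c j * vertices m i j = ratr (e i).
  rewrite /e rmorph_sum; apply: eq_bigr => j _.
  by rewrite mxE rmorphM /= v2.
have tauE : \sum_i \sum_j c j * vertices m i j = ratr tau.
  by rewrite /tau rmorph_sum; apply: eq_bigr => i _; rewrite eE.
pose U (i : 'I_d.+1) : R := ratr (multiplier d Q M tau (tau - d.+1%:R * e k0) (e i)).
have nS : n * (Q ^ k)%:R != 0 by rewrite mulf_neq0 ?gt_eqF // ltr0n.
have [|||Pm' [bP' dP']] := @barycentric_step R d (vertices m) Y (Q ^ k)%:R Pm c ko U d0 bP.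
- by move=> i; rewrite !eE ler_rat; apply: kmin.
(* The cut at the centroid, multiplied by n Q^k, is the division-free form that the cutting step
   uses. *)
- move=> i; rewrite tauE mulrA mulrC -ltr_pdivlMr; last by rewrite mulr_gt0 ?ltr0n ?expn_gt0 ?Q0.
  apply: lt_le_trans (cut i) _; rewrite le_eqVlt; apply/orP; left; apply/eqP.
  rewrite -tauE exchange_big /= mulr_suml; apply: eq_bigr => l _.
  rewrite fmorph_div rmorphM /= !ratr_nat -/n mulrA; congr (_ / _).
  rewrite rmorph_sum mulr_sumr; apply: eq_bigr => i' _.
  by rewrite mxE.
- move=> i _; rewrite !eE tauE /U.
  have rB x y : ratr x - d.+1%:R * ratr y = ratr (x - d.+1%:R * y) :> R.
    by rewrite rmorphB rmorphM /= ratr_nat.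
  have rB' x y : d.+1%:R * ratr x - ratr y = ratr (d.+1%:R * x - y) :> R.
    by rewrite rmorphB rmorphM /= ratr_nat.
  have rE x y : 32 * d.+1%:R ^+ 3 * (8 * d.+1%:R ^+ 2 * ratr x / (8 * d.+1%:R ^+ 2 * ratr x + ratr y)) =
      ratr (Q%:R * (M%:R * x / (M%:R * x + y))) :> R.
    rewrite [RHS]rmorphM /= [X in _ = _ * X]fmorph_div rmorphD rmorphM /= !ratr_nat.
    by rewrite /Q /M (natrM _ 32) (natrM _ 8) !natrX.
  have r1 u : ratr u + 1 = ratr (u + 1) :> R by rewrite rmorphD rmorph1.
  rewrite rB rB' rE r1 !ler_rat.
  exact: multiplier_itv.
exists Pm' => //; congr (barycentric _ _ _ _): bP'.
  apply/matrixP => i j; rewrite !mxE upd // -/(e i) -/tau rmorphD !rmorphM /= rmorphB /= ratr_nat /U.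
  by rewrite /Q (natrM _ 32) natrX !v2.
by rewrite [(Q ^ k.+1)%N]expnS [RHS]natrM; congr (_ * _); rewrite /Q (natrM _ 32) natrX.
Qed.

Lemma updated_radius k m m2 m3 :
  (forall i j, (i < d.+1)%N -> (j < d)%N -> vertex d m2 i j = vertex d m i j) ->
  (forall j, (j < d)%N -> m2 (d + j)%N \is a Num.int) ->
  updated d Q M m2 m3 ->
  (forall i j, (i < d.+1)%N -> (j < d)%N ->
     vertex d m i j \is a Num.int /\ `|vertex d m i j| <= radius k) ->
  forall i j, (i < d.+1)%N -> (j < d)%N ->
     vertex d m3 i j \is a Num.int /\ `|vertex d m3 i j| <= radius k.+1.
Proof.
move=> v2 ci [k0 k0n [kmin upd]] hV i j il jd.
pose e i := \sum_(j < d) m2 (d + j)%N * vertex d m2 i j.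
pose tau := \sum_(i < d.+1) e i.
pose al := tau - d.+1%:R * e k0.
have tau_ge : d.+1%:R * e k0 <= tau.
  rewrite mulr_natl -[X in _ *+ X]card_ord -sumr_const.
  by apply: ler_sum => l _; apply: kmin.
have U_bound : `|multiplier d Q M tau al (e i)| <= 3 * Q%:R.
  apply: multiplier_bound => //; first by rewrite (leq_trans _ (leq_pmulr _ _)) // expn_gt0.
    by rewrite subr_ge0.
  by rewrite opprB lerD2r ler_wpM2l //; exact: kmin.
rewrite upd // -/(e i) -/tau -/al !v2 //.
have [i1 b1] := hV k0 j k0n jd; have [i2 b2] := hV i j il jd.
split.
  by rewrite rpredD ?rpredM ?rpredB ?natr_int // rpredD ?intr_int.
have R0 := radius_ge0 k.
have -> : radius k.+1 = (8 * Q%:R) * radius k by rewrite /radius exprS -(natrM _ 8 Q) mulrCA.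
apply: le_trans (ler_normD _ _) _; rewrite !normrM.
have h1 : `|vertex d m i j - vertex d m k0 j| <= 2 * radius k.
  by apply: le_trans (ler_normB _ _) _; lra.
have h2 : `|multiplier d Q M tau al (e i)| * `|vertex d m i j - vertex d m k0 j| <=
    3 * Q%:R * (2 * radius k) by rewrite ler_pM.
have h3 : `|Q%:R| * `|vertex d m k0 j| <= Q%:R * radius k.
  by rewrite normr_nat ler_wpM2l.
have h4 : 0 <= Q%:R * radius k by rewrite mulr_ge0.
lra.
Qed.

Lemma centroid_bound k m j : (j < d)%N ->
  (forall i j, (i < d.+1)%N -> (j < d)%N ->
     vertex d m i j \is a Num.int /\ `|vertex d m i j| <= radius k) ->
  `|centroid d m (Q ^ k)%:R j| <= (2 * d * r * 8 ^ k)%:R.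
Proof.
move=> jd hV; have S0 : 0 < d.+1%:R * (Q ^ k)%:R :> rat.
  by rewrite mulr_gt0 ?ltr0n // expn_gt0 Q0.
rewrite /centroid normrM normfV (ger0_norm (ltW S0)) ler_pdivrMr //.
apply: le_trans (ler_norm_sum _ _ _) _.
apply: le_trans (_ : \sum_(i < d.+1) radius k <= _).
  by apply: ler_sum => i _; case: (hV i j).
rewrite sumr_const card_ord -[leLHS]mulr_natl [leRHS]mulrCA ler_wpM2l //.
by rewrite /radius -!natrX -!natrM ler_nat expnMn mulnA.
Qed.

(** Both kinds of answer are cuts with a margin, and [rounded_cut] applies to each: with scale P and
    margin dl/2 for a separating vector, with scale P/eps and margin lam eps / 2 for a gradient. A
    gradient cut is claimed only if the query is not eps-good; otherwise the stored value has become
    good. *)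
Lemma oracle_cut k m v m1 m2 v2 i :
  let q := read_vec d m1 (2 * d) in
  (k <= N)%N -> (forall j : 'I_d, q 0 j = centroid d m (Q ^ k)%:R j) ->
  (forall i j, (i < d.+1)%N -> (j < d)%N ->
     vertex d m i j \is a Num.int /\ `|vertex d m i j| <= radius k) ->
  asked O P eps m1 v m2 v2 ->
  v2 0%N <= f xmin + ratr eps \/
  \sum_(l < d) ratr (m2 (d + l)%N) * Y i l <
  \sum_(l < d) ratr (m2 (d + l)%N) * ratr (centroid d m (Q ^ k)%:R l).
Proof.
move=> q kN hq hV.
have dist l : `|Y i l - ratr (q 0 l)| <= 3 * d%:R * rr * 8 ^+ N.
  apply: le_trans (ler_normB _ _) _.
  have h1 : `|ratr (q 0 l) : R| <= (2 * d * r * 8 ^ k)%:R.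
    by rewrite hq -ratr_norm -[leRHS]ratr_nat ler_rat centroid_bound.
  have h2 : (2 * d * r * 8 ^ k)%:R <= 2 * d%:R * rr * 8 ^+ N :> R.
    by rewrite -natrX -!natrM ler_nat leq_mul2l leq_exp2l // kN orbT.
  have h3 : rr <= d%:R * rr * 8 ^+ N.
    by rewrite -natrX -!natrM ler_nat -mulnA mulnCA leq_pmulr // muln_gt0 d0 expn_gt0.
  have := Y_bound i l; lra.
(* The tracked points are bounded by r and the query by 2 d r 8^N, whence the distance 3 d r 8^N.
   [P_large] is this inequality cleared of denominators. *)
have prec : d%:R * (3 * d%:R * rr * 8 ^+ N) <= P%:R * (dl / 2).
  rewrite /dl -invfM -ler_pdivrMr ?invr_gt0 ?mulr_gt0 ?ltr0n // invrK.
  apply: le_trans (_ : (6 * d ^ 2 * r * Dl * 8 ^ N)%:R <= _); last by rewrite ler_nat.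
  rewrite -natrX -!natrM ler_nat leq_eqVlt; apply/orP; left; apply/eqP.
  by rewrite -mulnn; ring.
have sumE (c : 'I_d -> R) : \sum_l c l * (ratv R q) 0 l = \sum_l c l * ratr (centroid d m (Q ^ k)%:R l).
  by apply: eq_bigr => l _; rewrite mxE hq.
have P0 : 0 < P%:R :> R by rewrite ltr0n expn_gt0.
case=> [[c' [eqs hc _ _]] | [eqs hc hv]].
  right; rewrite -sumE.
  have := sepO q; rewrite eqs => -[c1 csep].
  apply: (@rounded_cut R d (fun l => ratv R c' 0 l) (fun l => ratr (m2 (d + l)%N)) (fun l => Y i l)
    (fun l => ratv R q 0 l) P%:R (dl / 2) (3 * d%:R * rr * 8 ^+ N)) => //.
  - move=> l; rewrite hc mxE.
    have -> : P%:R * ratr (c' 0 l) = ratr (c' 0 l / P%:R^-1) :> R.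
      by rewrite invrK rmorphM /= ratr_nat mulrC.
    by rewrite -rmorphB /= -ratr_norm -(@rmorph1 _ _ (@ratr R)) ler_rat floor_dist.
  - by move=> l; rewrite [ratv R q 0 l]mxE.
  exact: (separation_cut i cX bX Xx dl01 c1 csep).
have := sepO q; rewrite eqs => Xq.
case: (lerP (f (ratv R q)) (f xmin + ratr eps)) => fq.
  left; case: ifP hv => [_ [-> _]|/negbT]; first by rewrite (valO Xq).
  by rewrite -ltNge => /ltW h [-> _]; apply: le_trans fq; rewrite -(valO Xq).
right; rewrite -sumE.
have /andP[lam0 lam1] := lam01.
have reps : 0 < ratr eps :> R by rewrite ltr0q.
have rlam : 0 < ratr lam :> R by rewrite ltr0q.
have g0 := gradO Xq.
apply: (@rounded_cut R d (fun l => grad f (ratv R q) 0 l) (fun l => ratr (m2 (d + l)%N))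
   (fun l => Y i l) (fun l => ratv R q 0 l) (P%:R / ratr eps)
   (ratr lam * ratr eps / 2) (3 * d%:R * rr * 8 ^+ N)).
- move=> l; rewrite hc -g0 mxE.
  have -> : P%:R / ratr eps * ratr (o_grad O q 0 l) = ratr (o_grad O q 0 l * P%:R / eps) :> R.
    by rewrite fmorph_div rmorphM /= ratr_nat mulrAC [P%:R * _]mulrC.
  by rewrite -rmorphB /= -ratr_norm -(@rmorph1 _ _ (@ratr R)) ler_rat floor_dist.
- by move=> l; rewrite [ratv R q 0 l]mxE.
- by rewrite divr_gt0.
(* The scale times the margin is P lam / 2, and dl <= lam because 1/dl >= K2 >= 1/lam. So the
   estimate made for separating vectors suffices. *)
- apply: le_trans prec _.
  have -> : P%:R / ratr eps * (ratr lam * ratr eps / 2) = P%:R * (ratr lam / 2) :> R.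
    by field; rewrite gt_eqF.
  rewrite ler_wpM2l ?ler0n // ler_wpM2r //.
  rewrite /dl -[ratr lam]invrK lef_pV2 ?posrE ?invr_gt0 ?ltr0n //.
  apply: le_trans (_ : K2%:R <= _).
    by rewrite -fmorphV -[leRHS]ratr_nat ler_rat.
  rewrite ler_nat; apply: leq_trans (_ : 2 * K1 * K2 <= _)%N.
    by rewrite leq_pmull // muln_gt0 K10.
  by rewrite /Dl -[X in (_ <= X)%N]mulnA leq_pmulr.
apply: (@quasar_cut R d X f (ratr lam) (ratr B) (ratr eps) rr dl) => //.
rewrite /dl mulrC ler_pdivrMr ?ltr0n //.
have hB : ratr B / ratr eps <= K1%:R :> R by rewrite -fmorph_div -[leRHS]ratr_nat ler_rat.
have hl : (ratr lam)^-1 <= K2%:R :> R by rewrite -fmorphV -[leRHS]ratr_nat ler_rat.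
have {}hB : ratr B <= K1%:R * ratr eps :> R by rewrite -ler_pdivrMr.
have {}hl : 1 <= K2%:R * ratr lam :> R by rewrite -ler_pdivrMr // mul1r.
have -> : Dl%:R = 2 * K1%:R * K2%:R * (d%:R + 1) * (rr + 1) :> R.
  by rewrite /Dl !natrM -[d.+1%:R]natr1 -[r.+1%:R]natr1.
have dd : 0 <= d%:R :> R by [].
have r1 : 0 <= rr by rewrite /rr.
have k1 : 0 <= K1%:R :> R by [].
have B' : 0 <= ratr B :> R by rewrite ler0q ltW.
set w' := K1%:R * ratr eps * (rr + 1).
have hw : ratr B * (rr + 1) <= w' by rewrite ler_wpM2r // addr_ge0.
have w0 : 0 <= ratr B * (rr + 1) by rewrite mulr_ge0 // addr_ge0.
apply: le_trans (_ : (d%:R + 1) * w' <= _).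
  by move: (ratr B * _) w' hw w0 => y z; nra.
have : 0 <= (d%:R + 1) * w' by rewrite mulr_ge0 ?addr_ge0 // (le_trans w0).
move=> /ler_wpM2l/(_ _ _ hl); rewrite mulr1 => /le_trans; apply.
by rewrite /w' le_eqVlt; apply/orP; left; apply/eqP; field.
Qed.

Lemma invariant_step k m v m2 v2 m3 :
  let m1 := upd_range m (2 * d) d (centroid d m (Q ^ k)%:R) in
  (k < N)%N -> invariant k m v ->
  (forall x, (3 * d <= x)%N -> m2 x = m1 x) -> asked O P eps m1 v m2 v2 ->
  (forall x, (x < d)%N -> m3 x = m2 x) -> updated d Q M m2 m3 -> invariant k.+1 m3 v2.
Proof.
move=> m1 kN [hV Xo vo hb] h2 ask h3 upd.
have vm i j : (i < d.+1)%N -> (j < d)%N -> vertex d m2 i j = vertex d m i j.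
  by move=> il jd; rewrite -(vertex_upd d m (centroid d m (Q ^ k)%:R)) /vertex h2 ?leq_vertex_addr.
have ci j : (j < d)%N -> m2 (d + j)%N \is a Num.int.
  move=> jd; case: ask => [[c' [_ hc _ _]] | [_ hc _]].
    by rewrite (hc (Ordinal jd)) intr_int.
  by rewrite (hc (Ordinal jd)) intr_int.
have o3 : read_vec d m3 0 = read_vec d m2 0.
  by apply/rowP => j; rewrite !mxE add0n h3.
have o1 : read_vec d m1 0 = read_vec d m 0.
  exact: read_vec_upd_query.
have q1 (j : 'I_d) : read_vec d m1 (2 * d) 0 j = centroid d m (Q ^ k)%:R j.
  by rewrite mxE /m1 upd_range_in.
(* The stored value never increases, so an eps-good value stays eps-good. *)
have v2v : v2 0%N <= v 0%N.
  case: ask => [[c' [_ _ -> _]] // | [_ _]].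
  by case: ifP => [h [-> _] // | _ [-> _]].
have out : X (ratv R (read_vec d m2 0)) /\ v2 0%N = f (ratv R (read_vec d m2 0)).
  case: (ask) => [[c' [_ _ -> ->]] | [eqs _]]; first by rewrite o1.
  have := sepO (read_vec d m1 (2 * d)); rewrite eqs => Xq.
  by case: ifP => _ [-> ->]; [rewrite (valO Xq) | rewrite o1].
split; rewrite ?o3; try by case: out.
  exact: updated_radius vm ci upd hV.
case: hb => [hb|[Pm bP dP]]; first by left; apply: le_trans hb.
have cuts (i : 'I_d.+1) := oracle_cut i (ltnW kN) q1 hV ask.
(* The alternatives in [cuts] are taken separately for each [i]. Deciding once whether the stored
   value is good makes the cut hold for all tracked points together. *)
have [h|h] := pselect (v2 0%N <= f xmin + ratr eps); first by left.
right; have [|Pm' bP' dP'] := updated_bary vm upd bP.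
  by move=> i; case: (cuts i).
exists Pm' => //; apply: le_trans dP'; rewrite exprSr mulrA ler_wpM2r //.
by rewrite addr_ge0 // invr_ge0 mulr_ge0 // exprn_ge0.
Qed.

Lemma invariant_final m v : invariant N m v ->
  forall x, X x -> f (ratv R (read_vec d m 0)) <= f x + ratr eps.
Proof.
move=> [_ _ <- [h x Xx'|[Pm bP dP]]]; last by case: (progress_end dP bP).
by apply: le_trans h _; rewrite lerD2r; have [[_ h'] _] := qcf; exact: h'.
Qed.
End Progress.

(** * The main loop and the sizes of its numbers *)

Definition iterate_cmd : cmd := Seq query_cmd (Seq ask_cmd update_cmd).

(** Registers 17 and 18 still hold coordinates of the initial vertices. From here on 17 is the
    counter, and 18 starts at 1 = Q^0. *)
Definition main_cmd : cmd := Seq (blk [:: Const 18 1]) (For 17 16 iterate_cmd).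

Definition iterate_time (d c : nat) : nat :=
  ((c + fill_time d (2 * d) (sum_time d.+1 c (4 * c) + c)) + (ask_time d c + update_time d c))%N.

(** The logarithm of [radius] after N steps, using n <= 2^n throughout: 8 Q = 2^8 (d+1)^3 is at most
    2^(8 + 3 (d+1)), and 2 d r is at most 2^(1 + d + r). The bounds below arise in the same way. *)
Definition vertex_bits (d r L : nat) : nat := (1 + d + r + steps d L * (8 + 3 * d.+1))%N.
Definition scale_bits (d L : nat) : nat := (steps d L * (5 + 3 * d.+1))%N.
Definition query_bits (d r L : nat) : nat :=
  (d * (vertex_bits d r L + scale_bits d L + 2 * d.+1 + 3))%N.

(* Bounds the cost of every single instruction. *)
Definition budget (ptime pbits : {poly nat}) (d r k b L : nat) : nat :=
  let N := steps d L in
  let bV := vertex_bits d r L in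
  let bS := scale_bits d L in
  let vb := query_bits d r L in
  ((d.+1 * d + 10 * d + 10) + ((bV + bS + 2 * d + 10) + ((k + 3 * (L + N) + 3) +
  ((pbits.[vb] + (3 * (L + N) + 3)) + ((1 + vb + ptime.[d + vb]) +
  ((d.+1 * d + 40 * d + 2 * (32 * d.+1 ^ 3) + 3 * (8 * d.+1 ^ 2) +
         20 * ((k + 3 * (L + N)) + bV) + bS + 60) +
  ((b + 6) + ((32 * d.+1 ^ 3 + N + L + 20) + ((3 * (L + N) + 10) +
   (d.+1 * d + 10 * d + 3 * d * r + r + 20))))))))))%N.

Lemma vertex_radius d r L k : (k <= steps d L)%N ->
  radius d r k <= 2 ^+ vertex_bits d r L.
Proof.
move=> kN; rewrite /radius /vertex_bits exprD; apply: ler_pM.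
- exact: ler0n.
- by rewrite exprn_ge0.
- rewrite -natrX ler_nat !expnD expn1 -!mulnA leq_mul2l /=.
  by rewrite leq_mul // ltnW // ltn_expl.
apply: le_trans (_ : (8 * (32 * d.+1 ^ 3))%:R ^+ steps d L <= _).
  by rewrite -!natrX ler_nat leq_pexp2l // muln_gt0 muln_gt0 expn_gt0.
rewrite [(steps d L * _)%N]mulnC exprM -!natrX ler_nat; case: (steps d L) => [|N].
  by rewrite !expn0.
rewrite leq_exp2r // expnD mulnA -[(2 ^ 8)%N]/(8 * 32)%N leq_mul2l orFb.
by rewrite [(3 * _)%N]mulnC expnM leq_exp2r // ltnW // ltn_expl.
Qed.

Lemma scale_fits d L k : (k <= steps d L)%N ->
  fits (scale_bits d L) ((32 * d.+1 ^ 3) ^ k)%:R.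
Proof.
move=> kN; split; first exact: natr_int.
rewrite ger0_norm // -natrX ler_nat /scale_bits.
apply: leq_trans (_ : (32 * d.+1 ^ 3) ^ steps d L <= _)%N.
  by rewrite leq_pexp2l // muln_gt0 expn_gt0.
rewrite [(steps d L * _)%N]mulnC expnM; case: (steps d L) => [|N].
  by rewrite !expn0.
rewrite leq_exp2r // expnD leq_mul2l orFb.
by rewrite [(3 * _)%N]mulnC expnM leq_exp2r // ltnW // ltn_expl.
Qed.

Lemma budgetP ptime pbits d r k b L c :
  let N := steps d L in
  (budget ptime pbits d r k b L <= c)%N ->
  [/\ (d.+1 * d + 10 * d + 10 <= c)%N,
      (vertex_bits d r L + scale_bits d L + 2 * d + 10 <= c)%N,
      [/\ (k + 3 * (L + N) + 3 <= c)%N,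
         (pbits.[query_bits d r L] + (3 * (L + N) + 3) <= c)%N
       & (1 + query_bits d r L + ptime.[d + query_bits d r L] <= c)%N],
      (d.+1 * d + 40 * d + 2 * (32 * d.+1 ^ 3) + 3 * (8 * d.+1 ^ 2) +
         20 * ((k + 3 * (L + N)) + vertex_bits d r L) + scale_bits d L + 60 <= c)%N
    & [/\ (b + 6 <= c)%N, (32 * d.+1 ^ 3 + N + L + 20 <= c)%N, (3 * (L + N) + 10 <= c)%N
        & (d.+1 * d + 10 * d + 3 * d * r + r + 20 <= c)%N] ].
Proof.
have addn_leq x y z : (x + y <= z)%N -> (x <= z)%N /\ (y <= z)%N.
  by move=> h; split; apply: leq_trans h; rewrite ?leq_addr ?leq_addl.
move=> N; rewrite /budget -/N.
by do 9![move=> /addn_leq[?]].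
Qed.

Lemma norm_entry (R : realType) d (x : 'rV[R]_d) j : `|x 0 j| <= `|x|.
Proof.
rewrite [leRHS]mx_normrE.
exact: (@le_bigmax _ _ _ 0 (fun ij : 'I_1 * 'I_d => `|x ij.1 ij.2|) (0, j)).
Qed.

Section Main.
Context (R : realType) (d : nat) (X : set 'rV[R]_d) (f : 'rV[R]_d -> R) (O : oracles R d).
Variables (lam eps B : rat) (xmin : 'rV[R]_d) (r K1 K2 L k1 b : nat) (ptime pbits : {poly nat}).
Variable (c : nat).

Let N := steps d L.

Hypotheses (d0 : (0 < d)%N) (r0 : (0 < r)%N) (K10 : (0 < K1)%N) (K20 : (0 < K2)%N).
Hypotheses (hK1 : B / eps <= K1%:R) (hK2 : lam^-1 <= K2%:R) (k1P : (K1 <= 2 ^ k1)%N).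
Hypotheses (cX : convex_set X) (bX : eball 1 `<=` X) (Xr : X `<=` eball r%:R).
Hypotheses (lam01 : 0 < lam <= 1) (eps0 : 0 < eps) (B0 : 0 < B).
Hypothesis L0 : (0 < L)%N.
Hypothesis hL : (4 * d.+1 * r * (2 * K1 * K2 * d.+1 * r.+1) < 2 ^ L)%N.
Hypothesis sepO : separation_oracle X (o_sep O).
Hypothesis qcf : quasar_convex X f (ratr lam) xmin.
Hypothesis gradO : gradient_oracle X f ptime pbits O.
Hypothesis gradB : forall x, X x -> enorm (grad f x) <= ratr B.
Hypothesis valO : value_oracle X f (o_val O).
Hypothesis budget_c : (budget ptime pbits d r k1 b L <= c)%N.

Notation bV := (vertex_bits d r L).
Notation bS := (scale_bits d L).
Notation vb := (query_bits d r L).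

Let precision_fits : fits (3 * (L + N)) (8 ^ (L + N))%:R.
Proof. by split; [exact: natr_int|rewrite ger0_norm // exprM -!natrX]. Qed.

(** The counter register is given an arbitrary content [q0], because the enclosing loop changes it
    between rounds. *)
Lemma iterate_runs k q0 m v s : (k < N)%N ->
  invariant X f eps xmin r K1 K2 k m v ->
  at_state (params d lam eps B L ++ [:: q0; ((32 * d.+1 ^ 3) ^ k)%:R]) m v s ->
  runs O iterate_cmd s (iterate_time d c)
    (fun s' => exists m' v', invariant X f eps xmin r K1 K2 k.+1 m' v' /\
      at_state (params d lam eps B L ++ [:: q0; ((32 * d.+1 ^ 3) ^ k.+1)%:R]) m' v' s').
Proof.
move=> kN inv h0; have [hV _ _ _] := inv.
have fV i j : (i < d.+1)%N -> (j < d)%N -> fits bV (vertex d m i j).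
  move=> il jd; have [h1 h2] := hV i j il jd; split=> //.
  exact: le_trans h2 (vertex_radius _ (ltnW kN)).
have fS := scale_fits (ltnW kN).
have [f1' f2 [f5 f6 f7] f8 _] := budgetP budget_c.
have f1 : (d.+1 * d + 10 * d + 4 <= c)%N by apply: leq_trans f1'; rewrite leq_add2l.
have f3 : (10 * d + 4 <= c)%N by apply: leq_trans f1; rewrite -addnA leq_addl.
have f4 : (3 * (L + N) + 3 <= c)%N by apply: leq_trans f5; rewrite -addnA leq_addl.
set E := params d lam eps B L in h0 *.
rewrite /iterate_time.
apply: (runs_seq (Q1 := at_state (E ++ [:: q0; ((32 * d.+1 ^ 3) ^ k)%:R])
    (upd_range m (2 * d) d (centroid d m ((32 * d.+1 ^ 3) ^ k)%:R)) v)).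
  apply: (runs_weaken (query_runs O d0 f1 f2 fS fV h0)) => // s1 h1.
  by case/(@at_rcons _ (E ++ [:: q0; ((32 * d.+1 ^ 3) ^ k)%:R])): h1.
set m1 := upd_range _ _ _ _ => s1 h1.
have qE (j : 'I_d) : read_vec d m1 (2 * d) 0 j = centroid d m ((32 * d.+1 ^ 3) ^ k)%:R j.
  by rewrite mxE /m1 upd_range_in.
have qbits : (vec_bits (read_vec d m1 (2 * d)) <= vb)%N.
  rewrite /vec_bits /query_bits -[X in (_ <= X * _)%N]card_ord -sum_nat_const.
  apply: leq_sum => j _; rewrite qE /centroid.
  have fs : fits (bV + d.+1) (\sum_(i < d.+1) vertex d m i j).
    by apply: (@fits_sum _ _ (fun i => vertex d m i j)) => i il; apply: fV.
  by apply: leq_trans (rat_bits_div fs (fitsM (fits_nat d.+1) fS)) _; clear; lia.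
have Xq : o_sep O (read_vec d m1 (2 * d)) = None -> X (ratv R (read_vec d m1 (2 * d))).
  by move=> e; have := sepO (read_vec d m1 (2 * d)); rewrite e.
have PK : (K1 * 8 ^ (L + N))%:R <= 2 ^+ (k1 + 3 * (L + N)) :> rat.
  by rewrite -natrX ler_nat (expnD 2 k1) (expnM 2 3) leq_mul.
have sepB c' : o_sep O (read_vec d m1 (2 * d)) = Some c' -> forall j, `|c' 0 j| <= 1.
  move=> e j; have := sepO (read_vec d m1 (2 * d)); rewrite e => -[c1 _].
  have := norm_entry (ratv R c') j; rewrite c1 mxE.
  by rewrite -ratr_norm -(@rmorph1 _ _ (@ratr R)) ler_rat.
(* Each gradient entry is at most B in absolute value, so divided by eps it is at most K1. The size
   of the rounded gradient thus depends on the logarithm of B/eps only. *)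
have gB : o_sep O (read_vec d m1 (2 * d)) = None -> forall j,
    `|o_grad O (read_vec d m1 (2 * d)) 0 j * (8 ^ (L + N))%:R / eps| <= 2 ^+ (k1 + 3 * (L + N)).
  move=> e j; have [g1 _ _] := gradO (Xq e).
  apply: le_trans PK; rewrite natrM mulrAC normrM [`|_%:R|]ger0_norm //.
  rewrite ler_wpM2r // normrM [`|eps^-1|]ger0_norm ?invr_ge0 ?(ltW eps0) //.
  rewrite ler_pdivrMr //; apply: (@le_trans _ _ B); last by rewrite -ler_pdivrMr.
  have : `|grad f (ratv R (read_vec d m1 (2 * d))) 0 j| <= ratr B.
    by apply: enorm_coord; apply: gradB; exact: Xq.
  by rewrite -g1 mxE -ratr_norm ler_rat.
apply: runs_seq.
  apply: (@ask_runs _ _ O N (32 * d.+1 ^ 3) (8 * d.+1 ^ 2) (8 ^ (L + N)) lam eps B c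
    (3 * (L + N)) q0 ((32 * d.+1 ^ 3) ^ k)%:R m1 v s1 (k1 + 3 * (L + N)) pbits.[vb] vb
    ptime.[d + vb] d0 f3 f4 f5 f6 f7 precision_fits qbits sepB _ h1).
  move=> e; have [g1 g2 g3] := gradO (Xq e); split.
    by apply: leq_trans g2 _; apply: horner_leq; rewrite leq_add2l.
  move=> j; split; first exact: gB.
  apply: leq_trans (leq_trans g3 (horner_leq _ qbits)).
  by rewrite /vec_bits (bigD1 j) //= leq_addr.
move=> s2 [m2 [v2 [h2 m2E ask]]].
have fC j : (j < d)%N -> fits (k1 + 3 * (L + N)) (m2 (d + j)%N).
  move=> jd; case: ask => [[c' [e hc _ _]] | [e hc _]].
    rewrite (hc (Ordinal jd)); apply: fits_floor; rewrite invrK normrM.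
    apply: (@le_trans _ _ (2 ^+ (3 * (L + N)))); last by rewrite ler_weXn2l ?ler1n // leq_addl.
    by rewrite -[leRHS]mul1r ler_pM ?sepB //; case: precision_fits.
  by rewrite (hc (Ordinal jd)); apply: fits_floor; exact: gB.
have vm i j : vertex d m2 i j = vertex d m i j.
  by rewrite /vertex m2E ?leq_vertex_addr // -/(vertex d m1 i j) vertex_upd.
apply: (runs_weaken (@update_runs _ _ O N (32 * d.+1 ^ 3) (8 * d.+1 ^ 2) (8 ^ (L + N)) lam eps B c
    q0 ((32 * d.+1 ^ 3) ^ k)%:R m2 v2 s2 (k1 + 3 * (L + N)) bV bS d0 f8 fS fC _ h2)) => //.
  by move=> i j il jd; rewrite vm; apply: fV.
move=> s3 [m3 [h3 m3E upd]]; exists m3, v2; split.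
  exact: (invariant_step d0 r0 K10 K20 hK1 hK2 cX bX Xr lam01 eps0 B0 hL sepO qcf
    (fun q Xq => let: And3 h _ _ := gradO Xq in h) gradB valO kN inv m2E ask m3E upd).
by rewrite expnS natrM.
Qed.
End Main.

(** The coefficients of the radius polynomial are constants of the program. The polynomials that
    bound the gradient oracle do not occur in it; they affect only the time bound. *)
Definition algorithm (prad : {poly nat}) : cmd :=
  Seq constants_cmd (Seq (horner_cmd prad) (Seq threshold_cmd (Seq log_cmd
    (Seq parameters_cmd (Seq precision_cmd (Seq init_vertices_cmd main_cmd)))))).

Definition total_time (sz d b L c : nat) : nat :=
  (10 * c + (sz * (3 * c) + (17 * c + (b.+2 * (2 * c + 1) + (13 * c +
    ((for_time (L + steps d L) c + c) +
    ((6 * c + fill_time (d.+1 * d) (6 * d) (5 * c + (1 * c).+2)) +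
     (c + for_time (steps d L) (iterate_time d c)))))))))%N.

(** Bounds the logarithm of 4 (d+1) r / dl. The dimension and the radius enter linearly, through n
    <= 2^n, which is good enough for a polynomial bound; K1 and K2 must enter by their
    logarithms. *)
Definition threshold_bits (d r k1 k2 : nat) : nat :=
  (2 + d.+1 + r + (1 + k1 + k2 + d.+1 + r.+1))%N.

Lemma threshold_le d r K1 K2 k1 k2 : (K1 <= 2 ^ k1)%N -> (K2 <= 2 ^ k2)%N ->
  (4 * d.+1 * r * (2 * K1 * K2 * d.+1 * r.+1) <= 2 ^ threshold_bits d r k1 k2)%N.
Proof.
move=> h1 h2; rewrite /threshold_bits !expnD expn1.
have self n : (n <= 2 ^ n)%N by rewrite ltnW // ltn_expl.
by rewrite !leq_mul ?self.
Qed.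

(** * Monotonicity of the bounds in all parameters *)

Lemma leq_expn_l m n e : (m <= n)%N -> (m ^ e <= n ^ e)%N.
Proof. by move=> h; case: e => // e; rewrite leq_exp2r. Qed.

Lemma leqSS m n : (m <= n)%N -> (m.+1 <= n.+1)%N. Proof. by []. Qed.

Ltac mono := repeat first
  [ assumption | apply: leqnn
  | match goal with
    | |- is_true (_ + _ <= _ + _)%N => apply: leq_add
    | |- is_true ((_ + _)%R <= (_ + _)%R)%N => apply: leq_add
    | |- is_true (_ * _ <= _ * _)%N => apply: leq_mul
    | |- is_true (_ ^ _ <= _ ^ _)%N => apply: leq_expn_l
    | |- is_true (_.[_] <= _.[_])%N => apply: horner_leq
    | |- is_true (_.+1 <= _.+1)%N => apply: leqSS
    end ].

Lemma steps_leq d d' L L' : (d <= d')%N -> (L <= L')%N -> (steps d L <= steps d' L')%N.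
Proof. by move=> ? ?; rewrite /steps; mono. Qed.

Lemma vertex_bits_leq d d' r r' L L' : (d <= d')%N -> (r <= r')%N -> (L <= L')%N ->
  (vertex_bits d r L <= vertex_bits d' r' L')%N.
Proof. by move=> hd ? hL; have ? := steps_leq hd hL; rewrite /vertex_bits; mono. Qed.

Lemma scale_bits_leq d d' L L' : (d <= d')%N -> (L <= L')%N ->
  (scale_bits d L <= scale_bits d' L')%N.
Proof. by move=> hd hL; have ? := steps_leq hd hL; rewrite /scale_bits; mono. Qed.

Lemma query_bits_leq d d' r r' L L' : (d <= d')%N -> (r <= r')%N -> (L <= L')%N ->
  (query_bits d r L <= query_bits d' r' L')%N.
Proof.
move=> hd hr hL; have ? := vertex_bits_leq hd hr hL; have ? := scale_bits_leq hd hL.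
by rewrite /query_bits; mono.
Qed.

Lemma threshold_bits_leq d d' r r' k k' l l' :
  (d <= d')%N -> (r <= r')%N -> (k <= k')%N -> (l <= l')%N ->
  (threshold_bits d r k l <= threshold_bits d' r' k' l')%N.
Proof. by move=> ? ? ? ?; rewrite /threshold_bits; mono. Qed.

Lemma budget_leq ptime pbits d d' r r' k k' b b' L L' :
  (d <= d')%N -> (r <= r')%N -> (k <= k')%N -> (b <= b')%N -> (L <= L')%N ->
  (budget ptime pbits d r k b L <= budget ptime pbits d' r' k' b' L')%N.
Proof.
move=> hd hr hk hb hL; have ? := vertex_bits_leq hd hr hL; have ? := scale_bits_leq hd hL.
have ? := query_bits_leq hd hr hL; have ? := steps_leq hd hL.
by rewrite /budget; mono.
Qed.

Lemma for_time_leq n n' t t' : (n <= n')%N -> (t <= t')%N -> (for_time n t <= for_time n' t')%N.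
Proof. by move=> ? ?; rewrite /for_time; mono. Qed.

Lemma total_time_leq sz d d' b b' L L' c c' :
  (d <= d')%N -> (b <= b')%N -> (L <= L')%N -> (c <= c')%N ->
  (total_time sz d b L c <= total_time sz d' b' L' c')%N.
Proof.
move=> hd hb hL hc; have ? := steps_leq hd hL.
rewrite /total_time /iterate_time /ask_time /update_time /fill_time /sum_time /for_time.
by mono.
Qed.

(** * The whole program *)

Section Correctness.
Context (R : realType) (d : nat) (X : set 'rV[R]_d) (f : 'rV[R]_d -> R) (O : oracles R d).
Variables (prad ptime pbits : {poly nat}).
Variables (lam eps B : rat) (xmin : 'rV[R]_d) (K1 K2 k1 k2 : nat).
Variable (c : nat).

Let r := prad.[d].+1.
Let b := threshold_bits d r k1 k2.

Hypotheses (d0 : (0 < d)%N) (K10 : (0 < K1)%N) (K20 : (0 < K2)%N).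
Hypotheses (fK1 : (Num.floor (B / eps))%:~R + 1 = K1%:R :> rat).
Hypotheses (fK2 : (Num.floor lam^-1)%:~R + 1 = K2%:R :> rat).
Hypotheses (k1P : (K1 <= 2 ^ k1)%N) (k2P : (K2 <= 2 ^ k2)%N).
Hypotheses (cX : convex_set X) (bX : eball 1 `<=` X) (Xr : X `<=` eball r%:R).
Hypotheses (lam01 : 0 < lam <= 1) (eps0 : 0 < eps) (B0 : 0 < B).
Hypothesis sepO : separation_oracle X (o_sep O).
Hypothesis qcf : quasar_convex X f (ratr lam) xmin.
Hypothesis gradO : gradient_oracle X f ptime pbits O.
Hypothesis gradB : forall x, X x -> enorm (grad f x) <= ratr B.
Hypothesis valO : value_oracle X f (o_val O).
Hypothesis budget_c : forall L, (L <= b.+1)%N -> (budget ptime pbits d r k1 b L <= c)%N.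

Let floor_ltS (x : rat) K : (Num.floor x)%:~R + 1 = K%:R :> rat -> x <= K%:R.
Proof. by move=> <-; have /andP[_] := floor_itv x; rewrite intrD => /ltW. Qed.

Lemma main_runs L s m v :
  (0 < L <= b.+1)%N -> (4 * d.+1 * r * (2 * K1 * K2 * d.+1 * r.+1) < 2 ^ L)%N ->
  invariant X f eps xmin r K1 K2 0 m v ->
  at_state (params d lam eps B L ++ [:: - r%:R; 2 * d%:R * r%:R - r%:R]) m v s ->
  runs O main_cmd s (c + for_time (steps d L) (iterate_time d c))
    (fun s' => X (ratv R (output d s')) /\
       forall x, X x -> f (ratv R (output d s')) <= f x + ratr eps).
Proof.
move=> /andP[L0 Lb] hL inv0 h0; have bL := budget_c Lb.
have N0 : (0 < steps d L)%N by rewrite /steps muln_gt0 L0 muln_gt0 expn_gt0.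
have cb4 : (4 <= c)%N.
  by have [h _ _ _ _] := budgetP bL; apply: leq_trans h; rewrite (leq_trans _ (leq_addl _ _)).
set E := params d lam eps B L in h0 *.
apply: (runs_seq (Q1 := at_state (E ++ [:: - r%:R; 1]) m v)).
  rewrite -[c]mul1n; apply: runs_blk.
    by split=> //; rewrite /= (_ : rat_bits 1 = 3%N) // ltnW.
  apply/(@at_rcons _ (E ++ [:: - r%:R])); split=> //.
  by apply: at_set_reg => //; case/(@at_rcons _ (E ++ [:: - r%:R])): h0.
move=> s1 h1.
pose I k s' := exists q0 m' v', invariant X f eps xmin r K1 K2 k m' v' /\
  at_state (E ++ [:: q0; ((32 * d.+1 ^ 3) ^ k)%:R]) m' v' s'.
apply: (runs_weaken (t := for_time (steps d L) (iterate_time d c)) (Q := I (steps d L))) => //;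
  last first.
  move=> s' [q0 [m' [v' [inv h]]]]; have [_ hm _] := h.
  have [_ Xo _ _] := inv; rewrite /output hm; split=> // x Xx.
  exact: (invariant_final d0 (ltn0Sn _) K10 K20 hL qcf inv Xx).
apply: (runs_for (I := I)) => //.
- by move=> k s' [q0 [m' [v' [_ h]]]]; rewrite !(at_reg h).
- move=> k s' q [q0 [m' [v' [inv h]]]]; exists q, m', v'; split=> //.
  case/(@at_rcons _ (E ++ [:: q0])): h => /(@at_rcons _ E)[h _] hS.
  apply/(@at_rcons _ (E ++ [:: q])); split; last exact: hS.
  by apply/(@at_rcons _ E); split; first exact: at_set_reg.
- move=> k s' kN [q0 [m' [v' [inv h]]]] hk.
  have q0E : q0 = k%:R by rewrite -hk (at_reg h).
  apply: (runs_weaken (@iterate_runs _ _ _ _ _ lam eps B xmin r K1 K2 L k1 b ptime pbits c d0 (ltn0Sn _)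
    K10 K20 (floor_ltS fK1) (floor_ltS fK2) k1P cX bX Xr lam01 eps0 B0 hL sepO qcf gradO gradB valO
    bL k q0 m' v' s' kN inv h)) => //.
  move=> s2 [m2 [v2 [inv2 h2]]]; split; first by exists q0, m2, v2.
  by rewrite (at_reg h2).
- by exists (- r%:R), m, v.
Qed.

(** The number L is found at run time, and only 0 < L <= b + 1 is known beforehand. The stages after
    the logarithm are analysed with the actual L, and their time is then bounded by its value at b +
    1. *)
Lemma algorithm_runs :
  runs O (algorithm prad) (init R d lam eps B) (total_time (size prad) d b b.+1 c)
    (fun s => X (ratv R (output d s)) /\
       forall x, X x -> f (ratv R (output d s)) <= f x + ratr eps).
Proof.
have [g1 _ _ _ [g2 _ _ _]] := budgetP (budget_c (leqnn _)).
have g0 : (horner_rec prad d + 3 <= c)%N.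
  have [_ _ _ _ [_ _ _ h]] := budgetP (budget_c (leqnn _)).
  rewrite -[horner_rec prad d]/(prad.[d]); apply: leq_trans h.
  by apply: leq_add => //; apply: leq_trans (leq_addl _ _); exact: leqnSn.
have hX : (4 * d.+1 * r * (2 * K1 * K2 * d.+1 * (r + 1)) <= 2 ^ b)%N.
  by rewrite addn1; exact: threshold_le.
rewrite /total_time.
apply: (runs_seq (constants_runs O lam eps B d0 g1)) => s1 [h1 r1].
apply: (runs_seq (horner_runs O d0 g0 h1 r1)) => s2 [h2 r2].
apply: (runs_seq (threshold_runs O hX (leq_trans _ g2) K10 K20 fK1 fK2 h2 r2)) => //.
  by rewrite leq_add2l.
move=> s3 [h3 r3 t3 t3' t3''].
have X0 : (0 < 4 * d.+1 * r * (2 * K1 * K2 * d.+1 * (r + 1)))%N.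
  by rewrite !muln_gt0 K10 K20 addn1.
apply: (runs_seq (log_runs O X0 hX g2 h3 r3 t3 t3' t3'')) => s4 [L [h4 r4 L4 hL Lb]].
have L0 : (0 < L)%N by case: L hL {h4 L4 Lb} => //; rewrite expn0 ltnS leqn0 => /eqP h; rewrite h in X0.
have [_ _ _ _ [_ q1 q2 q3]] := budgetP (budget_c Lb).
have nL := steps_leq (leqnn d) Lb.
apply: (@runs_weaken _ _ _ _ _ (13 * c + ((for_time (L + steps d L) c + c) +
    ((6 * c + fill_time (d.+1 * d) (6 * d) (5 * c + (1 * c).+2)) +
     (c + for_time (steps d L) (iterate_time d c)))))); last by move=> s' h; exact: h.
  apply: (runs_seq (parameters_runs O L0 q1 h4 r4 L4)) => s5 [h5 [a5 b5]].
  apply: (runs_seq (precision_runs O L0 q2 h5 a5 b5)) => s6 [h6 r6].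
  apply: (runs_seq (init_vertices_runs O d0 q3 h6 r6)) => s7 h7.
  rewrite addn1 in hL; apply: (main_runs _ hL _ h7); first by rewrite L0.
  apply: (invariant_init (lam := lam) eps d0 (ltn0Sn _) K10 K20 cX bX Xr qcf).
  - move=> i j il jd; rewrite /vertex upd_range_in; last first.
      by rewrite mulSn addnC -addSn leq_add // leq_mul2r -ltnS il orbT.
    by rewrite divnMDl // modnMDl divn_small // modn_small // addn0 addn1.
  - rewrite read_vec_out; first by apply/rowP => j; rewrite !mxE.
    by rewrite add0n leq_pmull.
  - have z0 : ratv R (0 : 'rV[rat]_d) = 0 by apply/rowP => j; rewrite !mxE rmorph0.
    rewrite /= valO z0 //; apply: bX; rewrite /eball /= /enorm /dot big1 ?sqrtr0 // => i _.
    by rewrite mxE mulr0.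
rewrite leq_add2l leq_add //; last by rewrite leq_add2l leq_add2l for_time_leq.
by rewrite leq_add2r for_time_leq // leq_add.
Qed.
End Correctness.

(** * A single polynomial for the running time *)

Lemma polyboundedS g : polybounded g -> polybounded (fun x => (g x).+1).
Proof.
move=> /(polyboundedD (polybounded_cst 1)) [T hT]; exists T => x; exact: hT.
Qed.

Ltac polybound := repeat match goal with
  | |- polybounded (fun x => (_ + _)%N) => apply: polyboundedD
  | |- polybounded (fun x => (_ + _)%R) => apply: polyboundedD
  | |- polybounded (fun x => (_ * _)%N) => apply: polyboundedM
  | |- polybounded (fun x => (_ ^ _)%N) => apply: polyboundedX
  | |- polybounded (fun x => _.[_]) => apply: polybounded_horner
  | |- polybounded (fun x => x) => exact: polybounded_id
  | |- polybounded (fun x => ?a) => exact: polybounded_cst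
  | |- polybounded (fun x => _.+1) => apply: polyboundedS
  | |- polybounded (addn ?a) => exact: (polyboundedD (polybounded_cst a) polybounded_id)
  | |- polybounded (muln ?a) => exact: (polyboundedM (polybounded_cst a) polybounded_id)
  | |- polybounded succn => exact: (polyboundedS polybounded_id)
  | |- polybounded (horner ?p) => exact: (polybounded_horner p polybounded_id)
  | |- polybounded _ => assumption
  end.

(** All parameters are replaced by functions of one variable x that dominates the dimension and both
    logarithms; x + 1 stands for the logarithms of K1 and K2. *)
Lemma total_time_polybounded sz (prad ptime pbits : {poly nat}) :
  let b x := threshold_bits x prad.[x].+1 x.+1 x.+1 in
  polybounded (fun x => total_time sz x (b x) (b x).+1
    (budget ptime pbits x prad.[x].+1 x.+1 (b x) (b x).+1)).
Proof.
move=> b.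
have hb : polybounded b by rewrite /b /threshold_bits; polybound.
have hN : polybounded (fun x => steps x (b x).+1) by rewrite /steps; polybound.
have hV : polybounded (fun x => vertex_bits x prad.[x].+1 (b x).+1).
  by rewrite /vertex_bits; polybound.
have hS : polybounded (fun x => scale_bits x (b x).+1) by rewrite /scale_bits; polybound.
have hq : polybounded (fun x => query_bits x prad.[x].+1 (b x).+1).
  by rewrite /query_bits; polybound.
have hc : polybounded (fun x => budget ptime pbits x prad.[x].+1 x.+1 (b x) (b x).+1).
  by rewrite /budget; polybound.
rewrite /total_time /iterate_time /ask_time /update_time /fill_time /sum_time /for_time.
by polybound.
Qed.

(** Adding 1 to the floor at most doubles the power of two that bounds it, which is the extra unit
    in the exponent. *)
Lemma floor_log2c (q : rat) : 0 < q ->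
  (Num.floor q)%:~R + 1 = (`|Num.floor q|%N.+1)%:R :> rat /\
  (`|Num.floor q|%N.+1 <= 2 ^ (log2c q).+1)%N.
Proof.
move=> q0; have f0 : 0 <= Num.floor q by rewrite floor_ge0 ltW.
split; first by rewrite -natr1 pmulrn gez0_abs.
have h : (`|Num.floor q| <= `|Num.ceil q|)%N.
  have fc : Num.floor q <= Num.ceil q by rewrite -(ler_int rat) (le_trans (floor_le _)) // ceil_ge.
  by rewrite -lez_nat !gez0_abs // (le_trans f0).
have := leq_trans h (up_logP `|Num.ceil q| (isT : 1 < 2)%N).
rewrite -/(log2c q) expnS mul2n -addnn => h1.
by rewrite -[_.+1]addn1 leq_add // expn_gt0.
Qed.

Theorem theorem1p10 (R : realType) (prad : {poly nat}) :
  exists M : cmd,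
  forall ptime pbits : {poly nat},
  exists T : {poly nat},
  forall (d : nat) (X : set 'rV[R]_d) (rad : R) (f : 'rV[R]_d -> R)
         (lam eps B : rat) (O : oracles R d),
    (0 < d)%N ->
    convex_set X -> compact X -> isotropic X ->
    eball 1 `<=` X -> X `<=` eball rad -> rad <= (prad.[d])%:R ->
    separation_oracle X (o_sep O) ->
    0 < lam <= 1 -> 0 < eps -> 0 < B ->
    (exists U : set 'rV[R]_d,
      [/\ open U, X `<=` U & forall x, U x -> differentiable f x]) ->
    (exists xmin : 'rV[R]_d, quasar_convex X f (ratr lam) xmin) ->
    gradient_oracle X f ptime pbits O ->
    (forall x, X x -> enorm (grad f x) <= ratr B) ->
    value_oracle X f (o_val O) ->
    exists (n : nat) (s : state R),
      [/\ exec O M (init R d lam eps B) n s,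
          (n <= T.[d + log2c (B / eps) + log2c lam^-1])%N,
          X (ratv R (output d s))
        & forall x', X x' -> f (ratv R (output d s)) <= f x' + ratr eps].
Proof.
exists (algorithm prad) => ptime pbits.
have [T hT] := total_time_polybounded (size prad) prad ptime pbits.
exists T => d X rad f lam eps B O d0 cX _ _ bX Xrad radP sepO lam01 eps0 B0 _ [xmin qcf] gO gB vO.
have Be : 0 < B / eps by rewrite divr_gt0.
have lam0 : 0 < lam^-1 by rewrite invr_gt0; case/andP: lam01.
have [fK1 k1P] := floor_log2c Be; have [fK2 k2P] := floor_log2c lam0.
have Xr : X `<=` eball (prad.[d].+1)%:R.
  move=> x /Xrad; rewrite /eball /= => h; apply: le_trans h (le_trans radP _).
  by rewrite ler_nat.
(* By monotonicity each of the three summands may be replaced by their sum, which leaves a bound in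
   one variable. *)
set x := (d + log2c (B / eps) + log2c lam^-1)%N in hT *.
have dx : (d <= x)%N by rewrite /x -addnA leq_addr.
have rx : (prad.[d].+1 <= prad.[x].+1)%N by apply: horner_leq.
have k1x : ((log2c (B / eps)).+1 <= x.+1)%N by rewrite ltnS /x -addnA addnCA leq_addr.
have k2x : ((log2c lam^-1).+1 <= x.+1)%N by rewrite ltnS /x leq_addl.
have bx := threshold_bits_leq dx rx k1x k2x.
set c := budget ptime pbits x prad.[x].+1 x.+1 (threshold_bits x prad.[x].+1 x.+1 x.+1)
  (threshold_bits x prad.[x].+1 x.+1 x.+1).+1.
have [|n [s [e nt [Xo fo]]]] := @algorithm_runs R d X f O prad ptime pbits lam eps B xmin
  _ _ _ _ c d0 (ltn0Sn _) (ltn0Sn _) fK1 fK2 k1P k2P cX bX Xr lam01 eps0 B0 sepO qcf gO gB vO.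
  by move=> L Lb; apply: budget_leq => //; apply: leq_trans Lb _; apply: leqSS.
exists n, s; split=> //; apply: leq_trans nt (leq_trans _ (hT x)).
by apply: total_time_leq => //; apply: leqSS.
Qed.
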